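(* Let $\phi\in\mathrm{Rat}(\mathbb{U})$ have degree $d$. (a) If $\phi$ is outer regular, then $\phi_e^{-1}$ has $d$ distinct branches $\sigma_1,\dots,\sigma_d$ that are holomorphic on $\mathbb{U}$ and map $\mathbb{U}$ into $\mathbb{U}$, the functions $h_j(z)=z\sigma_j'(z)$ are bounded and holomorphic on $\mathbb{U}$, all operators below are bounded on $H^2$, and $$C_\phi^*=\Lambda_0+\sum_{j=1}^d M_{h_j}C_{\sigma_j}B \quad\text{on } H^2.$$ (b) If, in addition, $\phi$ is strongly outer regular, then moreover $\Lambda_\infty$ is a bounded operator on $H^2$, the functions $g_j(z)=z\sigma_j'(z)/\sigma_j(z)$ are bounded and holomorphic on $\mathbb{U}$, and $$C_\phi^*=\Lambda_\infty+\sum_{j=1}^d M_{g_j}C_{\sigma_j}\quad\text{on } H^2,$$ with all operators on the right bounded on $H^2$.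
   Context: $\mathbb{U}$ is the open unit disc, $\hat{\mathbb{C}}$ the Riemann sphere. $\mathrm{Rat}(\mathbb{U})$ is the set of rational functions mapping $\mathbb{U}$ into itself, regarded as maps $\hat{\mathbb{C}}\to\hat{\mathbb{C}}$; the degree of $p/q$ (relatively prime polynomials) is $\max(\deg p,\deg q)$. $\rho(z)=1/\overline z$ and $\phi_e:=\rho\circ\phi\circ\rho$. A point $w$ is a regular value of a rational function $R$ of degree $d$ if $R^{-1}(\{w\})$ consists of $d$ distinct points, otherwise a critical value; a branch of $R^{-1}$ on an open set $\Omega$ is a holomorphic $\sigma$ on $\Omega$ with $R\circ\sigma=\mathrm{id}_\Omega$. $\phi$ is outer regular if all its critical values lie in $\mathbb{U}$ (every point of $\{|z|\ge1\}\cup\{\infty\}$ is a regular value of $\phi$), and strongly outer regular if in addition $\phi(\infty)\in\mathbb{U}$. $H^2$ is the Hardy space on $\mathbb{U}$ (holomorphic $f=\sum\hat f(n)z^n$ with $\sum|\hat f(n)|^2<\infty$), $C_\psi f=f\circ\psi$, $C_\phi^*$ is the adjoint of $C_\phi$ on $H^2$, $M_g f=gf$, $B$ is the backward shift $(Bf)(z)=(f(z)-f(0))/z$ ($z\ne0$), $(Bf)(0)=f'(0)$. $\Lambda_0 f(z)=f(0)/(1-\overline{\phi(0)}z)$ and $\Lambda_\infty f(z)=f(0)/(1-\overline{\phi(\infty)}z)$. *)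

(* Defs.v *)
(* MathComp 2.5 + MathComp-Analysis 1.16 + real-closed's complex numbers. *)
From HB Require Import structures.
From mathcomp Require Import all_boot all_order all_algebra.
From mathcomp Require Import all_classical all_reals all_analysis.
From mathcomp Require Import complex.
From Stdlib Require Import ClassicalEpsilon.
Import Order.TTheory GRing.Theory Num.Theory.
Import numFieldNormedType.Exports.

Set Implicit Arguments.
Unset Strict Implicit.
Unset Printing Implicit Defensive.

Local Open Scope ring_scope.
Local Open Scope classical_set_scope.

(* The complex numbers: R[i] for a real number type R. *)
Definition CC (R : realType) : numClosedFieldType := R[i].

Section Defs.
Variable R : realType.
Local Notation C := (CC R).

(* Riemann sphere: [Some z] is the finite point z, [None] is infinity. *)
Definition sphere := option C.

(* The rational function p/q (p, q relatively prime, q <> 0) acting on the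
   Riemann sphere. *)
Definition rat_eval (p q : {poly C}) (w : sphere) : sphere :=
  match w with
  | Some z => if q.[z] == 0 then None else Some (p.[z] / q.[z])
  | None => if (size q < size p)%N then None
            else if (size p < size q)%N then Some 0
            else Some (lead_coef p / lead_coef q)
  end.

(* degree of p/q = max (deg p, deg q) *)
Definition rat_deg (p q : {poly C}) : nat := maxn (size p).-1 (size q).-1.

(* p/q is a rational function mapping the unit disc U into itself *)
Definition maps_disc_into_disc (p q : {poly C}) : Prop :=
  forall z : C, `|z| < 1 -> exists2 w, rat_eval p q (Some z) = Some w & `|w| < 1.

(* the restriction of p/q to finite points (used on U, where it is finite) *)
Definition phi_fun (p q : {poly C}) (z : C) : C := odflt 0 (rat_eval p q (Some z)).

(* w is a regular value: its preimage consists of exactly deg distinct points *)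
Definition regular_value (p q : {poly C}) (w : sphere) : Prop :=
  exists s : seq sphere, [/\ uniq s, size s = rat_deg p q &
                           forall z, (z \in s) <-> rat_eval p q z = w].

(* every point of {|z| >= 1} u {oo} is a regular value *)
Definition outer_regular (p q : {poly C}) : Prop :=
  forall w : sphere,
    match w return Prop with None => True | Some z => 1 <= `|z| end -> regular_value p q w.

Definition strongly_outer_regular (p q : {poly C}) : Prop :=
  outer_regular p q /\ exists2 w, rat_eval p q None = Some w & `|w| < 1.

(* rho(z) = 1 / conj z on the sphere *)
Definition rho (w : sphere) : sphere :=
  match w with
  | None => Some 0
  | Some z => if z == 0 then None else Some ((z^*)^-1)
  end.

(* phi_e = rho o phi o rho *)
Definition rat_eval_e (p q : {poly C}) (w : sphere) : sphere :=
  rho (rat_eval p q (rho w)).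

Definition holo_on_disc (f : C -> C) : Prop :=
  forall z : C, `|z| < 1 -> derivable f z 1.

Definition bounded_on_disc (f : C -> C) : Prop :=
  exists M : C, forall z : C, `|z| < 1 -> `|f z| <= M.

(* s is a (finite-valued) branch of phi_e^{-1} on U *)
Definition branch_e_on_disc (p q : {poly C}) (s : C -> C) : Prop :=
  holo_on_disc s /\ forall z : C, `|z| < 1 -> rat_eval_e p q (Some (s z)) = Some z.

(* Hardy space H^2 *)
Definition H2coef_of (f : C -> C) (a : nat -> C) : Prop :=
  cvgn (series (fun n => `|a n| ^+ 2)) /\
  forall z : C, `|z| < 1 -> series (fun n => a n * z ^+ n) @ \oo --> f z.

Definition inH2 (f : C -> C) : Prop := exists a, H2coef_of f a.

(* the Taylor coefficients \hat f(n) *)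
Definition H2coef (f : C -> C) : nat -> C :=
  epsilon (inhabits (fun _ => 0)) (H2coef_of f).

Definition H2inner (f g : C -> C) : C :=
  limn (series (fun n => H2coef f n * (H2coef g n)^*)).

Definition H2norm (f : C -> C) : C := sqrtC (H2inner f f).

Definition bounded_op (T : (C -> C) -> (C -> C)) : Prop :=
  exists M : C, 0 <= M /\
    forall f, inH2 f -> inH2 (T f) /\ H2norm (T f) <= M * H2norm f.

(* operators *)
Definition compo (s f : C -> C) : C -> C := fun z => f (s z).
Definition mulop (h f : C -> C) : C -> C := fun z => h z * f z.
Definition bshift (f : C -> C) : C -> C :=
  fun z => if z == 0 then 'D_1 f 0 else (f z - f 0) / z.
(* Lambda a f (z) = f(0) / (1 - conj(a) z) *)
Definition Lambda (a : C) (f : C -> C) : C -> C :=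
  fun z => f 0 / (1 - a^* * z).

(* h(z) = z s'(z),  g(z) = z s'(z) / s(z) *)
Definition hfun (s : C -> C) : C -> C := fun z => z * 'D_1 s z.
Definition gfun (s : C -> C) : C -> C := fun z => z * 'D_1 s z / s z.

End Defs.

(* Main.v *)
(** Functions that are C^{1,1} on the closed unit disc (class [C11]) replace general
holomorphic functions, and averages over the 2^m-th roots of unity replace integrals over the
circle: the interpolation polynomials of a C11 function at the 2^m-th roots of unity converge
uniformly at the speed of |w_m - 1|, where w_m is a primitive root close to 1, which yields the
Taylor expansion and, by Parseval, the bounds of the H^2 norm. Composition operators are bounded
by Littlewood's subordination principle: |P|^2 <= Re F for an explicit polynomial F.

The branches of the inverse of phi_e are the roots of the pencil Q_z = A - z B, where A and B are
the conjugate reversals of q and p; its degree is constant and its roots are simple for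
|z| <= 1. A resultant bounds |Q_z'| from below at the roots, uniformly in z, so that the roots can
be continued radially from 0 with a fixed number of steps.

Finally (C_phi^* g)(w) = <g, k_w o phi> for the reproducing kernel k_w, and k_w o phi is a rational
function with simple poles. Its partial fractions, in the variable x = 1 / conj z in which the
poles are the branch values sigma_j(w), give (a); evaluating them at x = 0 turns (a) into (b). *)
Require Import Defs.
From HB Require Import structures.
From mathcomp Require Import all_boot all_order all_algebra.
From mathcomp Require Import all_classical all_reals all_analysis.
From mathcomp Require Import complex separable.
From mathcomp Require Import ring lra.
Import Order.TTheory GRing.Theory Num.Theory.
Import numFieldNormedType.Exports.
Set Implicit Arguments.
Unset Strict Implicit.
Unset Printing Implicit Defensive.
Local Open Scope ring_scope.
Local Open Scope classical_set_scope.

(** * Real-valued modulus and convergence in the complex numbers *)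

(** The remainder in [C11] is quadratic and uniform up to the circle, and this replaces curve
    integrals: the increments of a function along a closed regular polygon sum to zero, and dividing
    by the length of a step leaves an average that is small with the step. Iterated square roots
    supply the vertices, with no angle or exponential. Outer regularity includes the points of the
    circle. Hence the roots of the pencil are simple over a compact disc, which yields one lower
    bound c for the derivative at the roots, one separation c / K between the roots and one step
    size for all continuations. The radial continuation is single-valued without a monodromy
    argument: along neighbouring radii the chosen roots stay close, and close roots of the same
    polynomial are equal. The adjoint is not constructed abstractly. The right side G of the formula
    is first shown to lie in H^2; its values are then identified through the kernels, so that its
    coefficients are the numbers <g, phi^n>. These determine <f, G> for every f in H^2. *)

Section ComplexModulus.
Variable R : realType.
Local Notation C := (CC R).

(* Moduli are taken in [R], because the order of the complex numbers is only partial. *)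
Definition rc (r : R) : C := (r%:C)%C.
Definition nm (z : C) : R := complex.Re (`|z| : R[i]).

Lemma nmE (z : C) : `|z| = rc (nm z).
Proof. by rewrite /nm /rc (normc_def (z : R[i])). Qed.

Lemma rc_inj : injective rc. Proof. exact: (@complexI R). Qed.
Lemma rcD x y : rc (x + y) = rc x + rc y. Proof. exact: rmorphD. Qed.
Lemma rcM x y : rc (x * y) = rc x * rc y. Proof. exact: rmorphM. Qed.
Lemma rc_le x y : (rc x <= rc y) = (x <= y). Proof. exact: lecR. Qed.
Lemma rc_lt x y : (rc x < rc y) = (x < y). Proof. exact: ltcR. Qed.
Lemma rc0 : rc 0 = 0. Proof. by []. Qed.
Lemma rc1 : rc 1 = 1. Proof. by []. Qed.
Lemma rcX x n : rc (x ^+ n) = rc x ^+ n. Proof. exact: rmorphXn. Qed.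
Lemma rcB x y : rc (x - y) = rc x - rc y. Proof. exact: rmorphB. Qed.
Lemma rcV x : rc (x^-1) = (rc x)^-1. Proof. exact: fmorphV. Qed.
Lemma rc_nat n : rc n%:R = n%:R. Proof. exact: rmorph_nat. Qed.
Lemma rc_sum I (s : seq I) P (F : I -> R) :
  rc (\sum_(i <- s | P i) F i) = \sum_(i <- s | P i) rc (F i).
Proof. exact: rmorph_sum. Qed.
Lemma rc_conj x : (rc x)^* = rc x.
Proof. exact: (conjc_real x). Qed.

Lemma nm_ge0 z : 0 <= nm z. Proof. by rewrite -rc_le -nmE normr_ge0. Qed.
Lemma nm_eq0 z : (nm z == 0) = (z == 0).
Proof. by rewrite -(inj_eq rc_inj) -nmE normr_eq0. Qed.
Lemma nm0 : nm 0 = 0. Proof. by apply/eqP; rewrite nm_eq0. Qed.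
Lemma nm_gt0 z : (0 < nm z) = (z != 0).
Proof. by rewrite lt_def nm_ge0 nm_eq0 andbT. Qed.
Lemma nmM x y : nm (x * y) = nm x * nm y.
Proof. by apply: rc_inj; rewrite rcM -!nmE normrM. Qed.
Lemma nm1 : nm 1 = 1. Proof. by apply: rc_inj; rewrite -nmE normr1. Qed.
Lemma nmX x n : nm (x ^+ n) = nm x ^+ n.
Proof. by apply: rc_inj; rewrite rcX -!nmE normrX. Qed.
Lemma nmV x : nm x^-1 = (nm x)^-1.
Proof. by apply: rc_inj; rewrite -nmE normfV nmE rcV. Qed.
Lemma nm_div x y : nm (x / y) = nm x / nm y. Proof. by rewrite nmM nmV. Qed.
Lemma nmN x : nm (- x) = nm x.
Proof. by apply: rc_inj; rewrite -!nmE normrN. Qed.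
Lemma nm_conj (x : C) : nm x^* = nm x.
Proof. by apply: rc_inj; rewrite -!nmE norm_conjC. Qed.
Lemma nmD x y : nm (x + y) <= nm x + nm y.
Proof. by rewrite -rc_le rcD -!nmE ler_normD. Qed.
Lemma nmB x y : nm (x - y) <= nm x + nm y.
Proof. by rewrite -[nm y]nmN nmD. Qed.
Lemma nm_distC x y : nm (x - y) = nm (y - x). Proof. by rewrite -nmN opprB. Qed.
Lemma nm_dist_trans x y z : nm (x - z) <= nm (x - y) + nm (y - z).
Proof. by rewrite -[x - z](subrKA y) nmD. Qed.
Lemma nm_rc r : nm (rc r) = `|r|.
Proof. by rewrite /nm /rc (normc_def (_ : R[i])) /= expr0n addr0 sqrtr_sqr. Qed.
Lemma nm_nat n : nm n%:R = n%:R.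
Proof.
have -> : (n%:R : C) = rc n%:R by rewrite rc_nat.
by rewrite nm_rc ger0_norm.
Qed.
Lemma nm_sum I (s : seq I) P (F : I -> C) :
  nm (\sum_(i <- s | P i) F i) <= \sum_(i <- s | P i) nm (F i).
Proof.
elim/big_rec2: _ => [|i y x _ le]; first by rewrite nm0.
by apply: (le_trans (nmD _ _)); rewrite lerD2l.
Qed.
(** In the partial order of the complex numbers a positive element is real, so every epsilon of the
    complex topology can be replaced by a real one. *)
Lemma gt0_rc (x : C) : 0 < x -> x = rc (complex.Re (x : R[i])).
Proof. by rewrite ltcE => /andP[/eqP e0 _]; rewrite [LHS]complexE e0 mulr0 addr0. Qed.
Lemma nm_sqE (z : C) : rc (nm z ^+ 2) = z * z^*.
Proof. by rewrite rcX -nmE normCK. Qed.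
Lemma nm_lt1 (x : C) : (`|x| < 1) = (nm x < 1).
Proof. by rewrite nmE -rc1 rc_lt. Qed.

Definition re (z : C) : R := complex.Re (z : R[i]).
Definition im (z : C) : R := complex.Im (z : R[i]).
Lemma reD x y : re (x + y) = re x + re y. Proof. by case: x y => [a b] [c d]. Qed.
Lemma re0 : re 0 = 0. Proof. by []. Qed.
Lemma re_rc r : re (rc r) = r. Proof. by []. Qed.
Lemma reN x : re (- x) = - re x. Proof. by case: x. Qed.
Lemma reB x y : re (x - y) = re x - re y. Proof. by case: x y => [a b] [c d]. Qed.
Lemma imB x y : im (x - y) = im x - im y. Proof. by case: x y => [a b] [c d]. Qed.
Lemma re_rcM r x : re (rc r * x) = r * re x.
Proof. by case: x => [a b]; rewrite /re /rc /= mul0r subr0. Qed.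
Lemma re_sum I (s : seq I) P (F : I -> C) :
  re (\sum_(i <- s | P i) F i) = \sum_(i <- s | P i) re (F i).
Proof. by elim/big_rec2: _ => [|i y x _ <-]; rewrite ?reD. Qed.
Lemma nm2E (z : C) : nm z ^+ 2 = re z ^+ 2 + im z ^+ 2.
Proof.
case: z => a b; rewrite /nm (normc_def (_ : R[i])) /=.
by rewrite sqr_sqrtr // addr_ge0 // sqr_ge0.
Qed.
Lemma re_le_nm z : re z <= nm z.
Proof. by have := nm2E z; have := nm_ge0 z; nra. Qed.
Lemma abs_re_le z : `|re z| <= nm z.
Proof. by rewrite ler_norml re_le_nm andbT lerNl -reN -(nmN z) re_le_nm. Qed.
Lemma abs_im_le z : `|im z| <= nm z.
Proof.
rewrite -[nm z]ger0_norm ?nm_ge0 // -ler_sqr ?nnegrE // ?normr_ge0 //.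
by rewrite !real_normK ?num_real // nm2E lerDr sqr_ge0.
Qed.
Lemma nm_le_reim z : nm z <= `|re z| + `|im z|.
Proof.
rewrite -ler_sqr ?nnegrE ?nm_ge0 ?addr_ge0 // nm2E sqrrD !real_normK ?num_real //.
by rewrite -addrA lerD2l lerDr mulrn_wge0 // mulr_ge0.
Qed.
Lemma nm2D (x y : C) : nm (x + y) ^+ 2 = nm x ^+ 2 + re (x * y^*) *+ 2 + nm y ^+ 2.
Proof. rewrite !nm2E; case: x y => [a b] [c d]; rewrite /re /im /=; ring. Qed.

Lemma cvgC (u : nat -> C) l :
  (u @ \oo --> l) <-> forall e : R, 0 < e -> exists N, forall n, (N <= n)%N -> nm (u n - l) <= e.
Proof.
split=> [/cvgrPdist_le h e e0|h].
  have := h (rc e); rewrite -rc0 rc_lt => /(_ e0) [N _ hN].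
  by exists N => n /hN /=; rewrite nmE rc_le nm_distC.
apply/cvgrPdist_le => e e0.
have eE := gt0_rc e0.
move: e0; rewrite eE -rc0 rc_lt => /h [N hN].
by exists N => // n /hN /=; rewrite nmE rc_le nm_distC.
Qed.

Lemma cvgR (u : nat -> R) l :
  (u @ \oo --> l) <-> forall e : R, 0 < e -> exists N, forall n, (N <= n)%N -> `|u n - l| <= e.
Proof.
split=> [/cvgrPdist_le h e e0|h].
  by have [N _ hN] := h e e0; exists N => n /hN /=; rewrite distrC.
apply/cvgrPdist_le => e /h [N hN].
by exists N => // n /hN /=; rewrite distrC.
Qed.

Lemma hausC : hausdorff_space C. Proof. exact: norm_hausdorff. Qed.
Lemma cvg_limC (u : nat -> C) (l : C) : u @ \oo --> l -> limn u = l.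
Proof. by move=> h; apply: (cvg_lim hausC). Qed.
Lemma cvg_uniqueC (u : nat -> C) (l m : C) : u @ \oo --> l -> u @ \oo --> m -> l = m.
Proof. by move=> h1 h2; rewrite -(cvg_limC h1) -(cvg_limC h2). Qed.

Lemma cauchyC (u : nat -> C) :
  (forall e : R, 0 < e -> exists N, forall m n, (N <= m)%N -> (N <= n)%N -> nm (u m - u n) <= e) ->
  cvgn (u : nat -> C).
Proof.
move=> h.
have aux (p : C -> R) : (forall x y, p (x - y) = p x - p y) -> (forall x, `|p x| <= nm x) ->
    cvgn (p \o u : nat -> R).
  move=> pB ple; apply: R_complete; apply/cauchy_exP => e e0.
  have [N hN] := h _ (divr_gt0 e0 (ltr0n _ 2)).
  exists (p (u N)), N => // n /= Nn; rewrite /ball/= -pB.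
  apply: (le_lt_trans (ple _)); apply: (le_lt_trans (hN _ _ _ _)) => //.
  by rewrite ltr_pdivrMr // mulr_natr mulr2n ltrDl.
have /cvg_ex [a /cvgR ha] := aux re reB abs_re_le.
have /cvg_ex [b /cvgR hb] := aux im imB abs_im_le.
apply/cvg_ex; exists (Complex a b : C); apply/cvgC => e e0.
have e20 : 0 < e / 2 by rewrite divr_gt0.
have [N hN] := ha _ e20; have [N' hN'] := hb _ e20.
exists (maxn N N') => n; rewrite geq_max => /andP[/hN h1 /hN' h2].
apply: (le_trans (nm_le_reim _)); rewrite reB imB [e]splitr.
exact: lerD.
Qed.

Lemma cvg_nm2 (u : nat -> C) (l : C) : u @ \oo --> l ->
  (fun n => nm (u n) ^+ 2) @ \oo --> nm l ^+ 2.
Proof.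
move=> /cvgC h; suff : (fun n => nm (u n)) @ \oo --> nm l by move=> hl; rewrite expr2; under eq_fun do rewrite expr2; exact: cvgM.
apply/cvgR => e /h [N hN]; exists N => n /hN; apply: le_trans.
rewrite ler_norml; have := nmD (u n - l) l; have := nmD (l - u n) (u n).
by rewrite !subrK [nm (l - _)]nm_distC => h1 h2; apply/andP; split; lra.
Qed.

End ComplexModulus.

Lemma cvg_sum_ord (K : numFieldType) L (F : nat -> nat -> K) (l : nat -> K) :
  (forall n, F n @ \oo --> l n) ->
  (fun m => \sum_(n < L) F n m) @ \oo --> \sum_(n < L) l n.
Proof.
move=> h; elim: L => [|L ih].
  by rewrite big_ord0; under eq_fun do rewrite big_ord0; exact: cvg_cst.
rewrite big_ord_recr; under eq_fun do rewrite big_ord_recr.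
exact: cvgD.
Qed.

(** * C^{1,1} functions on the closed disc *)

Section C11.
Variable R : realType.
Local Notation C := (CC R).
Implicit Types (f g : C -> C) (x y z : C).

(** [f'] is given together with [f] because the points of the circle are included, where only
    differences inside the closed disc make sense. *)
Definition C11 (f f' : C -> C) := exists K : R, forall x y, nm x <= 1 -> nm y <= 1 ->
  [/\ nm (f x) <= K, nm (f' x) <= K &
      nm (f x - f y - f' y * (x - y)) <= K * nm (x - y) ^+ 2].

Lemma nmM_le (a b : C) (A B : R) : nm a <= A -> nm b <= B -> nm (a * b) <= A * B.
Proof. by move=> hA hB; rewrite nmM ler_pM ?nm_ge0. Qed.

Lemma nmD_le (a b : C) (A B : R) : nm a <= A -> nm b <= B -> nm (a + b) <= A + B.
Proof. by move=> hA hB; apply: (le_trans (nmD _ _)); apply: lerD. Qed.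

Lemma nmB_le (a b : C) (A B : R) : nm a <= A -> nm b <= B -> nm (a - b) <= A + B.
Proof. by move=> hA hB; apply: (le_trans (nmB _ _)); apply: lerD. Qed.

(** Two points of the disc are at distance at most 2, so the quadratic remainder is at most
    [2 * K * nm (x - y)]; the term with [f'] adds one more [K], whence [3 * K]. *)
Lemma C11_lip f f' : C11 f f' -> exists2 L : R, 0 <= L &
  forall x y, nm x <= 1 -> nm y <= 1 ->
    [/\ nm (f x) <= L, nm (f' x) <= L, nm (f x - f y) <= L * nm (x - y) &
        nm (f x - f y - f' y * (x - y)) <= L * nm (x - y) ^+ 2].
Proof.
move=> [K hK].
have K0 : 0 <= K.
  by have [h _ _] := hK 0 0 ltac:(by rewrite nm0) ltac:(by rewrite nm0);
     apply: le_trans h; apply: nm_ge0.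
exists (3 * K); first by rewrite mulr_ge0.
move=> x y hx hy; have [h1 h2 h3] := hK x y hx hy; have [_ h4 _] := hK y x hy hx.
have dxy : nm (x - y) <= 2 by apply: (le_trans (nmB _ _)); lra.
have K3 : K <= 3 * K by lra.
split; [exact: le_trans K3|exact: le_trans K3| |].
  rewrite -[f x - f y](subrK (f' y * (x - y))).
  apply: (le_trans (nmD_le h3 (nmM_le h4 (lexx _)))).
  have d0 := nm_ge0 (x - y); set t := nm (x - y) in d0 dxy *.
  have : 0 <= K * t * (2 - t) by rewrite !mulr_ge0 // subr_ge0.
  by rewrite expr2; lra.
by apply: (le_trans h3); rewrite ler_wpM2r // sqr_ge0.
Qed.

Lemma C11_ext f f' g g' : (forall x, nm x <= 1 -> f x = g x /\ f' x = g' x) ->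
  C11 f f' -> C11 g g'.
Proof.
move=> e [K hK]; exists K => x y hx hy; have := hK x y hx hy.
by have [<- <-] := e x hx; have [<- <-] := e y hy.
Qed.

Lemma C11_cst c : C11 (fun=> c) (fun=> 0).
Proof.
exists (nm c) => x y _ _; split; rewrite ?nm0 ?nm_ge0 //.
by rewrite subrr mul0r subr0 nm0 mulr_ge0 ?sqr_ge0 ?nm_ge0.
Qed.

Lemma C11_id : C11 id (fun=> 1).
Proof.
exists 1 => x y hx _; split; rewrite ?nm1 //.
by rewrite mul1r subrr nm0 mulr_ge0 ?sqr_ge0.
Qed.

Lemma C11D f f' g g' : C11 f f' -> C11 g g' ->
  C11 (fun x => f x + g x) (fun x => f' x + g' x).
Proof.
move=> [K hK] [L hL]; exists (K + L) => x y hx hy.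
have [h1 h2 h3] := hK x y hx hy; have [l1 l2 l3] := hL x y hx hy.
split; [exact: nmD_le|exact: nmD_le|].
have -> : f x + g x - (f y + g y) - (f' y + g' y) * (x - y) =
  (f x - f y - f' y * (x - y)) + (g x - g y - g' y * (x - y)) by ring.
by rewrite mulrDl; exact: nmD_le.
Qed.

Lemma C11M f f' g g' : C11 f f' -> C11 g g' ->
  C11 (fun x => f x * g x) (fun x => f' x * g x + f x * g' x).
Proof.
move=> /C11_lip[K K0 hK] /C11_lip[L L0 hL]; exists (3 * (K * L)) => x y hx hy.
have [h1 h2 h3 h4] := hK x y hx hy; have [l1 l2 l3 l4] := hL x y hx hy.
have [h5 _ _ _] := hK y x hy hx; have [l5 _ _ _] := hL y x hy hx.
have KL : 0 <= K * L by exact: mulr_ge0.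
split.
- by apply: (le_trans (nmM_le h1 l1)); lra.
- by apply: (le_trans (nmD_le (nmM_le h2 l1) (nmM_le h1 l2))); lra.
(* The last summand is a product of two increments, which the Lipschitz bounds make quadratic. *)
have -> : f x * g x - f y * g y - (f' y * g y + f y * g' y) * (x - y) =
  (f x - f y - f' y * (x - y)) * g y + f y * (g x - g y - g' y * (x - y))
  + (f x - f y) * (g x - g y) by ring.
apply: (le_trans (nmD_le (nmD_le (nmM_le h4 l5) (nmM_le h5 l4)) (nmM_le h3 l3))).
by rewrite le_eqVlt; apply/orP; left; apply/eqP; ring.
Qed.

Lemma C11V f f' (c : R) : 0 < c -> (forall x, nm x <= 1 -> c <= nm (f x)) ->
  C11 f f' -> C11 (fun x => (f x)^-1) (fun x => - f' x / f x ^+ 2).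
Proof.
move=> c0 hc /C11_lip[K K0 hK].
have nz x : nm x <= 1 -> f x != 0.
  by move=> hx; rewrite -nm_gt0; apply: lt_le_trans (hc x hx).
have hV x : nm x <= 1 -> nm (f x)^-1 <= c^-1.
  by move=> hx; rewrite nmV lef_pV2 ?posrE ?hc // nm_gt0 nz.
have ci0 : 0 <= c^-1 by rewrite invr_ge0 ltW.
set d := c^-1 in hV ci0 *.
exists (d + K * (d * d) + (K * K + K * K) * (d * (d * d))) => x y hx hy.
have [h1 h2 h3 h4] := hK x y hx hy; have [h5 h6 _ _] := hK y x hy hx.
have dd : 0 <= K * (d * d) by rewrite !mulr_ge0.
have ddd : 0 <= (K * K + K * K) * (d * (d * d)) by rewrite !mulr_ge0 // addr_ge0 // mulr_ge0.
split.
- by apply: (le_trans (hV _ hx)); lra.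
- rewrite mulNr nmN [_ ^+ 2]expr2 invfM.
  by apply: (le_trans (nmM_le h2 (nmM_le (hV _ hx) (hV _ hx)))); lra.
have -> : (f x)^-1 - (f y)^-1 - - f' y / f y ^+ 2 * (x - y) =
  (f' y * (x - y) * (f x - f y) - f y * (f x - f y - f' y * (x - y)))
   * ((f x)^-1 * ((f y)^-1 * (f y)^-1)).
  by field; rewrite nz ?nz.
apply: (le_trans (nmM_le (nmB_le (nmM_le (nmM_le h6 (lexx _)) h3) (nmM_le h5 h4))
  (nmM_le (hV _ hx) (nmM_le (hV _ hy) (hV _ hy))))).
rewrite [leLHS](_ : _ = (K * K + K * K) * (d * (d * d)) * nm (x - y) ^+ 2); last by ring.
by rewrite ler_wpM2r ?sqr_ge0 //; lra.
Qed.

Lemma C11_sum I (s : seq I) (F F' : I -> C -> C) : (forall i, C11 (F i) (F' i)) ->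
  C11 (fun x => \sum_(i <- s) F i x) (fun x => \sum_(i <- s) F' i x).
Proof.
move=> h; elim: s => [|i s ih].
  by apply: C11_ext (C11_cst 0) => x _; rewrite !big_nil.
by apply: C11_ext (C11D (h i) ih) => x _; rewrite !big_cons.
Qed.

Lemma C11_poly (P : {poly C}) f f' : C11 f f' ->
  C11 (fun x => P.[f x]) (fun x => P^`().[f x] * f' x).
Proof.
move=> hf; elim/poly_ind: P => [|P c ih].
  by apply: C11_ext (C11_cst 0) => x _; rewrite deriv0 !horner0 mul0r.
apply: C11_ext (C11D (C11M ih hf) (C11_cst c)) => x _.
by rewrite derivMXaddC !hornerE; split; ring.
Qed.

Lemma C11X n : C11 (fun x => x ^+ n) (fun x => x ^+ n.-1 *+ n).
Proof.
apply: C11_ext (C11_poly 'X^n C11_id) => x _.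
by rewrite derivXn hornerMn !hornerXn mulr1.
Qed.

(** [g] is compared with [f] only inside the disc because functions such as [hfun] contain ['D_1],
    whose values on the circle are not controlled. *)
Lemma C11_is_derive f f' g z : C11 f f' -> (forall x, nm x < 1 -> g x = f x) ->
  nm z < 1 -> is_derive z 1 g (f' z).
Proof.
move=> /C11_lip[K K0 hK] e hz.
suff h : h^-1 *: ((g \o shift z) (h *: 1) - g z) @[h --> 0^'] --> f' z.
  split; first by apply/cvg_ex; exists (f' z).
  exact: (cvg_lim (@hausC R)).
apply/cvgrPdist_le => eps eps0.
have eE : eps = rc (re eps) := gt0_rc eps0.
move: eps0; rewrite eE -rc0 rc_lt => e0.
have K10 : 0 < K + 1 by rewrite ltr_wpDl.
near=> h.
have h0 : h != 0 by near: h; exact: nbhs_dnbhs_neq.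
have h1 : nm h < 1 - nm z.
  rewrite -rc_lt -nmE; near: h; apply: dnbhs0_lt.
  by rewrite -rc0 rc_lt subr_gt0.
have h2 : nm h < re eps / (K + 1).
  rewrite -rc_lt -nmE; near: h; apply: dnbhs0_lt.
  by rewrite -rc0 rc_lt divr_gt0.
have hzh : nm (h + z) < 1 by apply: (le_lt_trans (nmD _ _)); lra.
rewrite /= /shift /= [h *: 1]mulr1 !e // nmE rc_le nm_distC.
have [_ _ _ hb] := hK (h + z) z (ltW hzh) (ltW hz).
rewrite addrK in hb.
have -> : h^-1 *: (f (h + z) - f z) - f' z = h^-1 * (f (h + z) - f z - f' z * h).
  have scE (a b : C) : a *: b = a * b by [].
  by rewrite scE [in RHS]mulrBr [h^-1 * (_ * _)]mulrCA mulVf // mulr1.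
have hp : 0 < nm h by rewrite nm_gt0.
rewrite nmM nmV ler_pdivrMl //; apply: (le_trans hb).
rewrite expr2 mulrCA; rewrite ler_pM2l //.
move: h2; rewrite ltr_pdivlMr // => h2.
by apply: le_trans (ltW h2); rewrite mulrC ler_wpM2l ?nm_ge0 // lerDl.
Unshelve. all: by end_near. Qed.

End C11.

(** * Averages over roots of unity and Taylor expansions *)

Section RootsOfUnity.
Variable R : realType.
Local Notation C := (CC R).

(** The sign is chosen so that iterated square roots of -1 move towards 1. *)
Definition sqrt_pos (x : C) : C := if 0 <= re (sqrtC x) then sqrtC x else - sqrtC x.

Lemma sqrt_posK x : sqrt_pos x ^+ 2 = x.
Proof. by rewrite /sqrt_pos; case: ifP; rewrite ?sqrrN sqrtCK. Qed.

Lemma re_sqrt_pos x : 0 <= re (sqrt_pos x).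
Proof.
rewrite /sqrt_pos; case: ifP => // /negbT; rewrite -ltNge => h.
by rewrite reN oppr_ge0 ltW.
Qed.

Fixpoint unit_root (m : nat) : C := if m is k.+1 then sqrt_pos (unit_root k) else -1.
Local Notation w := unit_root.
Local Notation N m := (2 ^ m.+1)%N.

Lemma unit_root_half m : w m ^+ (2 ^ m) = -1.
Proof.
by elim: m => [|m ih] /=; rewrite ?expn0 ?expr1 // expnS exprM sqrt_posK.
Qed.

Lemma unit_rootX m : w m ^+ N m = 1.
Proof. by rewrite expnSr exprM unit_root_half sqrrN expr1n. Qed.

Lemma prim_unit_root m : (N m).-primitive_root (w m).
Proof.
have N0 : (0 < N m)%N by rewrite expn_gt0.
have [d dp dN] := prim_order_exists N0 (unit_rootX m).
have /(dvdn_pfactor d m.+1 (isT : prime 2)) [e le de] := dN.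
move: le; rewrite leq_eqVlt => /orP[/eqP <-|]; first by rewrite -de.
rewrite ltnS => le.
have : w m ^+ (2 ^ m) = 1.
  by apply/eqP; rewrite -(prim_order_dvd dp) de dvdn_exp2l.
rewrite unit_root_half => /eqP; rewrite -subr_eq0 -opprD oppr_eq0.
by rewrite -mulr2n pnatr_eq0.
Qed.

Lemma nm_unit_root m : nm (w m) = 1.
Proof.
apply/eqP; rewrite -(@pexpr_eq1 _ _ (N m)) ?nm_ge0 ?expn_gt0 //.
by rewrite -nmX unit_rootX nm1.
Qed.

Lemma unit_root_neq1 m : w m != 1.
Proof.
apply/eqP => h; have := unit_root_half m; rewrite h expr1n => /eqP.
by rewrite -subr_eq0 opprK -mulr2n pnatr_eq0.
Qed.

(** If v is the next root, then (v - 1)(v + 1) = w - 1, and Re v >= 0 gives |v + 1|^2 >= 2 >=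
    (4/3)^2. Each square root thus divides the distance to 1 by at least 4/3. *)
Lemma unit_root_cvg1 m : nm (w m - 1) <= 2 * (3 / 4) ^+ m.
Proof.
elim: m => [|m ih].
  by rewrite expr0 mulr1; apply: (le_trans (nmB _ _)); rewrite nmN nm1.
have e : (w m.+1 - 1) * (w m.+1 + 1) = w m - 1.
  by rewrite -subr_sqr expr1n /= sqrt_posK.
have h2 : 4 / 3 <= nm (w m.+1 + 1).
  have hr : 0 <= re (w m.+1) by apply: re_sqrt_pos.
  have := nm2D (w m.+1) 1; rewrite nm_unit_root nm1 rmorph1 mulr1 => h.
  have := nm_ge0 (w m.+1 + 1); nra.
have := nmM (w m.+1 - 1) (w m.+1 + 1); rewrite e => e2.
rewrite e2 in ih; rewrite exprS mulrCA; have h0 := nm_ge0 (w m.+1 - 1).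
have : nm (w m.+1 - 1) * (4 / 3) <= nm (w m.+1 - 1) * nm (w m.+1 + 1) by rewrite ler_wpM2l.
by lra.
Qed.

Definition avg (m : nat) (F : C -> C) : C := (\sum_(k < N m) F (w m ^+ k)) / (N m)%:R.
Definition avgR (m : nat) (F : C -> R) : R := (\sum_(k < N m) F (w m ^+ k)) / (N m)%:R.

Lemma natN_neq0 m : (N m)%:R != 0 :> C.
Proof. by rewrite pnatr_eq0 -lt0n expn_gt0. Qed.
Lemma natN_gt0 m : 0 < (N m)%:R :> R.
Proof. by rewrite ltr0n expn_gt0. Qed.

Lemma nm_unit_rootX m k : nm (w m ^+ k) = 1.
Proof. by rewrite nmX nm_unit_root expr1n. Qed.

Lemma avgD m F G : avg m (fun z => F z + G z) = avg m F + avg m G.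
Proof. by rewrite /avg big_split mulrDl. Qed.
Lemma avgB m F G : avg m (fun z => F z - G z) = avg m F - avg m G.
Proof. by rewrite /avg big_split /= sumrN mulrBl. Qed.
Lemma avgZ m c F : avg m (fun z => c * F z) = c * avg m F.
Proof. by rewrite /avg -mulr_sumr mulrA. Qed.
Lemma avg_sum m I (s : seq I) (P : pred I) (F : I -> C -> C) :
  avg m (fun z => \sum_(i <- s | P i) F i z) = \sum_(i <- s | P i) avg m (F i).
Proof. by rewrite /avg exchange_big mulr_suml. Qed.
Lemma eq_avg m F G : (forall z, nm z = 1 -> F z = G z) -> avg m F = avg m G.
Proof. by move=> h; congr (_ / _); apply: eq_bigr => k _; rewrite h // nm_unit_rootX. Qed.
Lemma ler_avgR m F G : (forall z, nm z = 1 -> F z <= G z) -> avgR m F <= avgR m G.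
Proof.
move=> h; rewrite ler_pM2r ?invr_gt0 ?natN_gt0 //.
by apply: ler_sum => k _; rewrite h // nm_unit_rootX.
Qed.
Lemma avgR_cst m (c : R) : avgR m (fun=> c) = c.
Proof.
rewrite /avgR sumr_const card_ord -(mulr_natr c) mulfK ?natr_eq0 // lt0r_neq0 ?natN_gt0.
Qed.
Lemma avgRZ m c F : avgR m (fun z => c * F z) = c * avgR m F.
Proof. by rewrite /avgR -mulr_sumr mulrA. Qed.
Lemma nm_avg m F : nm (avg m F) <= avgR m (fun z => nm (F z)).
Proof.
rewrite /avg /avgR nm_div nm_nat ler_pM2r ?invr_gt0 ?natN_gt0 //.
exact: nm_sum.
Qed.
Lemma nm_avg_le m F c : (forall z, nm z = 1 -> nm (F z) <= c) -> nm (avg m F) <= c.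
Proof.
by move=> h; apply: (le_trans (nm_avg _ _)); rewrite -(avgR_cst m c) ler_avgR.
Qed.
Lemma rc_avgR m F : rc (avgR m F) = avg m (fun z => rc (F z)).
Proof. by rewrite /avgR /avg rcM rcV rc_nat rc_sum. Qed.
Lemma re_avg m F : re (avg m F) = avgR m (fun z => re (F z)).
Proof.
have e : ((N m)%:R : C)^-1 = rc (((N m)%:R : R)^-1) by rewrite (rcV (_ : R)) rc_nat.
by rewrite /avg mulrC e re_rcM re_sum mulrC.
Qed.

Lemma avg_orth m i j : (i < N m)%N -> (j < N m)%N ->
  avg m (fun z => z ^+ i * (z ^+ j)^*) = (i == j)%:R.
Proof.
move=> hi hj; have [->|ne] := eqVneq i j.
  rewrite (eq_avg _ (G := fun=> 1)) => [|z hz].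
    by rewrite /avg sumr_const card_ord divff // natN_neq0.
  by rewrite -nm_sqE nmX hz !expr1n.
set u := w m ^+ i * (w m ^+ j)^*.
have u1 : u != 1.
  apply/eqP => h; move: ne; apply/negP; rewrite negbK.
  have : w m ^+ i == w m ^+ j.
    rewrite -[w m ^+ j]mul1r -h /u -mulrA [_ ^* * _]mulrC -nm_sqE nm_unit_rootX.
    by rewrite expr1n mulr1.
  by rewrite (eq_prim_root_expr (prim_unit_root m)) !modn_small.
have uN : u ^+ N m = 1.
  by rewrite exprMn -rmorphXn -!exprM ![(_ * N m)%N]mulnC !exprM unit_rootX !expr1n rmorph1 mulr1.
have : (u - 1) * (\sum_(k < N m) u ^+ k) = 0 by rewrite -subrX1 uN subrr.
move=> /eqP; rewrite mulf_eq0 subr_eq0 (negbTE u1) /= => /eqP h.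
rewrite /avg (eq_bigr (fun k : 'I_(N m) => u ^+ k)) ?h ?mul0r // => k _.
by rewrite /u exprMn -rmorphXn -!exprM ![(k * _)%N]mulnC.
Qed.

Definition fcoef m (f : C -> C) (n : nat) := avg m (fun z => f z * (z ^+ n)^*).
Definition interp m f (z : C) := \sum_(n < N m) fcoef m f n * z ^+ n.

Lemma fcoef_sum m (a : nat -> C) L n : (L <= N m)%N -> (n < L)%N ->
  fcoef m (fun z => \sum_(i < L) a i * z ^+ i) n = a n.
Proof.
move=> LN nL; rewrite /fcoef (eq_avg _ (G := fun z => \sum_(i < L) a i * (z ^+ i * (z ^+ n)^*))).
  rewrite avg_sum (bigD1 (Ordinal nL)) //= big1 ?addr0.
    by rewrite avgZ avg_orth ?(leq_trans nL) // eqxx mulr1.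
  move=> i ne; rewrite avgZ avg_orth ?(leq_trans nL) ?(leq_trans (ltn_ord i)) //.
  by rewrite -val_eqE in ne; rewrite (negbTE ne) mulr0.
by move=> z _; rewrite mulr_suml; apply: eq_bigr => i _; rewrite mulrA.
Qed.

Lemma avg_conj m F : avg m (fun z => (F z)^*) = (avg m F)^*.
Proof. by rewrite /avg rmorphM fmorphV rmorph_nat rmorph_sum. Qed.

Lemma avg_mul_poly m f (a : nat -> C) L : 
  avg m (fun z => f z * (\sum_(i < L) a i * z ^+ i)^*) = \sum_(i < L) fcoef m f i * (a i)^*.
Proof.
rewrite (eq_avg _ (G := fun z => \sum_(i < L) (a i)^* * (f z * (z ^+ i)^*))).
  by rewrite avg_sum; apply: eq_bigr => i _; rewrite avgZ mulrC.
move=> z _; rewrite rmorph_sum mulr_sumr; apply: eq_bigr => i _.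
by rewrite rmorphM mulrCA.
Qed.

Lemma parseval_poly m (a : nat -> C) L : (L <= N m)%N ->
  avgR m (fun z => nm (\sum_(i < L) a i * z ^+ i) ^+ 2) = \sum_(i < L) nm (a i) ^+ 2.
Proof.
move=> LN; apply: rc_inj; rewrite rc_avgR.
rewrite (eq_avg _ (fun z _ => nm_sqE _)) avg_mul_poly rc_sum.
by apply: eq_bigr => i _; rewrite fcoef_sum // -nm_sqE.
Qed.

(** The difference of the two sides is the average of |f - P|^2, where P is the partial sum of the
    interpolation polynomial: the mixed terms all equal the sum of the squared coefficients. *)
Lemma bessel m f L : (L <= N m)%N ->
  \sum_(n < L) nm (fcoef m f n) ^+ 2 <= avgR m (fun z => nm (f z) ^+ 2).
Proof.
move=> LN; set P := fun z => \sum_(i < L) fcoef m f i * z ^+ i.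
rewrite -subr_ge0 -(rc_le 0) rcB rc_avgR.
rewrite [leRHS](_ : _ = rc (avgR m (fun z => nm (f z - P z) ^+ 2))).
  by rewrite rc_le /avgR divr_ge0 // sumr_ge0 // => k _; rewrite sqr_ge0.
have e0 : rc (\sum_(n < L) nm (fcoef m f n) ^+ 2) = \sum_(n < L) fcoef m f n * (fcoef m f n)^*.
  by rewrite rc_sum; apply: eq_bigr => i _; rewrite -nm_sqE.
have e1 := avg_mul_poly m f (fcoef m f) L; rewrite -/P -e0 in e1.
have e2 := avg_mul_poly m P (fcoef m f) L.
rewrite -/P (eq_bigr (fun n : 'I_L => fcoef m f n * (fcoef m f n)^*)) -?e0 in e2; last first.
  by move=> n _; rewrite fcoef_sum.
have e3 : avg m (fun z => P z * (f z)^*) = rc (\sum_(n < L) nm (fcoef m f n) ^+ 2).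
  rewrite -[RHS]rc_conj -e1 -avg_conj; apply: eq_avg => z _.
  by rewrite rmorphM /= conjCK mulrC.
rewrite rc_avgR [RHS](eq_avg _ (fun z _ => nm_sqE _)) (eq_avg _ (fun z _ => nm_sqE _)).
rewrite [RHS](eq_avg _ (G := fun z => f z * (f z)^* - f z * (P z)^* - P z * (f z)^* + P z * (P z)^*)).
  by rewrite avgD !avgB e1 e2 e3; ring.
by move=> z _; rewrite rmorphB; ring.
Qed.

Lemma nm_fcoef_le m f n c : (forall z, nm z = 1 -> nm (f z) <= c) -> nm (fcoef m f n) <= c.
Proof.
by move=> h; apply: nm_avg_le => z hz; rewrite nmM nm_conj nmX hz expr1n mulr1 h.
Qed.

End RootsOfUnity.

(** * Interpolation error and Taylor coefficients *)

Section Taylor.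
Variable R : realType.
Local Notation C := (CC R).
Local Notation w := (@unit_root R).
Local Notation N m := (2 ^ m.+1)%N.

Definition dirichlet m (u z : C) := \sum_(n < N m) (u^* * z) ^+ n.

Lemma nm_dirichlet m u z : nm u <= 1 -> nm z <= 1 -> nm (dirichlet m u z) <= (N m)%:R.
Proof.
move=> hu hz; apply: (le_trans (nm_sum _ _ _)).
rewrite -[X in _ <= X%:R]card_ord -sumr_const; apply: ler_sum => n _.
by rewrite nmX exprn_ile1 ?nm_ge0 // nmM nm_conj mulr_ile1 ?nm_ge0.
Qed.

(** The geometric sum cancels the factor u - z and leaves u times a quantity that does not depend on
    the node u. An average of terms f'(..) (u - z) against the kernel therefore becomes the average
    bounded by [avg_deriv_circle]. *)
Lemma dirichlet_mul m k z : dirichlet m (w m ^+ k) z * (w m ^+ k - z) = w m ^+ k * (1 - z ^+ N m).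
Proof.
set u := w m ^+ k.
have uu : u * u^* = 1 by rewrite -nm_sqE nm_unit_rootX expr1n.
have uN : (u^* * z) ^+ N m = z ^+ N m.
  by rewrite exprMn -rmorphXn -exprM mulnC exprM unit_rootX expr1n rmorph1 mul1r.
have -> : u - z = u * (1 - u^* * z) by rewrite mulrBr mulr1 mulrA uu mul1r.
rewrite mulrCA; congr (_ * _).
by rewrite -[1 - z ^+ _]opprB -uN subrX1 -[RHS]mulNr opprB mulrC.
Qed.

Lemma avg_dirichlet m z : avg m (fun u => dirichlet m u z) = 1.
Proof.
rewrite /dirichlet avg_sum.
rewrite (eq_bigr (fun n : 'I_(N m) => z ^+ n * (0%N == n)%:R)) => [|n _].
  have h0 : (0 < N m)%N by rewrite expn_gt0.
  rewrite (bigD1 (Ordinal h0)) //= big1 ?addr0 ?mulr1 // => i.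
  by rewrite -val_eqE /= eq_sym => /negbTE ->; rewrite mulr0.
rewrite -(avg_orth R (m := m)) ?expn_gt0 // -avgZ; apply: eq_avg => u _.
by rewrite exprMn rmorphXn mulrC expr0 mul1r.
Qed.

Lemma interpE m f z : interp m f z = avg m (fun u => f u * dirichlet m u z).
Proof.
transitivity (avg m (fun u => \sum_(n < N m) z ^+ n * (f u * (u ^+ n)^*))).
  by rewrite avg_sum; apply: eq_bigr => n _; rewrite avgZ mulrC.
apply: eq_avg => u _; rewrite /dirichlet mulr_sumr; apply: eq_bigr => n _.
by rewrite exprMn rmorphXn mulrCA [z ^+ n * _]mulrC.
Qed.

Lemma interpB m f z : interp m f z - f z = avg m (fun u => (f u - f z) * dirichlet m u z).
Proof.
rewrite interpE -[X in _ - X]mulr1 -(avg_dirichlet m z) -avgZ -avgB.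
by apply: eq_avg => u _; rewrite mulrBl.
Qed.

Lemma nm_convex (u z : C) (t : R) : nm u <= 1 -> nm z <= 1 -> 0 <= t <= 1 ->
  nm (z + rc t * (u - z)) <= 1.
Proof.
move=> hu hz /andP[t0 t1].
have -> : z + rc t * (u - z) = rc (1 - t) * z + rc t * u by rewrite rcB rc1; ring.
apply: (le_trans (nmD_le (nmM_le (lexx _) hz) (nmM_le (lexx _) hu))).
by rewrite !nm_rc !ger0_norm ?subr_ge0 //; lra.
Qed.

(* Discrete form of the vanishing of the integral of f' along a circle: the increments of [f]
   along the closed polygon of the points [z + t (u - z)] sum to zero. *)
Lemma avg_deriv_circle f f' (K : R) m z t :
  (forall x y, nm x <= 1 -> nm y <= 1 -> nm (f x - f y - f' y * (x - y)) <= K * nm (x - y) ^+ 2) ->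
  0 <= K -> nm z <= 1 -> 0 <= t <= 1 ->
  nm (avg m (fun u => f' (z + rc t * (u - z)) * u)) <= K * nm (w m - 1).
Proof.
move=> hK K0 hz ht.
pose p u := z + rc t * (u - z).
(* The steps of the polygon are proportional to t, which is divided out below. For t = 0 the average
   is f'(z) times the average of u, which vanishes. *)
have [/eqP t0|tn0] := boolP (t == 0).
  rewrite (eq_avg _ (G := fun u => f' z * (u ^+ 1 * (u ^+ 0)^*))); last first.
    by move=> u _; rewrite t0 rc0 mul0r addr0 expr0 rmorph1 mulr1 expr1.
  rewrite avgZ avg_orth ?expn_gt0 //; first by rewrite mulr0 nm0 mulr_ge0 ?nm_ge0.
  by rewrite expnS leq_pmulr // expn_gt0.
have t0 : 0 < t by rewrite lt_def tn0; case/andP: ht.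
have s0 : \sum_(k < N m) (f (p (w m ^+ k.+1)) - f (p (w m ^+ k))) = 0.
  rewrite -(big_mkord xpredT (fun k => f (p (w m ^+ k.+1)) - f (p (w m ^+ k)))).
  by rewrite telescope_sumr // unit_rootX expr0 subrr.
have h : nm (\sum_(k < N m) f' (p (w m ^+ k)) * (rc t * (w m ^+ k * (w m - 1)))) <=
   (N m)%:R * (K * (t * nm (w m - 1)) ^+ 2).
  rewrite -nmN -[X in nm X]sub0r -[X in nm (X - _)]s0 -sumrB.
  apply: (le_trans (nm_sum _ _ _)).
  rewrite mulr_natl -[X in _ *+ X]card_ord -sumr_const; apply: ler_sum => k _.
  have e : p (w m ^+ k.+1) - p (w m ^+ k) = rc t * (w m ^+ k * (w m - 1)).
    by rewrite /p exprS; ring.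
  rewrite -e; apply: (le_trans (hK _ _ _ _)); rewrite ?nm_convex ?nm_unit_rootX //.
  by rewrite e !nmM nm_rc nm_unit_rootX mul1r gtr0_norm.
have wn : 0 < nm (w m - 1) by rewrite nm_gt0 subr_eq0 unit_root_neq1.
have e : \sum_(k < N m) f' (p (w m ^+ k)) * (rc t * (w m ^+ k * (w m - 1))) =
   (N m)%:R * (rc t * (w m - 1)) * avg m (fun u => f' (p u) * u).
  have N0 := natN_neq0 R m; rewrite /avg; move: (N m)%:R N0 => n n0.
  rewrite [RHS](_ : _ = rc t * (w m - 1) * \sum_(k < N m) f' (p (w m ^+ k)) * w m ^+ k); last by field.
  rewrite mulr_sumr.
  by apply: eq_bigr => k _; ring.
change (nm (avg m (fun u => f' (p u) * u)) <= K * nm (w m - 1)).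
move: (avg m (fun u => f' (p u) * u)) e => A e.
rewrite e !nmM nm_nat nm_rc gtr0_norm // in h.
have NN := natN_gt0 R m.
rewrite -mulrA ler_pM2l // in h.
set q := t * nm (w m - 1) in h *.
have q0 : 0 < q by rewrite mulr_gt0.
rewrite expr2 (mulrCA K q q) ler_pM2l // in h.
apply: (le_trans h); rewrite ler_wpM2l // /q ger_pMl //; by case/andP: ht.
Qed.

(** The error is the average of (f u - f z) times the Dirichlet kernel. Cutting the segment from z
    to u into M pieces makes f u - f z a Riemann sum of f'(..) (u - z), to which [dirichlet_mul] and
    [avg_deriv_circle] apply. The constant [4 * K] collects |1 - z^N| <= 2 and |w_m - 1| <= 2
    (3/4)^m. *)
Lemma interp_err f f' : C11 f f' -> exists2 L : R, 0 <= L & forall m z, nm z <= 1 ->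
  nm (interp m f z - f z) <= L * (3 / 4) ^+ m.
Proof.
move=> /C11_lip[K K0 hK0].
have hK x y : nm x <= 1 -> nm y <= 1 -> nm (f x - f y - f' y * (x - y)) <= K * nm (x - y) ^+ 2.
  by move=> hx hy; case: (hK0 x y hx hy).
exists (4 * K); first by rewrite mulr_ge0.
move=> m z hz.
apply: (@le_trans _ _ (2 * (K * nm (w m - 1)))); last first.
  by have := unit_root_cvg1 R m; have := K0; nra.
(* The number M of pieces is independent of m: for fixed m it is sent to infinity, which removes the
   last term, the sum of the M quadratic remainders. *)
suff h M : (0 < M)%N -> nm (interp m f z - f z) <=
    2 * (K * nm (w m - 1)) + 4 * K * (N m)%:R / M%:R.
  apply/ler_addgt0Pr => e e0.
  have := archi_boundP (divr_ge0 (mulr_ge0 (mulr_ge0 (ler0n _ 4) K0) (ler0n R (N m))) (ltW e0)); move: (Num.bound _) => M hM.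
  apply: (le_trans (h M.+1 isT)); rewrite lerD2l.
  rewrite ler_pdivrMr ?ltr0n // [leRHS]mulrC -ler_pdivrMr //.
  by apply: (le_trans (ltW hM)); rewrite ler_nat.
move=> M0.
have Mp : 0 < M%:R :> R by rewrite ltr0n.
pose t (i : nat) : R := i%:R / M%:R.
pose p u i := z + rc (t i) * (u - z).
have ht i : (i <= M)%N -> 0 <= t i <= 1.
  by move=> iM; rewrite /t divr_ge0 //= ler_pdivrMr // mul1r ler_nat.
have p1 u i : nm u = 1 -> (i <= M)%N -> nm (p u i) <= 1.
  by move=> hu iM; rewrite nm_convex ?hu ?ht.
pose E u i := f (p u i.+1) - f (p u i) - f' (p u i) * (rc M%:R^-1 * (u - z)).
have step u i : p u i.+1 - p u i = rc M%:R^-1 * (u - z).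
  have e : t i.+1 = t i + M%:R^-1 by rewrite /t -natr1 mulrDl mul1r.
  by rewrite /p e rcD; ring.
have hE u i : nm u = 1 -> (i < M)%N -> nm (E u i) <= 4 * K / M%:R / M%:R.
  move=> hu iM; rewrite /E -(step u i).
  apply: (le_trans (hK _ _ (p1 _ _ hu _) (p1 _ _ hu (ltnW iM)))) => //.
  rewrite step nmM nm_rc ger0_norm ?invr_ge0 //.
  have : nm (u - z) <= 2 by apply: (le_trans (nmB _ _)); lra.
  have := nm_ge0 (u - z); set a := nm _ => a0 a2.
  have a4 : a ^+ 2 <= 4 by nra.
  have Mi : 0 <= (M%:R^-1 : R) ^+ 2 by rewrite sqr_ge0.
  rewrite exprMn (_ : 4 * K / M%:R / M%:R = K * (M%:R^-1 ^+ 2 * 4)); last by ring.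
  by rewrite ler_wpM2l // ler_wpM2l.
rewrite interpB.
have -> : avg m (fun u => (f u - f z) * dirichlet m u z) =
   (1 - z ^+ N m) * (rc M%:R^-1 * \sum_(i < M) avg m (fun u => f' (p u i) * u))
   + \sum_(i < M) avg m (fun u => E u i * dirichlet m u z).
  rewrite mulr_sumr mulr_sumr -big_split /=.
  rewrite (eq_bigr (fun i : 'I_M => avg m (fun u => (f (p u i.+1) - f (p u i)) * dirichlet m u z))).
    rewrite -avg_sum; apply: eq_avg => u _; rewrite -mulr_suml; congr (_ * _).
    rewrite -(big_mkord xpredT (fun i => f (p u i.+1) - f (p u i))) telescope_sumr //.
    have -> : p u M = u by rewrite /p /t divff ?lt0r_neq0 // rc1 mul1r addrC subrK.
    by have -> : p u 0%N = z by rewrite /p /t mul0r rc0 mul0r addr0.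
  move=> i _; rewrite -!avgZ -avgD /avg; congr (_ / _).
  apply: eq_bigr => k _; rewrite /E.
  have := dirichlet_mul m k z; set u := w m ^+ k; set D := dirichlet m u z => e.
  rewrite (_ : (1 - z ^+ N m) * _ = f' (p u i) * rc M%:R^-1 * (u * (1 - z ^+ N m))); last by ring.
  by rewrite -e; ring.
apply: nmD_le.
  apply: nmM_le.
    apply: (le_trans (nmB _ _)); rewrite nm1 nmX.
    by have := exprn_ile1 (N m) (nm_ge0 z) hz; lra.
  rewrite -[leRHS](mulKf (lt0r_neq0 Mp)).
  apply: nmM_le; first by rewrite nm_rc ger0_norm ?invr_ge0.
  apply: (le_trans (nm_sum _ _ _)).
  rewrite mulr_natl -[X in _ *+ X]card_ord -sumr_const; apply: ler_sum => i _.
  exact: (avg_deriv_circle m hK K0 hz (ht i (ltnW (ltn_ord i)))).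
apply: (le_trans (nm_sum _ _ _)).
rewrite (_ : 4 * K * (N m)%:R / M%:R = M%:R * (4 * K / M%:R / M%:R * (N m)%:R)); last first.
  by field; rewrite lt0r_neq0.
rewrite mulr_natl -[X in _ *+ X]card_ord -sumr_const; apply: ler_sum => i _.
apply: nm_avg_le => u hu; apply: nmM_le; first exact: hE.
by apply: nm_dirichlet; rewrite ?hu.
Qed.

Lemma nm_sum_geo (a : nat -> C) (z : C) (K : R) L M : nm z < 1 -> 0 <= K ->
  (forall n, nm (a n) <= K) ->
  nm (\sum_(L <= n < M) a n * z ^+ n) <= K * nm z ^+ L / (1 - nm z).
Proof.
move=> hz K0 hK; have h1 : 0 < 1 - nm z by rewrite subr_gt0.
apply: (le_trans (nm_sum _ _ _)).
apply: (@le_trans _ _ (\sum_(L <= n < M) K * nm z ^+ n)).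
  by apply: ler_sum => n _; rewrite nmM nmX ler_wpM2r ?exprn_ge0 ?nm_ge0.
rewrite -mulr_sumr -mulrA ler_wpM2l // ler_pdivlMr //.
have [ML|LM] := leqP M L.
  by rewrite big_geq // mul0r exprn_ge0 // nm_ge0.
rewrite mulr_suml (eq_bigr (fun n => - nm z ^+ n.+1 - - nm z ^+ n)) => [|n _].
  by rewrite telescope_sumr ?(ltnW LM) // opprK addrC gerBl exprn_ge0 // nm_ge0.
by rewrite exprS; ring.
Qed.

Lemma geo_small (z L : R) (e : R) : 0 <= z < 1 -> 0 < e ->
  exists M, forall n, (M <= n)%N -> L * z ^+ n <= e.
Proof.
move=> /andP[z0 z1] e0.
have : (fun n => L * z ^+ n) @ \oo --> (L * 0 : R).
  by apply: cvgM; [exact: cvg_cst|apply: cvg_expr; rewrite ger0_norm].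
rewrite mulr0 => /cvgR /(_ e e0) [M hM]; exists M => n /hM.
by rewrite subr0 => /(le_trans (ler_norm _)).
Qed.

(** The coefficient [a n] is the limit in m of the discrete coefficients. Averages over finer roots
    of unity recover the coefficients of the polynomial [interp m f], so two discrete coefficients
    differ at most by the interpolation error. The last clause is Bessel's inequality in the limit;
    its premise allows an error [e] for large m because that is what [littlewood] provides. *)
Lemma taylor f f' : C11 f f' -> exists a : nat -> C,
  [/\ forall z, nm z < 1 -> series (fun n => a n * z ^+ n) @ \oo --> f z,
      exists K, forall n, nm (a n) <= K &
      forall B : R, (forall e, 0 < e -> exists m0, forall m, (m0 <= m)%N ->
          avgR m (fun z => nm (f z) ^+ 2) <= B + e) ->
        forall L, \sum_(n < L) nm (a n) ^+ 2 <= B].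
Proof.
move=> hf; have [E E0 hE] := interp_err hf; have [K K0 hK] := C11_lip hf.
pose c m n := fcoef m f n.
have cK m n : nm (c m n) <= K.
  apply: nm_fcoef_le => z hz; have hz1 : nm z <= 1 by rewrite hz.
  by have [] := hK z z hz1 hz1.
have cc m m' n : (n < N m)%N -> (m <= m')%N -> nm (c m n - c m' n) <= E * (3 / 4) ^+ m.
  move=> nN mm.
  rewrite -(@fcoef_sum R m' (c m) (N m) n) ?leq_exp2l // /c /fcoef -avgB.
  apply: nm_avg_le => z hz.
  by rewrite -mulrBl nmM nm_conj nmX hz expr1n mulr1 hE // hz.
have nltN n m : (n <= m)%N -> (n < N m)%N.
  by move=> nm; apply: (leq_ltn_trans nm); apply: ltn_trans (ltn_expl _ _); rewrite ?ltnSn.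
have q01 : 0 <= (3 / 4 : R) < 1 by lra.
have cvgc n : cvgn (c ^~ n : nat -> C).
  apply: cauchyC => e e0; have e20 : 0 < e / 2 by rewrite divr_gt0.
  have [M hM] := geo_small E q01 e20.
  pose M0 := maxn M n; exists M0 => m m' h h'.
  have lt0 : (n < N M0)%N by apply: nltN; rewrite leq_maxr.
  have hM0 := hM M0 (leq_maxl _ _).
  apply: (le_trans (nm_dist_trans _ (c M0 n) _)); rewrite [e]splitr nm_distC.
  by apply: lerD; apply: le_trans hM0; apply: cc.
pose a n := limn (c ^~ n); have ha n : c ^~ n @ \oo --> a n := cvgc n.
have ca m n : (n < N m)%N -> nm (c m n - a n) <= E * (3 / 4) ^+ m.
  move=> nN; apply/ler_addgt0Pr => e e0.
  have [M hM] := (cvgC _ _).1 (ha n) e e0.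
  apply: (le_trans (nm_dist_trans _ (c (maxn M m) n) _)); apply: lerD.
    by apply: cc => //; rewrite leq_maxr.
  by apply: hM; rewrite leq_maxl.
have aK n : nm (a n) <= K.
  apply/ler_addgt0Pr => e e0; have [M hM] := (cvgC _ _).1 (ha n) e e0.
  have := hM M (leqnn _); rewrite nm_distC => h.
  rewrite -[a n](subrK (c M n)) addrC; apply: (le_trans (nmD_le (cK M n) h)).
  by [].
exists a; split; first 1 last.
- by exists K.
- move=> B hB L; apply/ler_addgt0Pr => e e0; have e20 : 0 < e / 2 by rewrite divr_gt0.
  have h : (fun m => \sum_(n < L) nm (c m n) ^+ 2) @ \oo --> \sum_(n < L) nm (a n) ^+ 2.
    apply: (@cvg_sum_ord R L (fun n m => nm (c m n) ^+ 2) (fun n => nm (a n) ^+ 2)) => n.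
    exact: cvg_nm2.
  have [M hM] := (cvgR _ _).1 h _ e20; have [m0 hm0] := hB _ e20.
  pose m := maxn (maxn M m0) L.
  have b := @bessel R m f L (ltnW (nltN L m (leq_maxr _ _))).
  have h1 := hM m ltac:(by rewrite !leq_max leqnn).
  have h2 := hm0 m ltac:(by rewrite !leq_max leqnn orbT).
  rewrite /= distrC in h1; have := le_trans (ler_norm _) h1.
  rewrite -/(c _) in b; move: b h2; rewrite -/c.
  by have := splitr e; lra.
move=> z hz; apply/cvgC => e e0.
have h1 : 0 < 1 - nm z by rewrite subr_gt0.
have z01 : 0 <= nm z < 1 by rewrite nm_ge0.
have [M hM] := geo_small (K / (1 - nm z)) z01 e0.
exists M => L ML; rewrite /series /= big_mkord.
apply: le_trans (hM L ML); apply/ler_addgt0Pr => d d0.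
(* The factor L + 1 counts the interpolation error at z and the L errors of the coefficients below
   L; the tail from L on is bounded uniformly in m. *)
have [m0 hm0] := geo_small (L.+1%:R * E) q01 d0.
pose m := maxn m0 L.
have Lm : (L <= N m)%N by apply: ltnW; apply: nltN; rewrite leq_maxr.
have e1 : \sum_(n < L) a n * z ^+ n - f z =
   (interp m f z - f z) - \sum_(n < L) (c m n - a n) * z ^+ n - \sum_(L <= n < N m) c m n * z ^+ n.
  rewrite /interp -(big_mkord xpredT (fun n => fcoef m f n * z ^+ n)) (big_cat_nat (leq0n L) Lm) /=.
  rewrite big_mkord [X in _ - X - _](_ : _ = \sum_(n < L) (c m n * z ^+ n) - \sum_(n < L) a n * z ^+ n).
    by rewrite /c; ring.
  by rewrite -sumrB; apply: eq_bigr => n _; rewrite mulrBl.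
rewrite e1 [leRHS]addrC; apply: (le_trans (nmB _ _)); apply: lerD; last first.
  by apply: (le_trans (nm_sum_geo _ _ hz K0 (cK m))); rewrite mulrAC.
apply: (le_trans (nmB _ _)).
apply: le_trans (hm0 m (leq_maxl _ _)).
rewrite -natr1 mulrDl mul1r mulrDl [leRHS]addrC.
apply: lerD; first by apply: hE; exact: ltW.
apply: (le_trans (nm_sum _ _ _)).
rewrite mulr_natl mulrnAl -[X in _ *+ X]card_ord -sumr_const; apply: ler_sum => n _.
rewrite nmM nmX -[leRHS]mulr1; apply: ler_pM; rewrite ?exprn_ge0 ?nm_ge0 //.
  by apply: ca; apply: leq_trans Lm.
by rewrite exprn_ile1 ?nm_ge0 // ltW.
Qed.

(** Mean value property: at 0 only the constant term of [interp m f] survives, and this term is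
    [avg m f]. *)
Lemma avg_cvg (f f' : C -> C) : C11 f f' -> (fun m => avg m f) @ \oo --> f 0.
Proof.
move=> /interp_err[E E0 hE]; apply/cvgC => e e0.
have q01 : 0 <= (3 / 4 : R) < 1 by lra.
have [M hM] := geo_small E q01 e0; exists M => m /hM; apply: le_trans.
have N0 : (0 < N m)%N by rewrite expn_gt0.
have := hE m 0; rewrite nm0 /interp (bigD1 (Ordinal N0)) //= big1 => [|i].
  rewrite addr0 expr0 mulr1 /fcoef => h; rewrite -(eq_avg _ (F := fun z => f z * (z ^+ 0)^*)) ?h //.
  by move=> z _; rewrite expr0 rmorph1 mulr1.
by rewrite -val_eqE /= -lt0n => i0; rewrite expr0n gtn_eqF // mulr0.
Qed.

End Taylor.

(** * Littlewood subordination *)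

Section Littlewood.
Variable R : realType.
Local Notation C := (CC R).

(* For |z| = 1, the real part of [autocorr s] is |Poly s|^2; inside the disc it is the harmonic
   majorant of |Poly s|^2. *)
Fixpoint autocorr (s : seq C) : {poly C} :=
  if s is a :: t then (a * a^*)%:P + (a^* *+ 2) *: ('X * Poly t) + autocorr t else 0.

Lemma horner_Poly_cons (a w : C) t : (Poly (a :: t)).[w] = (Poly t).[w] * w + a.
Proof. by rewrite /= cons_poly_def hornerD hornerMX hornerC. Qed.

Lemma re_autocorr_cons (a w : C) t : re (autocorr (a :: t)).[w] =
  nm a ^+ 2 + re ((Poly t).[w] * w * a^*) *+ 2 + re (autocorr t).[w].
Proof.
rewrite [autocorr _]/= 2!hornerD hornerC hornerZ hornerM hornerX !reD -nm_sqE re_rc.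
have -> : (a^* *+ 2) * (w * (Poly t).[w]) = rc 2 * ((Poly t).[w] * w * a^*).
  by rewrite rc_nat -[_ *+ 2]mulr_natl; ring.
by rewrite re_rcM mulr_natl.
Qed.

(** Adding a coefficient turns |P|^2 into |w P + a|^2, while the majorant keeps its previous value
    and gains the same mixed term; only the factor |w|^2 <= 1 is lost. *)
Lemma autocorr_ge s w : nm w <= 1 -> nm (Poly s).[w] ^+ 2 <= re (autocorr s).[w].
Proof.
move=> hw; elim: s => [|a t ih]; first by rewrite /= !horner0 nm0 expr0n.
rewrite horner_Poly_cons re_autocorr_cons nm2D nmM.
have : (nm (Poly t).[w] * nm w) ^+ 2 <= nm (Poly t).[w] ^+ 2.
  by rewrite exprMn ler_piMr ?sqr_ge0 // exprn_ile1 ?nm_ge0.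
by lra.
Qed.

(** Harnack's inequality for the nonnegative harmonic function Re [autocorr s], whose value at 0 is
    the sum of the squares; here it is obtained by induction on the coefficients. *)
Lemma autocorr_le s w : nm w < 1 ->
  re (autocorr s).[w] <= (1 + nm w) / (1 - nm w) * \sum_(a <- s) nm a ^+ 2.
Proof.
move=> hw; set r := nm w; have r0 : 0 <= r := nm_ge0 w.
have r1 : 0 < 1 - r by rewrite subr_gt0.
(* The added multiple of |P(w)|^2 strengthens the claim enough for the induction to absorb the mixed
   term. *)
apply: (@le_trans _ _ (re (autocorr s).[w] + r * nm (Poly s).[w] ^+ 2)).
  by rewrite lerDl mulr_ge0 // sqr_ge0.
elim: s => [|a t ih]; first by rewrite /= !horner0 nm0 big_nil re0; lra.
rewrite horner_Poly_cons re_autocorr_cons big_cons.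
have h := nm2D ((Poly t).[w] * w) a; have h2 := nmD ((Poly t).[w] * w) a.
rewrite nmM -/r in h h2.
set f := nm (_ + a) in h h2 *; set p := nm (Poly t).[w] in ih h h2.
have f0 : 0 <= f := nm_ge0 _; have p0 : 0 <= p := nm_ge0 _; have a0 := nm_ge0 a.
set x := nm a in h h2 a0 *.
have key : (1 - r) * f ^+ 2 <= x ^+ 2 + r * (1 - r) * p ^+ 2.
  apply: (@le_trans _ _ ((1 - r) * (p * r + x) ^+ 2)).
    by rewrite ler_pM2l // ler_sqr ?nnegrE // addr_ge0 // mulr_ge0.
  rewrite -subr_ge0 [X in 0 <= X](_ : _ = r * (x - (1 - r) * p) ^+ 2); last by ring.
  by rewrite mulr_ge0 // sqr_ge0.
rewrite mulrDr.
have -> : (1 + r) / (1 - r) * x ^+ 2 = (1 + r) / (1 - r) * (x ^+ 2 + r * (1 - r) * p ^+ 2) - (1 + r) * r * p ^+ 2.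
  by field; rewrite lt0r_neq0.
have : (1 + r) * f ^+ 2 <= (1 + r) / (1 - r) * (x ^+ 2 + r * (1 - r) * p ^+ 2).
  rewrite -[leLHS](_ : (1 + r) / (1 - r) * ((1 - r) * f ^+ 2) = _); last by field; rewrite lt0r_neq0.
  by rewrite ler_wpM2l // divr_ge0 //; lra.
rewrite exprMn in h; nra.
Qed.

Lemma horner_Poly_mkseq (a : nat -> C) N w : (Poly (mkseq a N)).[w] = \sum_(n < N) a n * w ^+ n.
Proof.
rewrite (@horner_coef_wide _ N); last first.
  by apply: (leq_trans (size_Poly _)); rewrite size_mkseq.
by apply: eq_bigr => i _; rewrite coef_Poly nth_mkseq.
Qed.

(** On the circle |P(f)|^2 is at most Re F(f) with F the autocorrelation polynomial. The averages of
    F(f) tend to F(f(0)) by the mean value property, and Harnack's inequality bounds this value. *)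
Lemma littlewood f f' (a : nat -> C) N e : C11 f f' -> (forall z, nm z <= 1 -> nm (f z) <= 1) ->
  nm (f 0) < 1 -> 0 < e -> exists m0, forall m, (m0 <= m)%N ->
  avgR m (fun z => nm (\sum_(n < N) a n * f z ^+ n) ^+ 2) <=
  (1 + nm (f 0)) / (1 - nm (f 0)) * (\sum_(n < N) nm (a n) ^+ 2) + e.
Proof.
move=> hf f1 f0 e0; pose s := mkseq a N.
have [M hM] := (cvgC _ _).1 (avg_cvg (C11_poly (autocorr s) hf)) e e0.
exists M => m /hM h.
apply: (@le_trans _ _ (avgR m (fun z => re (autocorr s).[f z]))).
  apply: ler_avgR => z hz; rewrite -horner_Poly_mkseq.
  by apply: autocorr_ge; apply: f1; rewrite hz.
rewrite -re_avg.
have hs := autocorr_le s f0.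
rewrite /s big_map -(big_mkord xpredT (fun n => nm (a n) ^+ 2)) /index_iota subn0 in hs *.
move: (le_trans (re_le_nm _) h); rewrite reB => h2.
by lra.
Qed.

End Littlewood.

(** * Square-summable sequences and the Hardy space *)

Section SquareSummable.
Variable R : realType.
Local Notation C := (CC R).
Implicit Types (a b c : nat -> C) (S T : R).

(** Bounding all partial sums keeps the norm estimates in the totally ordered field [R]. *)
Definition l2le a S := forall N, \sum_(n < N) nm (a n) ^+ 2 <= S.
Definition l2 a := exists S, l2le a S.
(** Bilinear: the conjugation of the inner product is put into the second argument by hand. With [b]
    the powers of z it is evaluation at z. *)
Definition l2pair a b : C := limn (series (fun n => a n * b n)).

Lemma l2le_ge0 a S : l2le a S -> 0 <= S.
Proof. by move=> /(_ 0%N); rewrite big_ord0. Qed.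

Lemma l2_bounded a : l2 a -> exists K, forall n, nm (a n) <= K.
Proof.
move=> [S hS]; exists (S + 1) => n; have := hS n.+1; rewrite big_ord_recr /=.
have h : 0 <= \sum_(i < n) nm (a i) ^+ 2 by apply: sumr_ge0 => i _; exact: sqr_ge0.
by have := nm_ge0 (a n); nra.
Qed.

Lemma cvgR_le (u : nat -> R) (l B : R) : u @ \oo --> l ->
  (exists M, forall n, (M <= n)%N -> u n <= B) -> l <= B.
Proof.
move=> /cvgR h [M hM]; apply/ler_addgt0Pr => e /h [N hN].
have := hN _ (leq_maxr M N); rewrite distrC => /(le_trans (ler_norm _)).
by have := hM _ (leq_maxl M N); lra.
Qed.

Lemma cvgC_le (u : nat -> C) (l : C) (B : R) : u @ \oo --> l ->
  (exists M, forall n, (M <= n)%N -> nm (u n) <= B) -> nm l <= B.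
Proof.
move=> /cvgC h [M hM]; apply/ler_addgt0Pr => e /h [N hN].
have := hN _ (leq_maxr M N); rewrite nm_distC => h2.
rewrite -[l](subrK (u (maxn M N))) addrC; apply: (le_trans (nmD_le _ h2)).
  by apply: hM; exact: leq_maxl.
by [].
Qed.

Lemma l2_tail a e : l2 a -> 0 < e -> exists M, forall p q, (M <= p)%N ->
  \sum_(p <= n < q) nm (a n) ^+ 2 <= e.
Proof.
move=> [S hS] e0; pose u N := \sum_(0 <= n < N) nm (a n) ^+ 2.
have um : nondecreasing_seq u.
  move=> p q pq; rewrite /u (big_cat_nat (leq0n p) pq) /= lerDl.
  by apply: sumr_ge0 => n _; exact: sqr_ge0.
have : cvgn u.
  apply: nondecreasing_is_cvgn => //; exists S => _ [N _ <-].
  by rewrite /u big_mkord.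
move=> /cvg_ex [l /cvgR /(_ (e / 2))]; rewrite divr_gt0 // => /(_ isT) [M hM].
exists M => p q Mp; have [pq|qp] := leqP p q; last by rewrite big_geq ?(ltnW qp) // ltW.
have h1 := hM _ Mp; have h2 := hM _ (leq_trans Mp pq).
have : u q = u p + \sum_(p <= n < q) nm (a n) ^+ 2 by rewrite /u (big_cat_nat (leq0n p) pq).
by move: h1 h2; rewrite !ler_norml => /andP[h1 h2] /andP[h3 h4] h5; lra.
Qed.

(** A form of the Cauchy-Schwarz inequality without square roots; the weight t is chosen at each
    use. *)
Lemma nm_sum_amgm (s : seq nat) a b (t : R) : 0 < t ->
  nm (\sum_(n <- s) a n * b n) <=
  (t * (\sum_(n <- s) nm (a n) ^+ 2) + (\sum_(n <- s) nm (b n) ^+ 2) / t) / 2.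
Proof.
move=> t0; apply: (le_trans (nm_sum _ _ _)).
rewrite mulr_sumr [X in _ + X]mulr_suml -big_split /= mulr_suml.
apply: ler_sum => n _; rewrite nmM; set x := nm (a n); set y := nm (b n).
rewrite -subr_ge0 [X in 0 <= X](_ : _ = (t * x - y) ^+ 2 / t / 2); last by field; rewrite lt0r_neq0.
by rewrite !divr_ge0 ?sqr_ge0 // ltW.
Qed.

Lemma l2pair_cvg a b : l2 a -> l2 b -> series (fun n => a n * b n) @ \oo --> l2pair a b.
Proof.
move=> ha hb; apply: cauchyC => e e0.
have [M hM] := l2_tail ha e0; have [M' hM'] := l2_tail hb e0.
exists (maxn M M').
suff h p q : (maxn M M' <= p)%N -> (p <= q)%N -> nm (series (fun n => a n * b n) q -
    series (fun n => a n * b n) p) <= e.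
  move=> p q hp hq; have [pq|qp] := leqP p q; first by rewrite nm_distC h.
  by rewrite h // ltnW.
rewrite geq_max => /andP[hp hp'] pq.
rewrite /series /= (big_cat_nat (leq0n p) pq) /= [_ + _ - _]addrAC subrr add0r.
apply: (le_trans (nm_sum_amgm _ _ _ (@ltr01 _))); rewrite mul1r divr1.
by have := hM p q hp; have := hM' p q hp'; lra.
Qed.

Lemma l2pair_eq a b (l : C) : series (fun n => a n * b n) @ \oo --> l -> l2pair a b = l.
Proof. exact: cvg_limC. Qed.

Lemma l2pair_le a b S T (t : R) : l2le a S -> l2le b T -> 0 < t -> nm (l2pair a b) <= (t * S + T / t) / 2.
Proof.
move=> ha hb t0; apply: cvgC_le (l2pair_cvg (ex_intro _ _ ha) (ex_intro _ _ hb)) _.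
exists 0%N => n _; rewrite /series /=; apply: (le_trans (nm_sum_amgm _ _ _ t0)).
rewrite ler_pM2r ?invr_gt0 // lerD ?ler_pM2l // ?ler_pM2r ?invr_gt0 //; rewrite big_mkord.
  exact: ha.
exact: hb.
Qed.

Lemma l2D a b : l2 a -> l2 b -> l2 (fun n => a n + b n).
Proof.
move=> [S hS] [T hT]; exists (2 * S + 2 * T) => N.
apply: (@le_trans _ _ (\sum_(n < N) (2 * nm (a n) ^+ 2 + 2 * nm (b n) ^+ 2))).
  apply: ler_sum => n _; have := nmD (a n) (b n); have := nm_ge0 (a n + b n).
  set x := nm (a n); set y := nm (b n); set t := nm _ => t0 txy.
  have h : t ^+ 2 <= (x + y) ^+ 2 by rewrite ler_sqr ?nnegrE // (le_trans t0).
  apply: (le_trans h); rewrite -subr_ge0 [X in 0 <= X](_ : _ = (x - y) ^+ 2) ?sqr_ge0 //; ring.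
rewrite big_split /= -!mulr_sumr.
by have := hS N; have := hT N; lra.
Qed.

Lemma l2Z (x : C) a : l2 a -> l2 (fun n => x * a n).
Proof.
move=> [S hS]; exists (nm x ^+ 2 * S) => N.
rewrite (eq_bigr (fun n : 'I_N => nm x ^+ 2 * nm (a n) ^+ 2)) => [|n _]; last by rewrite nmM exprMn.
by rewrite -mulr_sumr ler_wpM2l ?sqr_ge0 //; exact: hS.
Qed.

Lemma l2_0 : l2 (fun=> 0).
Proof. by exists 0 => N; under eq_bigr do rewrite nm0 expr0n; rewrite big1_eq. Qed.

Lemma l2_sum I (s : seq I) (F : I -> nat -> C) : (forall i, l2 (F i)) ->
  l2 (fun n => \sum_(i <- s) F i n).
Proof.
move=> h; elim: s => [|i s ih].
  by rewrite (_ : (fun _ => _) = fun=> 0); [exact: l2_0|apply/funext => n; rewrite big_nil].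
rewrite (_ : (fun _ => _) = fun n => F i n + \sum_(j <- s) F j n); first exact: l2D.
by apply/funext => n; rewrite big_cons.
Qed.

Lemma l2_conj a : l2 a -> l2 (fun n => (a n)^*).
Proof.
by move=> [S hS]; exists S => N; under eq_bigr do rewrite nm_conj; exact: hS.
Qed.

Lemma l2_shift a : l2 a -> l2 (fun n => a n.+1).
Proof.
move=> [S hS]; exists S => N; have := hS N.+1; rewrite big_ord_recl /= => h.
by apply: le_trans h; rewrite lerDr sqr_ge0.
Qed.

Lemma l2pairDl a a' b : l2 a -> l2 a' -> l2 b ->
  l2pair (fun n => a n + a' n) b = l2pair a b + l2pair a' b.
Proof.
move=> ha ha' hb; apply: l2pair_eq.
rewrite (_ : series _ = fun n => series (fun n => a n * b n) n + series (fun n => a' n * b n) n).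
  by apply: cvgD; exact: l2pair_cvg.
apply/funext => n; rewrite /series /= -big_split /=.
by apply: eq_bigr => k _; rewrite mulrDl.
Qed.

Lemma l2pairZl (x : C) a b : l2 a -> l2 b -> l2pair (fun n => x * a n) b = x * l2pair a b.
Proof.
move=> ha hb; apply: l2pair_eq.
rewrite (_ : series _ = fun n => x * series (fun n => a n * b n) n).
  by apply: cvgMr; exact: l2pair_cvg.
apply/funext => n; rewrite /series /= mulr_sumr.
by apply: eq_bigr => k _; rewrite mulrA.
Qed.

Lemma l2pair_suml I (s : seq I) (F : I -> nat -> C) (x : I -> C) b : (forall i, l2 (F i)) -> l2 b ->
  l2pair (fun n => \sum_(i <- s) x i * F i n) b = \sum_(i <- s) x i * l2pair (F i) b.
Proof.
move=> h hb; elim: s => [|i s ih].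
  rewrite big_nil; apply: l2pair_eq.
  rewrite (_ : series _ = fun=> 0); first exact: cvg_cst.
  by apply/funext => n; rewrite /series /= big1 // => k _; rewrite big_nil mul0r.
have hs : l2 (fun n => \sum_(j <- s) x j * F j n) by apply: l2_sum => j; exact: l2Z.
rewrite big_cons -ih -(l2pairZl _ (h i) hb) -(l2pairDl (l2Z _ (h i)) hs hb).
by congr (l2pair _ _); apply/funext => n; rewrite big_cons.
Qed.

Lemma l2_geo (z : C) : nm z < 1 -> l2 (fun n => z ^+ n).
Proof.
move=> hz; exists (1 - nm z)^-1 => N.
apply: (@le_trans _ _ (\sum_(0 <= n < N) nm z ^+ n)).
  rewrite big_mkord; apply: ler_sum => n _; rewrite nmX -exprM.
  by rewrite exprM expr2 ler_piMl ?exprn_ge0 ?nm_ge0 ?exprn_ile1 ?nm_ge0 // ltW.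
have h : 0 < 1 - nm z by rewrite subr_gt0.
rewrite -[_^-1]mul1r ler_pdivlMr // mulr_suml.
rewrite (eq_bigr (fun n => - nm z ^+ n.+1 - - nm z ^+ n)) => [|n _].
  by rewrite telescope_sumr // opprK expr0 addrC gerBl exprn_ge0 // nm_ge0.
by rewrite exprS; ring.
Qed.

(** If all differences below n vanish, the n-th term is cancelled by the tail, so |c_n| is at most a
    multiple of x / (1 - x) for every small x > 0. *)
Lemma power_series_unique a b K : (forall n, nm (a n) <= K) -> (forall n, nm (b n) <= K) ->
  (forall z : C, nm z < 1 -> exists l : C, series (fun n => a n * z ^+ n) @ \oo --> l /\
      series (fun n => b n * z ^+ n) @ \oo --> l) -> a = b.
Proof.
move=> ha hb h; pose c n := a n - b n.
have K0 : 0 <= K := le_trans (nm_ge0 _) (ha 0%N).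
have K20 : 0 <= K + K by lra.
have hc n : nm (c n) <= K + K by apply: nmB_le.
suff : forall n, c n = 0 by move=> c0; apply/funext => n; apply/eqP; rewrite -subr_eq0; apply/eqP; exact: c0.
elim/ltn_ind => n ih.
apply/eqP; rewrite -nm_eq0 eq_le nm_ge0 andbT; apply/ler_addgt0Pr => e e0; rewrite add0r.
(* The first bound gives 1 - x >= 1/2 and the second (K + K) x <= e / 2, so that (K + K) x / (1 - x)
   <= e. *)
pose x : R := Num.min (1 / 2) (e / (2 * (K + K) + 1)).
have xp : 0 < x by rewrite lt_min !divr_gt0 //; lra.
have x1 : x <= 1 / 2 by rewrite ge_min lexx.
have x2 : x * (2 * (K + K) + 1) <= e by rewrite -ler_pdivlMr ?ge_min ?lexx ?orbT //; lra.
have nx : nm (rc x) = x by rewrite nm_rc gtr0_norm.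
have x11 : x < 1 by lra.
have [l [la lb]] := h (rc x) ltac:(by rewrite nx).
have : series (fun k => c k * rc x ^+ k) @ \oo --> (0 : C).
  rewrite -[0](subrr l) (_ : series _ = fun n => series (fun k => a k * rc x ^+ k) n - series (fun k => b k * rc x ^+ k) n).
    exact: cvgB.
  by apply/funext => m; rewrite /series /= -sumrB; apply: eq_bigr => k _; rewrite mulrBl.
move=> /cvgC h0.
have xn0 : 0 < x ^+ n by rewrite exprn_gt0.
have hh : nm (c n * rc x ^+ n) <= (K + K) * x ^+ n.+1 / (1 - x).
  apply/ler_addgt0Pr => d /h0 [M hM]; have := hM (maxn M n.+1) (leq_maxl _ _).
  rewrite subr0 /series /= (big_cat_nat (leq0n n.+1) (leq_maxr _ _)) /= => h1.
  rewrite big_nat_recr //= big1_seq ?add0r in h1; last first.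
    by move=> k /=; rewrite mem_index_iota => /andP[_ kn]; rewrite ih // mul0r.
  set s := \sum_(_ <= _ < _) _ in h1.
  rewrite -[c n * _](addrK s) addrC.
  apply: (le_trans (nmD_le _ h1)) => //; rewrite nmN.
  have nx1 : nm (rc x) < 1 by rewrite nx.
  by have := nm_sum_geo n.+1 (maxn M n.+1) nx1 K20 hc; rewrite nx lerD2r.
rewrite nmM nmX nx exprS in hh.
have hh2 : nm (c n) <= (K + K) * x / (1 - x).
  by rewrite -(ler_pM2r xn0); apply: (le_trans hh); rewrite le_eqVlt; apply/orP; left; apply/eqP; ring.
apply: (le_trans hh2); rewrite ler_pdivrMr; last by lra.
have : 0 <= e * (1 / 2 - x) by rewrite mulr_ge0; lra.
by nra.
Qed.

(** [tau n] stands for the image of z^n under an operator and [t] for its matrix. [taylor], applied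
    to a finite combination of the [tau n], bounds the squared norm; uniqueness of the coefficients
    identifies them with the combination of the rows [t n]. *)
Lemma finite_op_bound (tau tau' : nat -> C -> C) (M : R) : 0 <= M ->
  (forall n, C11 (tau n) (tau' n)) ->
  (forall N a e, 0 < e -> exists m0, forall m, (m0 <= m)%N ->
     avgR m (fun z => nm (\sum_(n < N) a n * tau n z) ^+ 2) <=
       M * (\sum_(n < N) nm (a n) ^+ 2) + e) ->
  exists t : nat -> nat -> C,
    [/\ forall n z, nm z < 1 -> series (fun k => t n k * z ^+ k) @ \oo --> tau n z,
      forall n, l2 (t n) &
      forall N a, l2le (fun k => \sum_(n < N) a n * t n k) (M * \sum_(n < N) nm (a n) ^+ 2)].
Proof.
move=> M0 htau hM.
have hf N a : C11 (fun z => \sum_(n < N) a n * tau n z) (fun z => \sum_(n < N) a n * tau' n z).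
  apply: C11_sum => n; apply: C11_ext (C11M (C11_cst (a n)) (htau n)) => x _.
  by rewrite mul0r add0r.
have /choice [t ht] n : exists t : nat -> C, (forall z, nm z < 1 -> series (fun k => t k * z ^+ k) @ \oo --> tau n z)
   /\ l2 t.
  have [a [h1 _ h3]] := taylor (htau n); exists a; split=> //.
  exists (M * \sum_(i < n.+1) nm ((i == n :> nat)%:R : C) ^+ 2) => L; apply: h3 => e e0.
  have [m0 hm0] := hM n.+1 (fun i => (i == n)%:R) e e0; exists m0 => m /hm0.
  apply: le_trans; apply: ler_avgR => z _.
  rewrite big_ord_recr /= eqxx mul1r big1 ?add0r // => i _.
  by rewrite ltn_eqF ?ltn_ord // mul0r.
exists t; split=> [n|n|N a]; [by case: (ht n)|by case: (ht n)|].
have [c [h1 [K hK] h3]] := taylor (hf N a).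
rewrite (_ : (fun k => _) = c); first by move=> L; apply: h3; exact: hM.
have l2s : l2 (fun k => \sum_(n < N) a n * t n k).
  by apply: (@l2_sum 'I_N _ (fun n k => a n * t n k)) => n; apply: l2Z; case: (ht n).
have [K' hK'] := l2_bounded l2s.
apply: (@power_series_unique _ _ (Num.max K K')) => [n|n|z hz].
- by rewrite le_max hK' orbT.
- by rewrite le_max hK.
exists (\sum_(n < N) a n * tau n z); split; last exact: h1.
rewrite (_ : series _ = fun L => \sum_(n < N) a n * series (fun k => t n k * z ^+ k) L).
  apply: (@cvg_sum_ord C N (fun n L => a n * series (fun k => t n k * z ^+ k) L) (fun n => a n * tau n z)).
  by move=> n; apply: cvgMr; case: (ht n) => h _; exact: h.
apply/funext => L; rewrite /series /=.
transitivity (\sum_(0 <= k < L) \sum_(n < N) a n * (t n k * z ^+ k)).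
  by apply: eq_bigr => k _; rewrite mulr_suml; apply: eq_bigr => n _; rewrite mulrA.
by rewrite exchange_big; apply: eq_bigr => n _; rewrite mulr_sumr.
Qed.

(** The images [cc N] of the truncations of [a] are Cauchy in l2, hence converge in each coordinate.
    The convergence of the pairings is recorded because it serves twice: for evaluation at a point
    and for the inner product in the adjoint identity. *)
Lemma l2_op_extend (t : nat -> nat -> C) (M : R) : 0 <= M -> (forall n, l2 (t n)) ->
  (forall N a, l2le (fun k => \sum_(n < N) a n * t n k) (M * \sum_(n < N) nm (a n) ^+ 2)) ->
  forall a, l2 a -> exists c,
    (forall S, l2le a S -> l2le c (M * S)) /\
    forall b, l2 b -> (fun N => \sum_(n < N) a n * l2pair (t n) b) @ \oo --> l2pair c b.
Proof.
move=> M0 ht hM a ha.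
pose cc N k := \sum_(n < N) a n * t n k.
have tail L N : (L <= N)%N -> l2le (fun k => cc N k - cc L k) (M * \sum_(L <= n < N) nm (a n) ^+ 2).
  move=> LN; have := hM N (fun n => if (n < L)%N then 0 else a n).
  rewrite (_ : (fun k => _) = (fun k => cc N k - cc L k)).
    rewrite (_ : \sum_(n < N) _ = \sum_(L <= n < N) nm (a n) ^+ 2) //.
    rewrite -(big_mkord xpredT (fun n => nm (if (n < L)%N then 0 else a n) ^+ 2)).
    rewrite (big_cat_nat (leq0n L) LN) /= big1_seq ?add0r.
      apply: eq_big_nat => n /andP[Ln _]; by rewrite ltnNge Ln.
    by move=> n /=; rewrite mem_index_iota => /andP[_ ->]; rewrite nm0 expr0n.
  apply/funext => k; rewrite /cc.
  rewrite -(big_mkord xpredT (fun n => (if (n < L)%N then 0 else a n) * t n k)).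
  rewrite -(big_mkord xpredT (fun n => a n * t n k)) -(big_mkord xpredT (fun n => a n * t n k)).
  rewrite !(big_cat_nat (leq0n L) LN) /= big1_seq ?add0r.
    rewrite [_ + _ - _]addrAC subrr add0r.
    by apply: eq_big_nat => n /andP[Ln _]; rewrite ltnNge Ln.
  by move=> n /=; rewrite mem_index_iota => /andP[_ ->]; rewrite mul0r.
have M1 : 0 < M + 1 by lra.
have tail_small e : 0 < e -> exists L, forall p q, (L <= p)%N -> (p <= q)%N ->
    l2le (fun k => cc q k - cc p k) e.
  move=> e0; have [L hL] := l2_tail ha (divr_gt0 e0 M1).
  exists L => p q Lp pq K; apply: (le_trans (tail p q pq K)).
  have := hL p q Lp; rewrite ler_pdivlMr // => h.
  have : 0 <= \sum_(p <= n < q) nm (a n) ^+ 2 by apply: sumr_ge0 => n _; exact: sqr_ge0.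
  by lra.
have cvgc k : cvgn (cc ^~ k : nat -> C).
  apply: cauchyC => e e0; have [L hL] := tail_small (e ^+ 2) ltac:(by rewrite exprn_gt0).
  have h p q : (L <= p)%N -> (p <= q)%N -> nm (cc q k - cc p k) <= e.
    move=> Lp pq; have := hL p q Lp pq k.+1; rewrite big_ord_recr /= => h.
    rewrite -ler_sqr ?nnegrE ?nm_ge0 ?(ltW e0) //; apply: le_trans h; rewrite lerDr.
    by apply: sumr_ge0 => i _; exact: sqr_ge0.
  exists L => p q Lp Lq; have [pq|qp] := leqP p q; last by rewrite h // ltnW.
  by rewrite nm_distC h.
pose c k := limn (cc ^~ k); have hc k : cc ^~ k @ \oo --> c k := cvgc k.
(* Norm bounds pass to the coordinatewise limit, since each partial sum has finitely many terms. *)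
have limc u B : (exists M0, forall N, (M0 <= N)%N -> l2le (fun k => cc N k - u k) B) ->
    l2le (fun k => c k - u k) B.
  move=> [M2 h] K.
  apply: (@cvgR_le (fun N => \sum_(k < K) nm (cc N k - u k) ^+ 2)); last first.
    by exists M2 => N /h; exact.
  apply: (@cvg_sum_ord R K (fun k N => nm (cc N k - u k) ^+ 2) (fun k => nm (c k - u k) ^+ 2)) => k.
  by apply: cvg_nm2; apply: cvgB => //; exact: cvg_cst.
have cM S : l2le a S -> l2le c (M * S).
  move=> hS; have h : l2le (fun k => c k - 0) (M * S).
    apply: limc; exists 0%N => N _ K; under eq_bigr do rewrite subr0.
    by apply: (le_trans (hM N a K)); rewrite ler_wpM2l.
  by move=> K; have := h K; under eq_bigr do rewrite subr0.
exists c; split=> // b hb.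
have l2c : l2 c by case: ha => S hS; exists (M * S); exact: cM.
have l2cc N : l2 (cc N) by apply: (@l2_sum 'I_N _ (fun n k => a n * t n k)) => n; exact: l2Z.
apply/cvgC => e e0; case: (hb) => T hT; have T0 := l2le_ge0 hT.
have T1 : 0 < T + 1 by lra.
(* The weight in [l2pair_le]: with the squared norm of the difference at most e^2 / (T + 1), both
   terms of the estimate are at most e. *)
have tp : 0 < (T + 1) / e by rewrite divr_gt0.
have [L hL] := tail_small (e / ((T + 1) / e)) ltac:(by rewrite divr_gt0).
exists L => N LN; rewrite -l2pair_suml // nm_distC.
have -> : l2pair c b - l2pair (fun k => \sum_(i < N) a i * t i k) b = l2pair (fun k => c k - cc N k) b.
  rewrite -[X in _ - X]mul1r -mulNr -(l2pairZl _ (l2cc N) hb) -(l2pairDl l2c (l2Z _ (l2cc N)) hb).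
  by congr (l2pair _ _); apply/funext => k; rewrite mulN1r.
have h1 : l2le (fun k => c k - cc N k) (e / ((T + 1) / e)).
  by apply: limc; exists N => N' NN'; exact: hL.
apply: (le_trans (l2pair_le h1 hT tp)).
have e1 : (T + 1) / e * (e / ((T + 1) / e)) = e by field; rewrite !lt0r_neq0.
have e2 : T / ((T + 1) / e) = T * e / (T + 1) by field; rewrite !lt0r_neq0.
rewrite e1 e2; have : T * e / (T + 1) <= e by rewrite ler_pdivrMr // mulrC; nra.
by lra.
Qed.

End SquareSummable.

(** * Operators on the Hardy space *)

Section HardySpace.
Variable R : realType.
Local Notation C := (CC R).
Implicit Types (a b c : nat -> C) (f g : C -> C) (S : R).

Lemma l2P a : l2 a <-> cvgn (series (fun n => `|a n| ^+ 2) : nat -> C).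
Proof.
have e n : series (fun n => `|a n| ^+ 2) n = rc (\sum_(i < n) nm (a i) ^+ 2).
  by rewrite rc_sum /series /= big_mkord; apply: eq_bigr => i _; rewrite nmE rcX.
split=> [h|/cvg_ex [l /cvgC h]].
  apply: cauchyC => d d0; have [M hM] := l2_tail h d0; exists M.
  suff hh p q : (M <= p)%N -> (p <= q)%N ->
      nm (series (fun n => `|a n| ^+ 2) q - series (fun n => `|a n| ^+ 2) p) <= d.
    move=> p q hp hq; have [pq|qp] := leqP p q; first by rewrite nm_distC hh.
    by rewrite hh // ltnW.
  move=> Mp pq; rewrite !e -rcB nm_rc -!(big_mkord xpredT (fun i => nm (a i) ^+ 2)).
  rewrite (big_cat_nat (leq0n p) pq) /= [_ + _ - _]addrAC subrr add0r ger0_norm ?hM //.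
  by apply: sumr_ge0 => i _; exact: sqr_ge0.
exists (re l) => N; apply/ler_addgt0Pr => d /h [M hM].
have := hM _ (leq_maxl M N); rewrite e => h1; have := le_trans (re_le_nm _) h1.
rewrite reB re_rc lerBlDl; apply: le_trans.
rewrite -!(big_mkord xpredT (fun i => nm (a i) ^+ 2)).
rewrite [leRHS](big_cat_nat (leq0n N) (leq_maxr M N)) /= lerDl.
by apply: sumr_ge0 => i _; exact: sqr_ge0.
Qed.

Lemma H2coefP f a : H2coef_of f a <->
  l2 a /\ forall z, nm z < 1 -> series (fun n => a n * z ^+ n) @ \oo --> f z.
Proof.
split=> -[h1 h2]; split; try exact/l2P.
  by move=> z hz; apply: h2; rewrite nm_lt1.
by move=> z; rewrite nm_lt1; exact: h2.
Qed.

Lemma H2coef_of_unique f a b : H2coef_of f a -> H2coef_of f b -> a = b.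
Proof.
move=> /H2coefP[la ha] /H2coefP[lb hb].
have [K hK] := l2_bounded la; have [L hL] := l2_bounded lb.
apply: (@power_series_unique _ _ _ (Num.max K L)) => [n|n|z hz].
- by rewrite le_max hK.
- by rewrite le_max hL orbT.
by exists (f z); split; [exact: ha|exact: hb].
Qed.

Lemma H2coefE f a : H2coef_of f a -> H2coef f = a.
Proof.
move=> h; apply: (@H2coef_of_unique f) => //.
by apply: ClassicalEpsilon.epsilon_spec; exists a.
Qed.

Lemma H2coef_ofE f : inH2 f -> H2coef_of f (H2coef f).
Proof. by move=> [a h]; rewrite (H2coefE h). Qed.

Lemma H2coef_of_ext f g a : (forall z, nm z < 1 -> f z = g z) -> H2coef_of f a -> H2coef_of g a.
Proof.
move=> e /H2coefP[h1 h2]; apply/H2coefP; split=> [|z hz]; first exact: h1.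
by rewrite -(e z hz); exact: h2.
Qed.

Lemma H2innerE f g a b : H2coef_of f a -> H2coef_of g b ->
  H2inner f g = l2pair a (fun n => (b n)^*).
Proof. by move=> /H2coefE ha /H2coefE hb; rewrite /H2inner ha hb. Qed.

Lemma l2pair_conj_self a : l2 a -> exists s : R, [/\ l2pair a (fun n => (a n)^*) = rc s, l2le a s &
  forall S, l2le a S -> s <= S].
Proof.
move=> ha; have h := l2pair_cvg ha (l2_conj ha); set l := l2pair _ _ in h *.
have e n : series (fun n => a n * (a n)^*) n = rc (\sum_(i < n) nm (a i) ^+ 2).
  by rewrite rc_sum /series /= big_mkord; apply: eq_bigr => i _; rewrite nm_sqE.
have hr : (fun n => \sum_(i < n) nm (a i) ^+ 2) @ \oo --> re l.
  apply/cvgR => d d0; have [M hM] := (cvgC _ _).1 h d d0; exists M => n /hM.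
  by rewrite e; apply: le_trans; rewrite -{1}[\sum_(_ < _) _]re_rc -reB abs_re_le.
have hrc : series (fun n => a n * (a n)^*) @ \oo --> rc (re l).
  apply/cvgC => d d0; have [M hM] := (cvgR _ _).1 hr d d0; exists M => n /hM.
  by rewrite e -rcB nm_rc.
exists (re l); split.
- exact: cvg_uniqueC h hrc.
- move=> N; apply/ler_addgt0Pr => d d0; have [M hM] := (cvgR _ _).1 hr d d0.
  have := hM _ (leq_maxl M N); move=> /(le_trans (ler_norm _)); rewrite lerBlDl; apply: le_trans.
  rewrite -!(big_mkord xpredT (fun i => nm (a i) ^+ 2)).
  rewrite [leRHS](big_cat_nat (leq0n N) (leq_maxr M N)) /= lerDl.
  by apply: sumr_ge0 => i _; exact: sqr_ge0.
- by move=> S hS; apply: cvgR_le hr _; exists 0%N => n _; exact: hS.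
Qed.

(** [M] bounds squared norms, so the operator norm is at most its square root. *)
Lemma bounded_opI (T : (C -> C) -> C -> C) (M : R) : 0 <= M ->
  (forall f a, H2coef_of f a -> exists c, H2coef_of (T f) c /\
     forall S, l2le a S -> l2le c (M * S)) -> bounded_op T.
Proof.
move=> M0 h; exists (sqrtC (rc M)); split; first by rewrite sqrtC_ge0 -rc0 rc_le.
move=> f [a ha]; have [c [hc hM]] := h f a ha; split; first by exists c.
have [la _] := (H2coefP _ _).1 ha; have [lc _] := (H2coefP _ _).1 hc.
have [s [es ls _]] := l2pair_conj_self la; have [t [et lt ht]] := l2pair_conj_self lc.
rewrite /H2norm (H2innerE ha ha) (H2innerE hc hc) es et.
have s0 := l2le_ge0 ls; have t0 := l2le_ge0 lt.
rewrite -sqrtCM ?nnegrE -?rc0 ?rc_le // ler_sqrtC ?nnegrE -?rcM -?rc0 ?rc_le ?mulr_ge0 //.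
by apply: ht; exact: hM.
Qed.

(** Evaluation at z is the pairing with the powers of z. The convergence of pairings therefore
    identifies the function [T f], known pointwise, with the series of the sequence produced by
    [l2_op_extend]. *)
Lemma C11_family_op (tau tau' : nat -> C -> C) (M : R) (T : (C -> C) -> C -> C) : 0 <= M ->
  (forall n, C11 (tau n) (tau' n)) ->
  (forall N a e, 0 < e -> exists m0, forall m, (m0 <= m)%N ->
     avgR m (fun z => nm (\sum_(n < N) a n * tau n z) ^+ 2) <=
       M * (\sum_(n < N) nm (a n) ^+ 2) + e) ->
  (forall f a, H2coef_of f a -> forall z, nm z < 1 ->
     (fun N => \sum_(n < N) a n * tau n z) @ \oo --> T f z) ->
  exists t : nat -> nat -> C, (forall n, H2coef_of (tau n) (t n)) /\
    forall f a, H2coef_of f a -> exists c, [/\ H2coef_of (T f) c,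
      forall S, l2le a S -> l2le c (M * S) &
      forall b, l2 b -> (fun N => \sum_(n < N) a n * l2pair (t n) b) @ \oo --> l2pair c b].
Proof.
move=> M0 htau hM hT; have [t [ht lt hb]] := finite_op_bound M0 htau hM.
exists t; split=> [n|f a ha].
  by apply/H2coefP; split; [exact: lt|exact: ht].
have [la _] := (H2coefP _ _).1 ha.
have [c [hc1 hc2]] := l2_op_extend M0 lt hb la.
exists c; split; [|exact: hc1|exact: hc2]; apply/H2coefP; split.
  by case: la => S hS; exists (M * S); exact: hc1.
move=> z hz; have lc : l2 c by case: la => S hS; exists (M * S); exact: hc1.
have -> : T f z = l2pair c (fun n => z ^+ n).
  apply: cvg_uniqueC (hT f a ha z hz) _.
  have e n : l2pair (t n) (fun k => z ^+ k) = tau n z by exact: (l2pair_eq (ht n z hz)).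
  by have := hc2 _ (l2_geo hz); under eq_fun do under eq_bigr do rewrite e.
exact: l2pair_cvg lc (l2_geo hz).
Qed.

Lemma mulop_bounded h h' g : C11 h h' -> (forall z, nm z < 1 -> g z = h z) -> bounded_op (mulop g).
Proof.
move=> hh e; have [K K0 hK] := C11_lip hh.
have M0 : 0 <= K ^+ 2 by exact: sqr_ge0.
have htau n : C11 (fun z => h z * z ^+ n) (fun z => h' z * z ^+ n + h z * (z ^+ n.-1 *+ n)).
  exact: C11M hh (C11X _ n).
have /(_ (mulop g)) [] := C11_family_op M0 htau.
(* For m >= N there are more than N roots of unity, so Parseval is exact for a polynomial with N
   coefficients. *)
- move=> N a d d0; exists N => m Nm.
  rewrite -(@parseval_poly _ m); last first.
    by apply: (leq_trans Nm); rewrite ltnW // (ltn_trans (ltnSn m)) // ltn_expl.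
  apply: le_trans (_ : K ^+ 2 * avgR m (fun z => nm (\sum_(n < N) a n * z ^+ n) ^+ 2) <= _); last first.
    by rewrite lerDl ltW.
  rewrite -avgRZ; apply: ler_avgR => z hz; have hz1 : nm z <= 1 by rewrite hz.
  have [hKz _ _ _] := hK z z hz1 hz1.
  rewrite (eq_bigr (fun n : 'I_N => h z * (a n * z ^+ n))) => [|n _]; last by rewrite mulrCA.
  by rewrite -mulr_sumr nmM exprMn ler_wpM2r ?sqr_ge0 // ler_sqr ?nnegrE ?nm_ge0.
- move=> f a /H2coefP[_ ha] z hz; rewrite /mulop e //.
  rewrite (_ : (fun N => _) = fun N => h z * series (fun n => a n * z ^+ n) N).
    by apply: cvgMr; exact: ha.
  apply/funext => N; rewrite /series /= big_mkord mulr_sumr.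
  by apply: eq_bigr => n _; rewrite mulrCA.
move=> t [_ ht]; apply: (bounded_opI M0) => f a /ht [c [h1 h2 _]].
by exists c; split; [exact: h1|exact: h2].
Qed.

Lemma H2coef_bound f f' a : C11 f f' -> (forall z, nm z <= 1 -> nm (f z) <= 1) ->
  H2coef_of f a -> l2le a 1.
Proof.
move=> hf f1 ha; have [b [h1 [K hK] h3]] := taylor hf.
have lb : l2le b 1.
  apply: h3 => e e0; exists 0%N => m _; apply: (@le_trans _ _ 1); last by rewrite lerDl ltW.
  rewrite -(avgR_cst m 1); apply: ler_avgR => z hz; rewrite exprn_ile1 ?nm_ge0 //.
  by apply: f1; rewrite hz.
rewrite (@H2coef_of_unique f a b) //; apply/H2coefP; split; first by exists 1.
exact: h1.
Qed.

(** The rows [t n], the coefficients of s^n, have norm at most 1 since |s^n| <= 1. This bound and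
    the convergence of the pairings are what the adjoint identity needs. *)
Lemma compo_op s s' g : C11 s s' -> (forall z, nm z <= 1 -> nm (s z) <= 1) ->
  (forall z, nm z < 1 -> nm (s z) < 1) -> (forall z, nm z < 1 -> g z = s z) ->
  bounded_op (compo g) /\
  exists t : nat -> nat -> C, (forall n, l2le (t n) 1) /\
    forall f a, H2coef_of f a -> exists c, H2coef_of (compo g f) c /\
      forall b, l2 b -> (fun N => \sum_(n < N) a n * l2pair (t n) b) @ \oo --> l2pair c b.
Proof.
move=> hs s1 s2 e; have s0 : nm (s 0) < 1 by apply: s2; rewrite nm0.
set M := (1 + nm (s 0)) / (1 - nm (s 0)).
have M0 : 0 <= M by rewrite divr_ge0 //; have := nm_ge0 (s 0); lra.
have htau n : C11 (fun z => s z ^+ n) (fun z => ('X^n)^`().[s z] * s' z).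
  by apply: C11_ext (C11_poly 'X^n hs) => x _; rewrite hornerXn.
have /(_ (compo g)) [] := C11_family_op M0 htau.
- by move=> N a d d0; exact: (@littlewood R s s' a N d hs s1 s0 d0).
- move=> f a /H2coefP[_ ha] z hz; rewrite /compo e //.
  rewrite (_ : (fun N => _) = series (fun n => a n * s z ^+ n)); first exact: ha (s2 z hz).
  by apply/funext => N; rewrite /series /= big_mkord.
move=> t [ht1 ht]; split.
  by apply: (bounded_opI M0) => f a /ht [c [h1 h2 _]]; exists c; split; [exact: h1|exact: h2].
exists t; split=> [n|f a /ht [c [h1 _ h3]]]; last by exists c.
apply: H2coef_bound (htau n) _ (ht1 n) => z hz; rewrite nmX exprn_ile1 ?nm_ge0 //.
exact: s1.
Qed.

Lemma H2coef0 f a : H2coef_of f a -> f 0 = a 0%N.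
Proof.
move=> /H2coefP[_ h]; have := h 0; rewrite nm0 => /(_ ltr01) h0.
apply: cvg_uniqueC h0 _; apply/cvgC => d d0; exists 1%N => -[//|n] _.
rewrite /series /= big_nat_recl // expr0 mulr1 big1 ?addr0 ?subrr ?nm0 ?ltW // => i _.
by rewrite expr0n mulr0.
Qed.

Lemma series_shift a (z l : C) : z != 0 -> series (fun n => a n * z ^+ n) @ \oo --> l ->
  series (fun n => a n.+1 * z ^+ n) @ \oo --> (l - a 0%N) / z.
Proof.
move=> z0 /cvgC h; apply/cvgC => d d0.
have [M hM] := h (d * nm z) ltac:(by rewrite mulr_gt0 ?nm_gt0).
exists M => n Mn; have := hM n.+1 (leqW Mn).
rewrite -ler_pdivrMr ?nm_gt0 // -nm_div; congr (nm _ <= _).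
rewrite /series /= big_nat_recl // expr0 mulr1.
rewrite (eq_bigr (fun i => z * (a i.+1 * z ^+ i))) => [|i _]; last by rewrite exprS mulrCA.
by rewrite -mulr_sumr; field.
Qed.

Lemma H2_bshift f a : H2coef_of f a -> H2coef_of (@bshift R f) (fun n => a n.+1).
Proof.
move=> hf; have f0 := H2coef0 hf; have [la ha] := (H2coefP _ _).1 hf.
have sh (z : C) : z != 0 -> nm z < 1 -> series (fun n => a n.+1 * z ^+ n) @ \oo --> (f z - f 0) / z.
  by move=> z0 hz; rewrite f0; apply: series_shift => //; exact: ha.
have [K hK] := l2_bounded la.
have K0 : 0 <= K := le_trans (nm_ge0 _) (hK 0%N).
apply/H2coefP; split=> [|z hz]; first exact: l2_shift.
rewrite /bshift; case: eqP => [->|/eqP z0]; last exact: sh.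
(* [f] is known here only through its series: the difference quotient at h minus [a 1] is a tail of
   the shifted series, at most K |h| / (1 - |h|). *)
suff -> : 'D_1 f 0 = a 1%N.
  apply/cvgC => d d0; exists 1%N => -[//|n] _.
  rewrite /series /= big_nat_recl // expr0 mulr1 big1 ?addr0 ?subrr ?nm0 ?ltW // => i _.
  by rewrite expr0n mulr0.
apply: (cvg_lim (@hausC R)); apply/cvgrPdist_le => eps eps0.
have eE : eps = rc (re eps) := gt0_rc eps0.
move: eps0; rewrite eE -rc0 rc_lt => e0.
have K10 : 0 < 2 * K + 1 by lra.
near=> h.
have h0 : h != 0 by near: h; exact: nbhs_dnbhs_neq.
have h1 : nm h < 1 / 2.
  by rewrite -rc_lt -nmE; near: h; apply: dnbhs0_lt; rewrite -rc0 rc_lt divr_gt0.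
have h2 : nm h < re eps / (2 * K + 1).
  by rewrite -rc_lt -nmE; near: h; apply: dnbhs0_lt; rewrite -rc0 rc_lt divr_gt0.
have h11 : nm h < 1 by lra.
rewrite /= /shift /= [h *: 1]mulr1 addr0 nmE rc_le nm_distC.
have scE (x y : C) : x *: y = x * y by [].
rewrite scE mulrC.
have hc : (fun N => series (fun n => a n.+1 * h ^+ n) N - a 1%N) @ \oo --> (f h - f 0) / h - a 1%N.
  by apply: cvgB; [exact: sh|exact: cvg_cst].
apply: (@le_trans _ _ (K * nm h / (1 - nm h))).
  apply: cvgC_le hc _; exists 1%N => -[//|N] _.
  rewrite /series /= big_ltn // expr0 mulr1 [_ + _ - _]addrAC subrr add0r.
  by rewrite -[X in _ * X / _]expr1; exact: nm_sum_geo (fun n => hK n.+1).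
rewrite ler_pdivrMr; last by lra.
move: h2; rewrite ltr_pdivlMr // => h2; have := nm_ge0 h; nra.
Unshelve. all: by end_near. Qed.

Lemma bshift_bounded : bounded_op (@bshift R).
Proof.
apply: (@bounded_opI _ 1) => // f a ha; exists (fun n => a n.+1); split; first exact: H2_bshift.
move=> S hS N; rewrite mul1r; apply: le_trans (hS N.+1).
by rewrite big_ord_recl /= lerDr sqr_ge0.
Qed.

Lemma cvg_geo (z : C) : nm z < 1 -> series (fun n => z ^+ n) @ \oo --> (1 - z)^-1.
Proof.
move=> hz; have z1 : 1 - z != 0.
  by rewrite subr_eq0; apply: contraTneq hz => <-; rewrite nm1 ltxx.
have e n : series (fun n => z ^+ n) n - (1 - z)^-1 = - (1 - z)^-1 * z ^+ n.
  have := subrX1 z n; rewrite /series /= big_mkord; set s := \sum_(_ < _) _ => h.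
  have -> : z ^+ n = (z - 1) * s + 1 by rewrite -h subrK.
  by field.
apply/cvgC => d d0; have [|M hM] := @geo_small R (nm z) (nm (- (1 - z)^-1)) d _ d0.
  by rewrite nm_ge0.
by exists M => n /hM; rewrite e nmM nmX.
Qed.

Lemma H2_Lambda (x : C) f : nm x < 1 -> H2coef_of (Lambda x f) (fun n => f 0 * x^* ^+ n).
Proof.
move=> hx; apply/H2coefP; split; first by apply: l2Z; apply: l2_geo; rewrite nm_conj.
move=> z hz; rewrite (_ : series _ = fun N => f 0 * series (fun n => (x^* * z) ^+ n) N).
  apply: cvgMr; apply: cvg_geo; rewrite nmM nm_conj.
  by apply: le_lt_trans hx; rewrite ler_piMr ?nm_ge0 // ltW.
apply/funext => N; rewrite /series /= mulr_sumr; apply: eq_bigr => n _.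
by rewrite exprMn mulrA.
Qed.

Lemma Lambda_bounded (x : C) : nm x < 1 -> bounded_op (Lambda x).
Proof.
move=> hx; have [S hS] : l2 (fun n => x^* ^+ n) by apply: l2_geo; rewrite nm_conj.
apply: (@bounded_opI _ S); first exact: l2le_ge0 hS.
move=> f a ha; exists (fun n => f 0 * x^* ^+ n); split; first exact: H2_Lambda.
move=> B hB N; rewrite (eq_bigr (fun n : 'I_N => nm (f 0) ^+ 2 * nm (x^* ^+ n) ^+ 2)) => [|n _].
  rewrite -mulr_sumr mulrC; apply: ler_pM; rewrite ?sqr_ge0 //.
  - by apply: sumr_ge0 => i _; exact: sqr_ge0.
  - exact: hS.
  by have := hB 1%N; rewrite big_ord_recr big_ord0 /= add0r (H2coef0 ha).
by rewrite nmM exprMn.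
Qed.

Lemma H2coef_ofD (f g : C -> C) a b : H2coef_of f a -> H2coef_of g b ->
  H2coef_of (fun z => f z + g z) (fun n => a n + b n).
Proof.
move=> /H2coefP[la ha] /H2coefP[lb hb]; apply/H2coefP; split=> [|z hz]; first exact: l2D.
have e : series (fun n => (a n + b n) * z ^+ n) =
    (fun N => series (fun n => a n * z ^+ n) N + series (fun n => b n * z ^+ n) N).
  by apply/funext => N; rewrite /series /= -big_split; apply: eq_bigr => n _; rewrite mulrDl.
by rewrite e; apply: cvgD; [exact: ha|exact: hb].
Qed.

Lemma H2coef_ofZ (x : C) (f : C -> C) a : H2coef_of f a ->
  H2coef_of (fun z => x * f z) (fun n => x * a n).
Proof.
move=> /H2coefP[la ha]; apply/H2coefP; split=> [|z hz]; first exact: l2Z.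
have e : series (fun n => x * a n * z ^+ n) = (fun N => x * series (fun n => a n * z ^+ n) N).
  by apply/funext => N; rewrite /series /= mulr_sumr; apply: eq_bigr => n _; rewrite mulrA.
by rewrite e; apply: cvgMr; exact: ha.
Qed.

Lemma H2coef_of_sum I (s : seq I) (F : I -> C -> C) (a : I -> nat -> C) :
  (forall i, H2coef_of (F i) (a i)) ->
  H2coef_of (fun z => \sum_(i <- s) F i z) (fun n => \sum_(i <- s) a i n).
Proof.
move=> h; elim: s => [|i s ih].
  apply/H2coefP; split=> [|z _].
    have -> : (fun n => \sum_(i <- [::]) a i n) = (fun=> 0) by apply/funext => n; rewrite big_nil.
    exact: l2_0.
  rewrite big_nil; have -> : series (fun n => (\sum_(i <- [::]) a i n) * z ^+ n) = (fun=> 0).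
    by apply/funext => N; rewrite /series /= big1 // => n _; rewrite big_nil mul0r.
  exact: cvg_cst.
have -> : (fun n => \sum_(j <- i :: s) a j n) = (fun n => a i n + \sum_(j <- s) a j n).
  by apply/funext => n; rewrite big_cons.
have -> : (fun z => \sum_(j <- i :: s) F j z) = (fun z => F i z + \sum_(j <- s) F j z).
  by apply/funext => n; rewrite big_cons.
exact: H2coef_ofD (h i) ih.
Qed.

Lemma inH2D f g : inH2 f -> inH2 g -> inH2 (fun z => f z + g z).
Proof. by move=> [a ha] [b hb]; exists (fun n => a n + b n); exact: H2coef_ofD. Qed.

Lemma inH2_sum L (F : 'I_L -> C -> C) : (forall i, inH2 (F i)) -> inH2 (fun z => \sum_(i < L) F i z).
Proof.
move=> /choice [a ha]; exists (fun n => \sum_(i < L) a i n).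
exact: (@H2coef_of_sum 'I_L (index_enum _) F a ha).
Qed.

End HardySpace.

(** * Root branches of a pencil of polynomials *)

Section PolynomialBounds.
Variable R : realType.
Local Notation C := (CC R).

Lemma poly_bounds (P : {poly C}) : exists2 L : R, 0 <= L &
  forall s t : C, nm s <= 1 -> nm t <= 1 ->
    [/\ nm P.[s] <= L, nm P^`().[s] <= L, nm (P.[s] - P.[t]) <= L * nm (s - t) &
        nm (P.[s] - P.[t] - P^`().[t] * (s - t)) <= L * nm (s - t) ^+ 2].
Proof.
have [L L0 hL] := C11_lip (C11_poly P (@C11_id R)); exists L => // s t hs ht.
by have := hL s t hs ht; rewrite !mulr1.
Qed.

(** Factorisation takes the place of compactness: every root r has |r| > 1, so each factor is at
    least |r| - 1 on the closed disc. *)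
Lemma poly_lower_bound (P : {poly C}) : (forall z : C, nm z <= 1 -> P.[z] != 0) ->
  exists2 c : R, 0 < c & forall z : C, nm z <= 1 -> c <= nm P.[z].
Proof.
move=> h; have [rs e] := closed_field_poly_normal P.
have lc0 : 0 < nm (lead_coef P).
  rewrite nm_gt0 lead_coef_eq0; apply: contraTneq (h 0 _) => [->|]; last by rewrite nm0.
  by rewrite horner0 eqxx.
have hr r : r \in rs -> 1 < nm r.
  move=> rr; rewrite ltNge; apply/negP => r1; have := h r r1.
  by rewrite e hornerZ mulf_eq0 negb_or -/(root _ _) root_prod_XsubC rr andbF.
suff [c c0 hc] : exists2 c : R, 0 < c & forall z : C, nm z <= 1 -> c <= nm (\prod_(r <- rs) ('X - r%:P)).[z].
  exists (nm (lead_coef P) * c); first exact: mulr_gt0.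
  by move=> z hz; rewrite e hornerZ nmM lead_coefZ (monicP (monic_prod_XsubC _ _ _)) mulr1 ler_pM2l // hc.
elim: rs hr {e} => [|r rs ih] hr.
  by exists 1 => // z _; rewrite big_nil hornerC nm1.
have [c c0 hc] : exists2 c : R, 0 < c & forall z : C, nm z <= 1 -> c <= nm (\prod_(r <- rs) ('X - r%:P)).[z].
  by apply: ih => x xr; apply: hr; rewrite in_cons xr orbT.
have r1 : 1 < nm r by apply: hr; rewrite mem_head.
exists ((nm r - 1) * c); first by rewrite mulr_gt0 // subr_gt0.
move=> z hz; rewrite big_cons hornerM nmM !hornerE; apply: ler_pM => //.
- by rewrite subr_ge0 ltW.
- exact: ltW.
- by have := nm_dist_trans 0 z r; rewrite !sub0r !nmN; lra.
- exact: hc.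
Qed.

Lemma bivariate_bound (v : {poly {poly C}}) : exists2 L : R, 0 <= L &
  forall z s : C, nm z <= 1 -> nm s <= 1 -> nm (v.[s%:P]).[z] <= L.
Proof.
elim/poly_ind: v => [|v c [L L0 hL]].
  by exists 0 => // z s _ _; rewrite !horner0 nm0.
have [K K0 hK] := poly_bounds c; exists (L * 1 + K); first by rewrite mulr1 addr_ge0.
move=> z s hz hs; rewrite hornerMXaddC hornerD hornerM hornerC.
apply: nmD_le; last by have [] := hK z z hz hz.
by apply: nmM_le => //; exact: hL.
Qed.

End PolynomialBounds.

(** * Continuation of the roots of the pencil A - z B *)

Section Branches.
Variable R : realType.
Local Notation C := (CC R).
Variables (d : nat) (A B : {poly C}) (c1 : R).
Let Q (z : C) : {poly C} := A - z *: B.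
Hypothesis d_gt0 : (0 < d)%N.
Hypothesis sA : (size A <= d.+1)%N.
Hypothesis sB : (size B <= d.+1)%N.
Hypothesis c1_gt0 : 0 < c1.
Hypothesis lead_lb : forall z, nm z <= 1 -> c1 <= nm (Q z)`_d.
Hypothesis roots : forall z, nm z <= 1 -> exists rs : seq C, [/\ uniq rs, size rs = d & all (root (Q z)) rs].
Hypothesis roots_disc : forall z s, nm z <= 1 -> root (Q z) s -> nm s <= 1.

Lemma size_pencil z : nm z <= 1 -> size (Q z) = d.+1.
Proof.
move=> hz; apply/eqP; rewrite eqn_leq; apply/andP; split.
  apply: (leq_trans (size_polyD _ _)); rewrite geq_max sA size_polyN.
  exact: leq_trans (size_scale_leq _ _) sB.
rewrite ltnNge; apply/negP => /leq_sizeP /(_ d (leqnn d)) e.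
by have := lead_lb hz; rewrite e nm0 leNgt c1_gt0.
Qed.

Lemma pencil_factor z : nm z <= 1 -> exists rs : seq C, [/\ uniq rs, size rs = d &
  Q z = (Q z)`_d *: \prod_(r <- rs) ('X - r%:P)].
Proof.
move=> hz; have [rs [urs srs ars]] := roots hz; exists rs; split=> //.
have sQ := size_pencil hz.
rewrite [LHS](all_roots_prod_XsubC _ ars) ?sQ ?srs ?uniq_rootsE //.
by rewrite lead_coefE sQ.
Qed.

Lemma pencil_deriv_coprime z : nm z <= 1 -> coprimep (Q z) (Q z)^`().
Proof.
move=> hz; have [rs [urs srs e]] := pencil_factor hz.
have l0 : (Q z)`_d != 0 by rewrite -nm_gt0 (lt_le_trans c1_gt0) ?lead_lb.
have sep : separable_poly (\prod_(r <- rs) ('X - r%:P)) by rewrite separable_prod_XsubC.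
rewrite unlock in sep; by rewrite e derivZ (coprimepZl _ _ l0) (coprimepZr _ _ l0).
Qed.

Lemma horner_pencil z s : (Q z).[s] = A.[s] - z * B.[s].
Proof. by rewrite hornerD hornerN hornerZ. Qed.

Lemma horner_pencil_deriv z s : (Q z)^`().[s] = A^`().[s] - z * B^`().[s].
Proof. by rewrite derivB derivZ hornerD hornerN hornerZ. Qed.

(** The resultant P(z) of Q_z and its derivative is a polynomial in z without zeros on the closed
    disc, hence bounded below. Being a combination u Q + v Q', it equals v Q' at a root of Q_z, and
    v is bounded. *)
Lemma pencil_deriv_lb : exists2 c : R, 0 < c &
  forall z s, nm z <= 1 -> root (Q z) s -> c <= nm (Q z)^`().[s].
Proof.
(* In degree 1 the derivative is a constant, too small for [resultant_in_ideal], but it is the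
   leading coefficient. *)
have [d1|d2] := leqP d 1.
  have dd : d = 1%N by apply/eqP; rewrite eqn_leq d1.
  exists c1 => // z s hz _.
  have -> : deriv (Q z) = ((Q z)`_d)%:P.
    apply/polyP => i; rewrite coef_deriv coefC dd; case: i => [|i]; first by rewrite mulr1n.
    by rewrite nth_default ?mul0rn // size_pencil // dd.
  by rewrite hornerC lead_lb.
(* The pencil as a polynomial in s with coefficients in the polynomials in z: ['X] is the parameter
   z, and [horner_eval z] specialises it. *)
pose QQ : {poly {poly C}} := map_poly polyC A - 'X *: map_poly polyC B.
have mapQ z : map_poly (horner_eval z) QQ = Q z.
  apply/polyP => i; rewrite coef_map coefB coefZ !coef_map /= /horner_eval.
  by rewrite hornerD hornerN hornerM hornerX !hornerC coefB coefZ.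
have sQQ : size QQ = d.+1.
  apply/eqP; rewrite eqn_leq; apply/andP; split.
    apply: (leq_trans (size_polyD _ _)); rewrite geq_max size_polyN.
    rewrite (leq_trans (size_poly _ _)) //=; apply: (leq_trans (size_scale_leq _ _)).
    exact: leq_trans (size_poly _ _) _.
  have n0 : nm (0 : C) <= 1 by rewrite nm0.
  by rewrite -(size_pencil n0) -(mapQ 0) size_poly.
have QQd z : nm z <= 1 -> horner_eval z QQ`_d != 0.
  move=> hz; rewrite -coef_map mapQ -nm_gt0; exact: lt_le_trans (lead_lb hz).
have QQ'd z : nm z <= 1 -> horner_eval z (deriv QQ)`_d.-1 != 0.
  move=> hz; rewrite coef_deriv prednK // rmorphMn /= mulrn_eq0 negb_or -lt0n d_gt0 /=.
  exact: QQd.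
have n0 : nm (0 : C) <= 1 by rewrite nm0.
have sQQ' : size (deriv QQ) = d.
  apply/eqP; rewrite eqn_leq; apply/andP; split.
    by rewrite -ltnS -sQQ; apply: leq_trans (lt_size_deriv _) _ => //; rewrite -size_poly_eq0 sQQ.
  rewrite -(prednK d_gt0) ltnNge; apply/negP => /leq_sizeP /(_ d.-1 (leqnn _)) e.
  by have := QQ'd 0 n0; rewrite e rmorph0 eqxx.
have [[u v] _ /= hres] := @resultant_in_ideal _ QQ (deriv QQ) ltac:(by rewrite sQQ ltnS) ltac:(by rewrite sQQ').
set P := resultant QQ (deriv QQ) in hres.
have P0 z : nm z <= 1 -> P.[z] != 0.
  (* The resultant commutes with the specialisation because neither leading coefficient vanishes at
     z. *)
  move=> hz; rewrite -[P.[z]]/(horner_eval z P) /P map_resultant /=; last first.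
  - by rewrite lead_coefE sQQ' QQ'd.
  - by rewrite lead_coefE sQQ QQd.
  rewrite -deriv_map mapQ resultant_eq0 -leqNgt.
  by have := pencil_deriv_coprime hz; rewrite /coprimep => /eqP ->.
have [c c0 hc] := poly_lower_bound P0; have [L L0 hL] := bivariate_bound v.
have L10 : 0 < L + 1 by lra.
exists (c / (L + 1)); first exact: divr_gt0.
move=> z s hz hs; have s1 := roots_disc hz hs.
have ev (F : {poly {poly C}}) : F.[s%:P].[z] = (map_poly (horner_eval z) F).[s].
  by rewrite -[LHS]/(horner_eval z F.[s%:P]) -horner_map /= /horner_eval hornerC.
have e : P.[z] = v.[s%:P].[z] * (Q z)^`().[s].
  have := congr1 (fun F : {poly {poly C}} => F.[s%:P].[z]) hres; rewrite /= hornerC => ->.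
  rewrite hornerD !hornerM hornerD !hornerM !ev -deriv_map mapQ.
  by rewrite (rootP hs) mulr0 add0r.
rewrite ler_pdivrMr // mulrC; apply: (le_trans (hc z hz)).
rewrite e nmM; apply: ler_wpM2r; first exact: nm_ge0.
by apply: (le_trans (hL z s hz s1)); lra.
Qed.


Lemma pencil_second_order : exists2 K : R, 0 < K & forall z s t, nm z <= 1 -> nm s <= 1 -> nm t <= 1 ->
  [/\ nm B.[s] <= K, nm (B.[s] - B.[t]) <= K * nm (s - t) &
      nm ((Q z).[s] - (Q z).[t] - (deriv (Q z)).[t] * (s - t)) <= K * nm (s - t) ^+ 2].
Proof.
have [K K0 hK] := poly_bounds A; have [L L0 hL] := poly_bounds B.
exists (K + L + 1); first by lra.
move=> z s t hz hs ht; have [_ _ _ h1] := hK s t hs ht; have [h2 _ h3 h4] := hL s t hs ht.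
split.
- by apply: (le_trans h2); lra.
- by apply: (le_trans h3); rewrite ler_wpM2r ?nm_ge0 //; lra.
rewrite !horner_pencil horner_pencil_deriv.
have -> : A.[s] - z * B.[s] - (A.[t] - z * B.[t]) - (A^`().[t] - z * B^`().[t]) * (s - t) =
  (A.[s] - A.[t] - A^`().[t] * (s - t)) - z * (B.[s] - B.[t] - B^`().[t] * (s - t)) by ring.
apply: (le_trans (nmB_le h1 (nmM_le hz h4))).
by rewrite mul1r -mulrDl ler_wpM2r ?sqr_ge0 //; lra.
Qed.

(** At two distinct roots the Taylor formula reads |Q'(t)| |s - t| <= K |s - t|^2, whence c <= K |s
    - t|. *)
Lemma root_separation (c K : R) z s t : 
  (forall z s, nm z <= 1 -> root (Q z) s -> c <= nm (deriv (Q z)).[s]) ->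
  (forall z s t, nm z <= 1 -> nm s <= 1 -> nm t <= 1 ->
    nm ((Q z).[s] - (Q z).[t] - (deriv (Q z)).[t] * (s - t)) <= K * nm (s - t) ^+ 2) ->
  nm z <= 1 -> root (Q z) s -> root (Q z) t -> K * nm (s - t) < c -> s = t.
Proof.
move=> hc hK hz hs ht hst; apply/eqP; rewrite -subr_eq0 -nm_eq0; apply/negP => /negP st.
have st0 : 0 < nm (s - t) by rewrite lt_def st nm_ge0.
have := hK z s t hz (roots_disc hz hs) (roots_disc hz ht).
rewrite (rootP hs) (rootP ht) subrr sub0r nmN nmM expr2 mulrA ler_pM2r //.
by move=> h; have := le_lt_trans (le_trans (hc z t hz ht) h) hst; rewrite ltxx.
Qed.

(** At a root s of Q_z the value Q_z'(s) = (z - z') B(s) is small. It is also the leading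
    coefficient times the product of the d distances from s to the roots of Q_z', which cannot all
    exceed e. *)
Lemma near_root (e : R) : 0 < e -> exists2 eta : R, 0 < eta & forall z z' s,
  nm z <= 1 -> nm z' <= 1 -> nm (z - z') <= eta -> root (Q z) s ->
  exists t, root (Q z') t /\ nm (t - s) <= e.
Proof.
move=> e0; have [K K0 hK] := pencil_second_order.
exists (c1 * e ^+ d / K); first by rewrite divr_gt0 // mulr_gt0 // exprn_gt0.
move=> z z' s hz hz' zz hs; have s1 := roots_disc hz hs.
have [rs [_ srs eQ]] := pencil_factor hz'.
have hQ : nm (Q z').[s] <= c1 * e ^+ d.
  have -> : (Q z').[s] = (z - z') * B.[s].
    by have := rootP hs; rewrite !horner_pencil => h; rewrite -[LHS]subr0 -h; ring.
  have [hB _ _] := hK z s s hz s1 s1.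
  by apply: (le_trans (nmM_le zz hB)); rewrite divfK // lt0r_neq0.
rewrite eQ hornerZ nmM in hQ.
have hP : nm (\prod_(r <- rs) ('X - r%:P)).[s] <= e ^+ d.
  rewrite -(ler_pM2l c1_gt0); apply: le_trans hQ; rewrite ler_wpM2r ?nm_ge0 //.
  exact: lead_lb.
have [/hasP[t trs hte]|/hasPn far] := boolP (has (fun t => nm (t - s) <= e) rs).
  exists t; split=> //; rewrite eQ rootZ ?root_prod_XsubC //.
  by rewrite -nm_gt0 (lt_le_trans c1_gt0) ?lead_lb.
move: hP; rewrite leNgt => /negP[]; rewrite -srs.
have rs0 : (0 < size rs)%N by rewrite srs.
have lb : forall l : seq C, (forall t, t \in l -> e < nm (t - s)) ->
    e ^+ size l <= nm (\prod_(r <- l) ('X - r%:P)).[s].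
  elim=> [|r l ih] hl; first by rewrite big_nil hornerC nm1.
  rewrite big_cons hornerM nmM !hornerE exprS; apply: ler_pM.
  - exact: ltW.
  - by rewrite exprn_ge0 // ltW.
  - by rewrite nm_distC; apply: ltW; apply: hl; rewrite mem_head.
  - by apply: ih => t tl; apply: hl; rewrite in_cons tl orbT.
have far' t : t \in rs -> e < nm (t - s) by move=> /far; rewrite -ltNge.
case: rs rs0 far' {srs eQ far hQ} => // r l _ far'.
rewrite big_cons hornerM nmM !hornerE /= exprS.
apply: (@lt_le_trans _ _ (nm (s - r) * e ^+ size l)).
  by rewrite ltr_pM2r ?exprn_gt0 // nm_distC far' // mem_head.
rewrite ler_wpM2l ?nm_ge0 //; apply: lb => t tl; apply: far'; by rewrite in_cons tl orbT.
Qed.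

Section Continuation.
Variables (e : R) (M : nat).

(** The default [s] is returned only if no root lies within [e], which [heta] excludes along the
    continuation. *)
Definition next_root (z s : C) : C := xget s [set t | root (Q z) t /\ nm (t - s) <= e].

(* continues the root [r] of [Q 0] along the segment from [0] to [z] *)
Fixpoint continued_root (r : C) (m : nat) (z : C) : C :=
  if m is k.+1 then next_root (rc (k.+1%:R / M%:R) * z) (continued_root r k z) else r.

Variables (c K eta : R).
Hypothesis hc : forall z s, nm z <= 1 -> root (Q z) s -> c <= nm (deriv (Q z)).[s].
Hypothesis hK : forall z s t, nm z <= 1 -> nm s <= 1 -> nm t <= 1 ->
    nm ((Q z).[s] - (Q z).[t] - (deriv (Q z)).[t] * (s - t)) <= K * nm (s - t) ^+ 2.
Hypothesis K_gt0 : 0 < K.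
Hypothesis heta : forall z z' s,
  nm z <= 1 -> nm z' <= 1 -> nm (z - z') <= eta -> root (Q z) s ->
  exists t, root (Q z') t /\ nm (t - s) <= e.
Hypothesis small : K * (4 * e) < c.
Hypothesis M_gt0 : (0 < M)%N.
Hypothesis fine : M%:R^-1 <= eta.

Let p (m : nat) (z : C) : C := rc (m%:R / M%:R) * z.

Lemma nm_continuation_point m z z' : (m <= M)%N -> nm (p m z - p m z') <= nm (z - z').
Proof.
move=> mM; rewrite /p -mulrBr nmM nm_rc ger0_norm ?divr_ge0 //.
by rewrite ler_piMl ?nm_ge0 // ler_pdivrMr ?ltr0n // mul1r ler_nat.
Qed.

Lemma nm_continuation_point1 m z : (m <= M)%N -> nm z <= 1 -> nm (p m z) <= 1.
Proof.
move=> mM; apply: le_trans.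
by have := nm_continuation_point z 0 mM; rewrite /p mulr0 !subr0.
Qed.

Lemma next_rootP z z' s : nm z <= 1 -> nm z' <= 1 -> nm (z - z') <= eta -> root (Q z) s ->
  root (Q z') (next_root z' s) /\ nm (next_root z' s - s) <= e.
Proof.
move=> hz hz' zz hs; have [t ht] := heta hz hz' zz hs.
by rewrite /next_root; case: xgetP => [u _ //|/(_ t)].
Qed.

Lemma continued_rootP r m z : root (Q 0) r -> (m <= M)%N -> nm z <= 1 ->
  root (Q (p m z)) (continued_root r m z) /\
  ((0 < m)%N -> nm (continued_root r m z - continued_root r m.-1 z) <= e).
Proof.
move=> hr; elim: m => [|m ih] mM hz; first by rewrite /p mul0r rc0 mul0r.
have [h1 _] := ih (ltnW mM) hz.
have st : nm (p m z - p m.+1 z) <= eta.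
  rewrite /p -mulrBl -rcB -mulrBl nmM nm_rc -natr1 opprD addNKr mulN1r normrN.
  rewrite ger0_norm ?invr_ge0 //; apply: le_trans fine.
  by rewrite ler_piMr // invr_ge0.
have [] := next_rootP (nm_continuation_point1 (ltnW mM) hz) (nm_continuation_point1 mM hz) st h1.
by move=> h2 h3; split.
Qed.

(** The root for z' that is close to the continuation for z differs from the continuation for z' by
    at most four moves of length [e]; by separation they coincide. This is the origin of [4 * e] in
    [small]. *)
Lemma continued_root_near r m z z' : root (Q 0) r -> (m <= M)%N -> nm z <= 1 -> nm z' <= 1 ->
  nm (z - z') <= eta -> nm (continued_root r m z - continued_root r m z') <= e.
Proof.
move=> hr mM hz hz' zz; have e0 : 0 <= e.
  have n0 : nm (0 : C) <= 1 by rewrite nm0.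
  have n00 : nm (0 - 0 : C) <= eta by rewrite subrr nm0 (le_trans _ fine) // invr_ge0.
  by have [t [_]] := heta n0 n0 n00 hr; apply: le_trans; exact: nm_ge0.
elim: m mM => [|m ih] mM; first by rewrite subrr nm0.
have h := ih (ltnW mM).
have [h1 /(_ isT) h2] := continued_rootP hr mM hz.
have [h1' /(_ isT) h2'] := continued_rootP hr mM hz'.
have [t [rt ht]] := heta (nm_continuation_point1 mM hz) (nm_continuation_point1 mM hz')
  (le_trans (nm_continuation_point z z' mM) zz) h1.
suff <- : t = continued_root r m.+1 z' by rewrite nm_distC.
apply: (root_separation hc hK (nm_continuation_point1 mM hz') rt h1').
apply: le_lt_trans small; rewrite ler_pM2l //.
move: h2 h2' ht h; move: (continued_root r m.+1 z) (continued_root r m.+1 z') => a a'.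
rewrite /=; move: (continued_root r m z) (continued_root r m z') => b b'.
move=> h2 h2' ht h.
have -> : t - a' = (t - a) + (a - b) + (b - b') - (a' - b') by ring.
apply: (le_trans (nmB_le (nmD_le (nmD_le ht h2) h) h2')); lra.
Qed.

(** Continuations that meet at some step were within [2 * e] one step earlier, so by separation they
    had already met. *)
Lemma continued_root_inj r r' m z : root (Q 0) r -> root (Q 0) r' -> (m <= M)%N -> nm z <= 1 ->
  0 <= e -> continued_root r m z = continued_root r' m z -> r = r'.
Proof.
move=> hr hr' mM hz e0; elim: m mM => [//|m ih] mM eq.
apply: ih; first exact: ltnW.
have [h1 /(_ isT) h2] := continued_rootP hr mM hz.
have [h1' /(_ isT) h2'] := continued_rootP hr' mM hz.
have [h3 _] := continued_rootP hr (ltnW mM) hz.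
have [h3' _] := continued_rootP hr' (ltnW mM) hz.
apply: (root_separation hc hK (nm_continuation_point1 (ltnW mM) hz) h3 h3').
apply: le_lt_trans small; rewrite ler_pM2l //.
move: eq h2 h2'; move: (continued_root r m.+1 z) (continued_root r' m.+1 z) => a a' <-.
rewrite /=; move: (continued_root r m z) (continued_root r' m z) => b b' h2 h2'.
have -> : b - b' = (a - b') - (a - b) by ring.
by apply: (le_trans (nmB_le h2' h2)); lra.
Qed.

End Continuation.

(** Differentiating A(s) - z B(s) = 0 in z gives s' = B(s) / Q_z'(s). The remainder is estimated by
    expanding Q_y at s(y) and using Q_y(s(x)) = (x - y) B(s(x)). *)
Lemma branch_C11 (s : C -> C) (c K e eta : R) : 0 < c -> 0 < K -> 0 < eta ->
  (forall z s, nm z <= 1 -> root (Q z) s -> c <= nm (deriv (Q z)).[s]) ->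
  (forall z s t, nm z <= 1 -> nm s <= 1 -> nm t <= 1 ->
    [/\ nm B.[s] <= K, nm (B.[s] - B.[t]) <= K * nm (s - t) &
      nm ((Q z).[s] - (Q z).[t] - (deriv (Q z)).[t] * (s - t)) <= K * nm (s - t) ^+ 2]) ->
  K * (4 * e) < c ->
  (forall z, nm z <= 1 -> root (Q z) (s z)) ->
  (forall z z', nm z <= 1 -> nm z' <= 1 -> nm (z - z') <= eta -> nm (s z - s z') <= e) ->
  C11 s (fun z => B.[s z] / (deriv (Q z)).[s z]).
Proof.
move=> c0 K0 eta0 hc hK small hs near.
have s1 z : nm z <= 1 -> nm (s z) <= 1 by move=> hz; exact: roots_disc (hs z hz).
pose L := 2 * K / c; have L0 : 0 <= L by rewrite divr_ge0 ?mulr_ge0 // ltW.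
pose K1 := (K * L ^+ 2 + K * L) / c; have K10 : 0 <= K1.
  by rewrite divr_ge0 ?(ltW c0) // addr_ge0 // mulr_ge0 ?sqr_ge0 // ltW.
pose K2 := (1 + 1 + K / c * 2) / eta ^+ 2.
have Kc : 0 <= K / c by rewrite divr_ge0 // ltW.
have K20 : 0 <= K2 by rewrite divr_ge0 ?sqr_ge0 //; lra.
exists (1 + K / c + K1 + K2) => x y hx hy.
have hd z : nm z <= 1 -> nm (B.[s z] / (deriv (Q z)).[s z]) <= K / c.
  move=> hz; have [hB _ _] := hK z _ _ hz (s1 z hz) (s1 z hz).
  have h := hc z _ hz (hs z hz); rewrite nm_div.
  apply: ler_pM; rewrite ?nm_ge0 ?invr_ge0 ?nm_ge0 //.
  by rewrite lef_pV2 ?posrE // (lt_le_trans c0).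
split; [by have := s1 x hx; lra|by have := hd x hx; lra|].
have sq0 := sqr_ge0 (nm (x - y)).
(* For points farther apart than [eta] boundedness suffices: dividing by [eta ^+ 2] gives the
   constant [K2]. *)
have [xy|yx] := leP (nm (x - y)) eta; last first.
  have b : nm (s x - s y - B.[s y] / (deriv (Q y)).[s y] * (x - y)) <= 1 + 1 + K / c * 2.
    apply: nmB_le; first by apply: nmB_le; exact: s1.
    apply: nmM_le; first exact: hd.
    by apply: (le_trans (nmB _ _)); lra.
  apply: (le_trans b); apply: (@le_trans _ _ (K2 * nm (x - y) ^+ 2)).
    rewrite /K2 [leRHS]mulrAC ler_pdivlMr ?exprn_gt0 //; apply: ler_wpM2l; first by lra.
    by rewrite ler_sqr ?nnegrE ?nm_ge0 ?ltW.
  by apply: ler_wpM2r => //; lra.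
have hst := near x y hx hy xy; have rx := hs x hx; have ry := hs y hy.
have [hB hBl hQ] := hK y _ _ hy (s1 x hx) (s1 y hy).
have hQy := hc y _ hy ry.
move: hB hBl hQ hQy hst; set S := s x; set T := s y; set D := (deriv (Q y)).[T].
move=> hB hBl hQ hQy hst.
have QyS : (Q y).[S] = (x - y) * B.[S].
  by have := rootP rx; rewrite !horner_pencil => h; rewrite -[LHS]subr0 -h /S; ring.
rewrite QyS (rootP ry) subr0 in hQ.
have D0 : D != 0 by rewrite -nm_gt0 (lt_le_trans c0).
(* Since 4 K |S - T| <= c, the quadratic term is at most a quarter of the left side and is absorbed
   there. *)
have lip : nm (S - T) <= L * nm (x - y).
  have h1 : nm (D * (S - T)) <= nm (x - y) * K + K * nm (S - T) ^+ 2.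
    rewrite -[D * _](subrK ((x - y) * B.[S])) addrC.
    by apply: nmD_le; [exact: nmM_le|rewrite nm_distC].
  have h2 : c * nm (S - T) <= nm (D * (S - T)) by rewrite nmM ler_wpM2r ?nm_ge0.
  rewrite /L mulrAC ler_pdivlMr //.
  have st0 := nm_ge0 (S - T); move: (le_trans h2 h1); rewrite expr2.
  have : K * (nm (S - T) * nm (S - T)) * 4 <= c * nm (S - T).
    rewrite [leLHS](_ : _ = (K * (4 * nm (S - T))) * nm (S - T)); last by ring.
    rewrite ler_wpM2r //; apply: le_trans (ltW small); rewrite ler_pM2l //; lra.
  by have := nm_ge0 (x - y); nra.
have -> : S - T - B.[T] / D * (x - y) =
   - ((x - y) * B.[S] - D * (S - T) - (x - y) * (B.[S] - B.[T])) / D by field.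
rewrite nm_div nmN ler_pdivrMr; last by rewrite (lt_le_trans c0).
have xy0 := nm_ge0 (x - y); have st0 := nm_ge0 (S - T).
apply: (@le_trans _ _ ((K * L ^+ 2 + K * L) * nm (x - y) ^+ 2)).
  apply: (le_trans (nmB_le hQ (nmM_le (lexx _) hBl))).
  rewrite mulrDl; apply: lerD.
    by rewrite -mulrA -exprMn ler_pM2l // ler_sqr ?nnegrE // mulr_ge0.
  rewrite [leRHS](_ : _ = nm (x - y) * (K * (L * nm (x - y)))); last by ring.
  by rewrite ler_wpM2l // ler_pM2l.
have -> : K * L ^+ 2 + K * L = K1 * c by rewrite /K1 divfK // lt0r_neq0.
rewrite mulrAC; apply: ler_pM => //.
- by rewrite mulr_ge0.
- exact: ltW.
- by apply: ler_wpM2r => //; lra.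
Qed.

Lemma pencil_branches : exists sigma : 'I_d -> C -> C, 
  [/\ forall j, C11 (sigma j) (fun z => B.[sigma j z] / (deriv (Q z)).[sigma j z]),
      forall j z, nm z <= 1 -> root (Q z) (sigma j z) &
      forall i j z, nm z <= 1 -> sigma i z = sigma j z -> i = j].
Proof.
have [c c0 hc] := pencil_deriv_lb; have [K K0 hK] := pencil_second_order.
have hK3 z s t : nm z <= 1 -> nm s <= 1 -> nm t <= 1 ->
    nm ((Q z).[s] - (Q z).[t] - (deriv (Q z)).[t] * (s - t)) <= K * nm (s - t) ^+ 2.
  by move=> hz hs ht; case: (hK z s t hz hs ht).
(* Dividing by 5 makes K (4 e) = 4 c / 5, below the separation constant c. *)
pose e := c / K / 5; have e0 : 0 < e by rewrite !divr_gt0.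
have small : K * (4 * e) < c.
  rewrite (_ : K * (4 * e) = c * (4 / 5)); last by rewrite /e; field; rewrite lt0r_neq0.
  by rewrite gtr_pMr //; lra.
have [eta eta0 heta] := near_root e0.
have := archi_boundP (ltW (divr_gt0 ltr01 eta0)); move: (Num.bound _) => M0 hM0.
pose M := M0.+1; have Mp : (0 < M)%N by [].
have fine : M%:R^-1 <= eta.
  rewrite -[_^-1]mul1r ler_pdivrMr ?ltr0n // mulrC -ler_pdivrMr //.
  by apply: (le_trans (ltW hM0)); rewrite ler_nat.
have n0 : nm (0 : C) <= 1 by rewrite nm0.
have [rs [urs srs ars]] := roots n0.
pose sigma (j : 'I_d) := continued_root e M rs`_j M.
have hr (j : 'I_d) : root (Q 0) rs`_j by apply: (allP ars); rewrite mem_nth // srs.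
have MM : rc (M%:R / M%:R : R) = 1 by rewrite divff // pnatr_eq0.
have hroot j z : nm z <= 1 -> root (Q z) (sigma j z).
  move=> hz; have [h _] := continued_rootP heta Mp fine (hr j) (leqnn M) hz.
  by rewrite MM mul1r in h.
exists sigma; split=> //.
- move=> j; apply: (branch_C11 (e := e) (eta := eta) c0 K0 eta0 hc hK small) => //.
    by move=> z hz; exact: hroot.
  move=> z z' hz hz' zz.
  exact: (continued_root_near hc hK3 K0 heta small Mp fine (hr j) (leqnn M)).
- move=> i j z hz eq; apply: val_inj; apply/eqP.
  have := continued_root_inj hc hK3 K0 heta small Mp fine (hr i) (hr j) (leqnn M) hz (ltW e0) eq.
  by move=> /eqP; rewrite nth_uniq ?srs.
Qed.

End Branches.

(** * Partial fractions and rational self-maps of the disc *)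

Section PartialFractions.
Variable F : numFieldType.

Lemma partial_fractions (d : nat) (s : 'I_d -> F) (c : F) (N Q : {poly F}) (x : F) :
  injective s -> c != 0 -> Q = c *: \prod_j ('X - (s j)%:P) -> (size N <= d.+1)%N ->
  (forall j, x != s j) ->
  N.[x] / Q.[x] = N`_d / c + \sum_j N.[s j] / (deriv Q).[s j] / (x - s j).
Proof.
move=> sI c0 eQ sN xs.
pose T j := c *: \prod_(i | i != j) ('X - (s i)%:P).
have QT j : Q = ('X - (s j)%:P) * T j by rewrite eQ /T (bigD1 j) //= scalerAr.
have Qs j : Q.[s j] = 0 by rewrite (QT j) hornerM hornerXsubC subrr mul0r.
have Ts j k : j != k -> (T j).[s k] = 0.
  by move=> jk; rewrite hornerZ horner_prod (bigD1 k) 1?eq_sym //= hornerXsubC subrr mul0r mulr0.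
have TQ j : (T j).[s j] = (deriv Q).[s j].
  by rewrite (QT j) derivM derivXsubC hornerD !hornerM hornerC hornerXsubC subrr mul0r addr0 mul1r.
have T0 j : (T j).[s j] != 0.
  rewrite hornerZ mulf_neq0 // horner_prod; apply/prodf_neq0 => i ij.
  by rewrite hornerXsubC subr_eq0 (inj_eq sI) eq_sym.
have sQ : size Q = d.+1.
  by rewrite eQ size_scale // -big_enum size_prod_XsubC size_enum_ord.
have sT j : (size (T j) <= d)%N.
  have Tn : T j != 0 by apply: contraNneq (T0 j) => ->; rewrite horner0.
  have := sQ; rewrite (QT j) size_monicM ?monicXsubC // size_XsubC add2n => /eqP.
  by rewrite eqSS => /eqP ->.
have Qd : Q`_d = c.
  have := lead_coefZ c (\prod_j ('X - (s j)%:P)); rewrite -eQ lead_coefE sQ /= => ->.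
  by rewrite (monicP (monic_prod_XsubC _ _ _)) mulr1.
pose D := N - (N`_d / c) *: Q - \sum_j (N.[s j] / (deriv Q).[s j]) *: T j.
have D0 : D = 0.
  apply: (@roots_geq_poly_eq0 _ D [seq s j | j <- enum 'I_d]).
  - apply/allP => _ /mapP [k _ ->]; rewrite /root /D !hornerD !hornerN hornerZ Qs mulr0 subr0.
    rewrite horner_sum (bigD1 k) //= big1 ?addr0 => [|j jk]; last by rewrite hornerZ Ts ?mulr0.
    have Qk : (deriv Q).[s k] != 0 by rewrite -TQ.
    by rewrite hornerZ TQ divfK // subrr.
  - by rewrite map_inj_uniq ?enum_uniq.
  - rewrite size_map size_enum_ord; apply/leq_sizeP => i di.
    rewrite coefB coefB coefZ coef_sum big1 ?subr0 => [|j _]; last first.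
      by rewrite coefZ nth_default ?mulr0 // (leq_trans (sT j)).
    move: di; rewrite leq_eqVlt => /orP[/eqP <-|di]; first by rewrite Qd divfK ?subrr.
    have Ni : N`_i = 0 by apply: nth_default; apply: leq_trans sN _.
    have Qi : Q`_i = 0 by apply: nth_default; rewrite sQ.
    by rewrite Ni Qi mulr0 subr0.
have Qx : Q.[x] != 0.
  rewrite eQ hornerZ mulf_neq0 // horner_prod; apply/prodf_neq0 => i _.
  by rewrite hornerXsubC subr_eq0.
have := congr1 (horner^~ x) D0; rewrite horner0 /D !hornerD !hornerN hornerZ horner_sum.
move=> /eqP; rewrite subr_eq0 subr_eq => /eqP ->.
rewrite mulrDl addrC mulfK // mulr_suml; congr (_ + _); apply: eq_bigr => j _.
have xj : x - s j != 0 by rewrite subr_eq0.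
rewrite hornerZ {2}(QT j) hornerM hornerXsubC.
have Tx : (T j).[x] != 0.
  by apply: contraNneq Qx => h; rewrite (QT j) hornerM h mulr0.
by rewrite -!mulrA; congr (_ * (_ * _)); field; rewrite xj.
Qed.

End PartialFractions.

(** * Reflection in the unit circle and conjugate reversal *)

Section Reversal.
Variable R : realType.
Local Notation C := (CC R).

(* [z^d conj (P (1 / conj z))] *)
Definition crev (d : nat) (P : {poly C}) : {poly C} := \poly_(i < d.+1) (P`_(d - i))^*.

Lemma size_crev d P : (size (crev d P) <= d.+1)%N. Proof. exact: size_poly. Qed.

Lemma coef_crev_lead d P : (crev d P)`_d = (P.[0])^*.
Proof. by rewrite coef_poly ltnSn subnn horner_coef0. Qed.

Lemma horner_crev0 d P : (crev d P).[0] = (P`_d)^*.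
Proof. by rewrite horner_coef0 coef_poly subn0. Qed.

Lemma horner_crev d (P : {poly C}) (s : C) : (size P <= d.+1)%N -> s != 0 ->
  (crev d P).[s] = s ^+ d * (P.[(s^*)^-1])^*.
Proof.
move=> sP s0; rewrite horner_poly (horner_coef_wide _ sP) rmorph_sum mulr_sumr.
rewrite (reindex_inj rev_ord_inj) /=; apply: eq_bigr => i _.
have id : (i <= d)%N by rewrite -ltnS.
rewrite subSS subKn // rmorphM rmorphXn fmorphV /= conjCK mulrCA exprVn.
by rewrite expfB_cond // (negbTE s0).
Qed.

Lemma rhoK : involutive (@rho R).
Proof.
case=> [z|] /=; last by rewrite eqxx.
case: eqP => [-> //|/eqP z0] /=; rewrite invr_eq0 conjC_eq0 (negbTE z0).
by rewrite fmorphV /= conjCK invrK.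
Qed.

End Reversal.

(** * The pencil of a rational self-map of the disc *)

Section RationalSelfMap.
Variable R : realType.
Local Notation C := (CC R).
Variables p q : {poly C}.
Hypothesis pq : coprimep p q.
Hypothesis q_neq0 : q != 0.
Hypothesis disc : maps_disc_into_disc p q.
Let d := rat_deg p q.
Let A := crev d q.
Let B := crev d p.
Let Q (z : C) : {poly C} := A - z *: B.

Lemma size_le_rat_degl : (size p <= d.+1)%N.
Proof. by apply: leq_trans (leqSpred _) _; rewrite ltnS leq_maxl. Qed.

Lemma size_le_rat_degr : (size q <= d.+1)%N.
Proof. by apply: leq_trans (leqSpred _) _; rewrite ltnS leq_maxr. Qed.

Lemma selfmap_lt u : nm u < 1 -> nm p.[u] < nm q.[u].
Proof.
rewrite -nm_lt1 => /disc [w]; rewrite /rat_eval; case: eqP => // /eqP qu [<-].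
by rewrite nm_lt1 nm_div ltr_pdivrMr ?mul1r // nm_gt0.
Qed.

(** A point of the circle is moved inwards by t; the strict inequality there returns with an error
    of at most (K + L) t, and t is arbitrary. *)
Lemma selfmap_le u : nm u <= 1 -> nm p.[u] <= nm q.[u].
Proof.
rewrite le_eqVlt => /orP[/eqP hu|/selfmap_lt/ltW //].
have [K K0 hK] := poly_bounds p; have [L L0 hL] := poly_bounds q.
apply/ler_addgt0Pr => e e0.
pose t := Num.min (1 / 2) (e / (K + L + 1)); have KL : 0 < K + L + 1 by lra.
have t0 : 0 < t by rewrite lt_min !divr_gt0.
have t1 : t <= 1 / 2 by rewrite ge_min lexx.
have te : t * (K + L + 1) <= e by rewrite -ler_pdivlMr // ge_min lexx orbT.
pose v := rc (1 - t) * u.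
have hv : nm v = 1 - t by rewrite nmM hu mulr1 nm_rc ger0_norm; lra.
have uv : nm (u - v) = t.
  have -> : u - v = rc t * u by rewrite /v rcB rc1; ring.
  by rewrite nmM hu mulr1 nm_rc gtr0_norm.
have v1 : nm v < 1 by rewrite hv; lra.
have hu1 : nm u <= 1 by rewrite hu.
have [_ _ h1 _] := hK u v hu1 (ltW v1); have [_ _ h2 _] := hL v u (ltW v1) hu1.
rewrite [nm (v - u)]nm_distC uv in h2; rewrite uv in h1.
have h3 := selfmap_lt v1.
have h4 := nmD (p.[u] - p.[v]) p.[v]; have h5 := nmD (q.[v] - q.[u]) q.[u].
rewrite !subrK in h4 h5; lra.
Qed.

Lemma denominator_neq0 u : nm u <= 1 -> q.[u] != 0.
Proof.
move=> hu; apply/negP => /eqP qu; have := selfmap_le hu.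
rewrite qu nm0 => h; have /eqP : nm p.[u] = 0 by apply/eqP; rewrite eq_le h nm_ge0.
rewrite nm_eq0 => /eqP pu; have := coprimep_root pq (introT eqP pu).
by rewrite qu eqxx.
Qed.

(** Away from 0 this is conjugation and clearing of denominators at u = 1 / conj s, with the zeros
    of q and p apart because one of the values is infinite there. At s = 0 the point u is infinity,
    and the coefficients of degree d decide. *)
Lemma rat_eval_e_root s z : (rat_eval_e p q (Some s) = Some z) <-> root (Q z) s.
Proof.
rewrite /root /Q !hornerE /A /B.
have [->|s0] := eqVneq s 0; last first.
  rewrite !horner_crev ?size_le_rat_degl ?size_le_rat_degr //.
  rewrite /rat_eval_e /rho (negbTE s0) /rat_eval.
  set u := (s^*)^-1.
  have -> : s ^+ d * (q.[u])^* - z * (s ^+ d * (p.[u])^*) = s ^+ d * ((q.[u])^* - z * (p.[u])^*) by ring.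
  rewrite mulf_eq0 expf_eq0 (negbTE s0) andbF /= subr_eq0.
  have [qu|qu] := eqVneq q.[u] 0.
    have pu : p.[u] != 0.
      by move: pq; rewrite coprimep_sym => qp; exact: coprimep_root qp (introT eqP qu).
    rewrite qu rmorph0 eq_sym mulf_eq0 conjC_eq0 (negbTE pu) orbF.
    by split=> [[<-]|/eqP ->]; rewrite ?eqxx.
  have [pu|pu] := eqVneq p.[u] 0.
    by rewrite pu mul0r eqxx rmorph0 mulr0 conjC_eq0 (negbTE qu); split.
  rewrite mulf_eq0 invr_eq0 (negbTE pu) (negbTE qu) /= rmorphM fmorphV /= invfM invrK.
  have pc : (p.[u])^* != 0 by rewrite conjC_eq0.
  split=> [[<-]|/eqP ->]; first by rewrite mulrAC mulVf // mul1r eqxx.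
  by rewrite mulrCA mulVf ?mulr1.
rewrite !horner_crev0 /rat_eval_e /= eqxx /=.
have q1 : (0 < size q)%N by rewrite lt0n size_poly_eq0.
case: ltngtP => h.
- have dp : d = (size p).-1 by rewrite /d /rat_deg; apply/maxn_idPl; rewrite -!subn1 leq_sub2r // ltnW.
  have qd : q`_d = 0 by rewrite nth_default // dp -ltnS prednK // (leq_ltn_trans _ h).
  have pd : p`_d != 0 by rewrite dp -lead_coefE lead_coef_eq0 -size_poly_eq0 -lt0n (leq_ltn_trans _ h).
  rewrite /= qd rmorph0 sub0r oppr_eq0 mulf_eq0 conjC_eq0 (negbTE pd) orbF.
  by split=> [[<-]|/eqP ->]; rewrite ?eqxx.
- have dq : d = (size q).-1 by rewrite /d /rat_deg; apply/maxn_idPr; rewrite -!subn1 leq_sub2r // ltnW.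
  have pd : p`_d = 0 by rewrite nth_default // dq -ltnS prednK.
  rewrite /= eqxx pd rmorph0 mulr0 subr0 conjC_eq0 dq -lead_coefE lead_coef_eq0 (negbTE q_neq0).
  by split.
- have dq : d = (size q).-1 by rewrite /d /rat_deg -h maxnn.
  have pn : lead_coef p != 0 by rewrite lead_coef_eq0 -size_poly_eq0 -h size_poly_eq0.
  have qn : lead_coef q != 0 by rewrite lead_coef_eq0.
  have -> : p`_d = lead_coef p by rewrite lead_coefE dq h.
  have -> : q`_d = lead_coef q by rewrite lead_coefE dq.
  rewrite /= mulf_eq0 invr_eq0 (negbTE pn) (negbTE qn) /= subr_eq0 rmorphM fmorphV /= invfM invrK.
  have pc : (lead_coef p)^* != 0 by rewrite conjC_eq0.
  split=> [[<-]|/eqP ->]; first by rewrite mulrAC mulVf // mul1r eqxx.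
  by rewrite mulrCA mulVf ?mulr1.
Qed.

Lemma root_pencil_inv z s : s != 0 -> root (Q z) s ->
  nm q.[(s^*)^-1] = nm z * nm p.[(s^*)^-1].
Proof.
move=> s0; rewrite /root /Q !hornerE /A /B !horner_crev ?size_le_rat_degl ?size_le_rat_degr //.
set u := (s^*)^-1.
have -> : s ^+ d * (q.[u])^* - z * (s ^+ d * (p.[u])^*) = s ^+ d * ((q.[u])^* - z * (p.[u])^*) by ring.
rewrite mulf_eq0 expf_eq0 (negbTE s0) andbF /= subr_eq0 => /eqP h.
by rewrite -nm_conj h nmM nm_conj.
Qed.

(** A root outside the closed disc would reflect to a point u inside with |q(u)| = |z| |p(u)| <=
    |p(u)|, against |p(u)| < |q(u)|. *)
Lemma root_pencil_disc z s : nm z <= 1 -> root (Q z) s -> nm s <= 1.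
Proof.
move=> hz hs; rewrite leNgt; apply/negP => s1.
have s0 : s != 0 by rewrite -nm_gt0 (lt_trans ltr01).
have := root_pencil_inv s0 hs; set u := _^-1 => e.
have hu : nm u < 1 by rewrite nmV nm_conj invf_lt1 // (lt_trans ltr01).
have := selfmap_lt hu; rewrite e => h.
have : 0 <= (1 - nm z) * nm p.[u] by rewrite mulr_ge0 ?nm_ge0 // subr_ge0.
by lra.
Qed.

Lemma root_pencil_open_disc z s : nm z < 1 -> root (Q z) s -> nm s < 1.
Proof.
move=> hz hs; rewrite lt_neqAle (root_pencil_disc (ltW hz) hs) andbT; apply/eqP => s1.
have s0 : s != 0 by rewrite -nm_gt0 s1.
have := root_pencil_inv s0 hs; set u := _^-1 => e.
have hu : nm u <= 1 by rewrite nmV nm_conj s1 invr1.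
have := denominator_neq0 hu; rewrite -nm_gt0 => q0.
have h1 : 0 <= nm z * (nm q.[u] - nm p.[u]) by rewrite mulr_ge0 ?nm_ge0 // subr_ge0 selfmap_le.
have h2 : 0 < (1 - nm z) * nm q.[u] by rewrite mulr_gt0 // subr_gt0.
by lra.
Qed.

Lemma lead_pencil z : (Q z)`_d = (q.[0])^* - z * (p.[0])^*.
Proof. by rewrite coefB coefZ !coef_crev_lead. Qed.

Lemma selfmap0 : nm p.[0] < nm q.[0].
Proof. by apply: selfmap_lt; rewrite nm0. Qed.

(** The degree of the pencil is constant because |phi(0)| < 1. *)
Lemma lead_pencil_lb z : nm z <= 1 -> nm q.[0] - nm p.[0] <= nm (Q z)`_d.
Proof.
move=> hz; rewrite lead_pencil; have := nmD ((q.[0])^* - z * (p.[0])^*) (z * (p.[0])^*).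
rewrite subrK !nm_conj nmM nm_conj.
have : 0 <= (1 - nm z) * nm p.[0] by rewrite mulr_ge0 ?nm_ge0 // subr_ge0.
by lra.
Qed.

(** [rho] carries the d preimages of rho(z) under phi to roots of the pencil. None of them is 0, the
    point sent to infinity, since |phi(0)| < 1 while rho(z) is outside the disc. *)
Lemma pencil_roots : outer_regular p q -> forall z, nm z <= 1 ->
  exists rs : seq C, [/\ uniq rs, size rs = d & all (root (Q z)) rs].
Proof.
move=> reg z hz.
have hrz : match rho (Some z) return Prop with None => True | Some y => 1 <= `|y| end.
  rewrite /=; case: eqP => // /eqP z0.
  by rewrite nmE -rc1 rc_le nmV nm_conj invf_ge1 // nm_gt0.
have [l [ul sl hl]] := reg _ hrz.
pose fin (x : sphere R) : C := odflt 0 (rho x).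
have hx x : x \in l -> rho x = Some (fin x) /\ root (Q z) (fin x).
  move=> /hl ex; have ey : rho x = Some (fin x).
    rewrite /fin; case: x ex => [x|] ex //=; case: eqP => // x0.
    move: ex; rewrite x0 /rat_eval (negbTE (denominator_neq0 _)) ?nm0 // => ex.
    move: hrz; rewrite -ex nmE -rc1 rc_le nm_div ler_pdivlMr ?mul1r.
      by rewrite leNgt selfmap0.
    by rewrite nm_gt0 denominator_neq0 ?nm0.
  split=> //; apply/rat_eval_e_root.
  by rewrite /rat_eval_e -ey rhoK ex rhoK.
exists (map fin l); split; rewrite ?size_map //.
  rewrite map_inj_in_uniq // => x y /hx [ex _] /hx [ey _] e.
  by rewrite -(rhoK x) -(rhoK y) ex ey e.
by apply/allP => _ /mapP [x /hx [_ h] ->].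
Qed.

Lemma phi_C11 : exists phi', C11 (fun z => p.[z] / q.[z]) phi'.
Proof.
have [c c0 hc] := poly_lower_bound denominator_neq0.
eexists; apply: C11M (C11_poly p (@C11_id R)) (C11V c0 hc (C11_poly q (@C11_id R))).
Qed.

Lemma phi_funE z : nm z <= 1 -> phi_fun p q z = p.[z] / q.[z].
Proof. by move=> hz; rewrite /phi_fun /rat_eval (negbTE (denominator_neq0 hz)). Qed.

Lemma nm_phi_lt1 z : nm z < 1 -> nm (p.[z] / q.[z]) < 1.
Proof.
move=> hz; rewrite nm_div ltr_pdivrMr ?mul1r ?selfmap_lt //.
by rewrite nm_gt0 denominator_neq0 // ltW.
Qed.

Lemma nm_phi_le1 z : nm z <= 1 -> nm (p.[z] / q.[z]) <= 1.
Proof.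
move=> hz; rewrite nm_div ler_pdivrMr ?mul1r ?selfmap_le //.
by rewrite nm_gt0 denominator_neq0.
Qed.

Lemma rat_eval_infinity v : rat_eval p q None = Some v -> q`_d != 0 /\ v = p`_d / q`_d.
Proof.
rewrite /rat_eval; case: ltngtP => // h [<-].
  have dq : d = (size q).-1 by rewrite /d /rat_deg; apply/maxn_idPr; rewrite -!subn1 leq_sub2r // ltnW.
  split; first by rewrite dq -lead_coefE lead_coef_eq0.
  rewrite [p`_d]nth_default ?mul0r // dq -ltnS prednK //.
  by rewrite lt0n size_poly_eq0.
have dq : d = (size q).-1 by rewrite /d /rat_deg -h maxnn.
split; first by rewrite dq -lead_coefE lead_coef_eq0.
by rewrite !lead_coefE dq h.
Qed.

End RationalSelfMap.

(** * The adjoint formula *)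

Section Adjoint.
Variable R : realType.
Local Notation C := (CC R).

Lemma C11_disc_op (f f' g : C -> C) : C11 f f' -> (forall z, nm z < 1 -> g z = f z) ->
  [/\ holo_on_disc g, bounded_on_disc g & bounded_op (mulop g)].
Proof.
move=> hf e; split; last exact: mulop_bounded hf e.
  by move=> z; rewrite nm_lt1 => hz; have [] := C11_is_derive hf e hz.
have [K K0 hK] := C11_lip hf; exists (rc K) => z; rewrite nm_lt1 => hz.
by rewrite e // nmE rc_le; have [] := hK z z (ltW hz) (ltW hz).
Qed.

Lemma H2coef_of_one : H2coef_of (fun=> 1 : C) (fun n => (n == 0%N)%:R).
Proof.
apply/H2coefP; split=> [|z hz].
  exists 1 => -[|N]; first by rewrite big_ord0.
  rewrite big_ord_recl /= nm1 expr1n big1 ?addr0 // => i _.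
  by rewrite nm0 expr0n.
apply/cvgC => e e0; exists 1%N => -[//|N] _.
rewrite /series /= big_nat_recl // expr0 mulr1 big1 ?addr0 ?subrr ?nm0 ?ltW // => i _.
by rewrite mul0r.
Qed.

(** The coefficients of z k_s(z). Pairing with this function evaluates the backward shift at s,
    which is how B enters the formula. *)
Definition shifted_kernel_coef (s : C) (n : nat) : C := if n is m.+1 then s^* ^+ m else 0.

Lemma H2coef_of_shifted_kernel (s : C) : nm s < 1 ->
  H2coef_of (fun z => z / (1 - s^* * z)) (shifted_kernel_coef s).
Proof.
move=> hs; have hs' : nm (s^*) < 1 by rewrite nm_conj.
apply/H2coefP; split=> [|z hz].
  have [S hS] := l2_geo hs'; exists S => -[|N]; first by rewrite big_ord0 (l2le_ge0 hS).
  by rewrite big_ord_recl /= nm0 expr0n add0r; exact: hS.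
have hsz : nm (s^* * z) < 1.
  by rewrite nmM; apply: le_lt_trans hs'; rewrite ler_piMr ?nm_ge0 // ltW.
have h : (fun N => z * series (fun n => (s^* * z) ^+ n) N) @ \oo --> z / (1 - s^* * z).
  by apply: cvgMr; exact: cvg_geo.
apply/cvgC => e e0; have [M hM] := (cvgC _ _).1 h e e0; exists M.+1 => -[//|N] MN.
rewrite /series /= big_nat_recl // mul0r add0r; have := hM N MN; rewrite /series /= mulr_sumr.
by rewrite (eq_bigr (fun i => s^* ^+ i * z ^+ i.+1)) // => i _; rewrite exprMn exprS mulrCA.
Qed.

Lemma l2pair_one (b : nat -> C) : l2pair (fun n => (n == 0%N)%:R) b = b 0%N.
Proof.
apply: l2pair_eq; apply/cvgC => e e0; exists 1%N => -[//|N] _.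
rewrite /series /= big_nat_recl // mul1r big1 ?addr0 ?subrr ?nm0 ?ltW // => i _.
by rewrite mul0r.
Qed.

Lemma l2pair_shifted_kernel (s : C) g b : nm s < 1 -> H2coef_of g b ->
  l2pair (shifted_kernel_coef s) (fun n => (b n)^*) = (bshift g s)^*.
Proof.
move=> hs hg; have [_ /(_ s hs) h] := (H2coefP _ _).1 (H2_bshift hg).
apply: l2pair_eq; apply/cvgC => e e0; have [M hM] := (cvgC _ _).1 h e e0.
exists M.+1 => -[//|N] MN; have := hM N MN.
rewrite -nm_conj rmorphB /series /= (rmorph_sum Num.conj) big_nat_recl // mul0r add0r.
by rewrite (eq_bigr (fun i => s^* ^+ i * (b i.+1)^*)) // => i _; rewrite rmorphM rmorphXn mulrC.
Qed.

(* The last hypothesis reads [G w = <g, k_w o phi>], where [k_w] is the reproducing kernel of H^2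
   at [w]. *)
Lemma adjoint_of_kernels (phi s s' g G : C -> C) : C11 s s' ->
  (forall z, nm z <= 1 -> nm (s z) <= 1) -> (forall z, nm z < 1 -> nm (s z) < 1) ->
  (forall z, nm z < 1 -> phi z = s z) -> inH2 g -> inH2 G ->
  (forall w c, nm w < 1 -> H2coef_of (compo phi (fun z => (1 - w^* * z)^-1)) c ->
     l2pair c (fun n => (H2coef g n)^*) = (G w)^*) ->
  forall f, inH2 f -> H2inner (compo phi f) g = H2inner f G.
Proof.
move=> hs s1 s2 e ig iG hG f /H2coef_ofE hf.
have [_ [t [ht1 ht]]] := compo_op hs s1 s2 e.
have hg := H2coef_ofE ig; have hGc := H2coef_ofE iG.
have [lg _] := (H2coefP _ _).1 hg; have [lG sG] := (H2coefP _ _).1 hGc.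
set b := fun n => (H2coef g n)^*.
have lb : l2 b by exact: l2_conj.
(* [D n] is <g, phi^n>, the coefficient of z^n in the image of g under the adjoint. The kernels show
   that the series of [D] sums to [G]. *)
pose D n := (l2pair (t n) b)^*.
have eD : H2coef G = D.
  have [K hK] := l2_bounded lG; have [S hS] := lb.
  apply: (@power_series_unique _ _ _ (Num.max K ((1 * 1 + S / 1) / 2))) => [n|n|w hw].
  - by rewrite le_max hK.
  - by rewrite le_max nm_conj (l2pair_le (ht1 n) hS) // orbT.
  exists (G w); split; first exact: sG.
  have hk : H2coef_of (fun z => (1 - w^* * z)^-1) (fun n => w^* ^+ n).
    have h1 := @H2_Lambda R w (fun=> 1) hw.
    have e1 : (fun n => (fun=> 1 : C) (0 : C) * w^* ^+ n) = (fun n => w^* ^+ n).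
      by apply/funext => n; rewrite mul1r.
    rewrite e1 in h1; apply: H2coef_of_ext h1 => z _.
    by rewrite /Lambda mul1r.
  have [c [hc1 hc2]] := ht _ _ hk; have := hc2 b lb; rewrite (hG w c hw hc1) => h.
  apply/cvgC => eps eps0; have [M hM] := (cvgC _ _).1 h eps eps0; exists M => n /hM.
  rewrite -nm_conj rmorphB /= conjCK (rmorph_sum Num.conj) /series /= big_mkord.
  rewrite (eq_bigr (fun i : 'I_n => D i * w ^+ i)) // => i _.
  by rewrite rmorphM rmorphXn /= conjCK mulrC.
have [c [hc1 hc2]] := ht _ _ hf.
rewrite (H2innerE hc1 hg) /H2inner eD; symmetry; apply: cvg_limC.
have e1 : series (fun n => H2coef f n * (D n)^*) = (fun N => \sum_(n < N) H2coef f n * l2pair (t n) b).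
  by apply/funext => N; rewrite /series /= big_mkord; apply: eq_bigr => n _; rewrite /D conjCK.
by rewrite e1; exact: hc2.
Qed.

End Adjoint.

(** * Partial fractions of the kernels composed with phi *)

Section AdjointFormula.
Variable R : realType.
Local Notation C := (CC R).
Variables p q : {poly C}.
Hypothesis pq : coprimep p q.
Hypothesis q_neq0 : q != 0.
Hypothesis disc : maps_disc_into_disc p q.
Hypothesis reg : outer_regular p q.
Local Notation d := (rat_deg p q).
Let A := crev d q.
Let B := crev d p.
Let Q (z : C) : {poly C} := A - z *: B.
Let deriv_branch (s : C -> C) (z : C) : C := B.[s z] / (deriv (Q z)).[s z].

Lemma lead_gap : 0 < nm q.[0] - nm p.[0].
Proof. by rewrite subr_gt0 (selfmap0 disc). Qed.

Lemma selfmap_branches : exists sigma : 'I_d -> C -> C,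
  [/\ forall j, C11 (sigma j) (deriv_branch (sigma j)),
      forall j z, nm z <= 1 -> root (Q z) (sigma j z) &
      forall i j z, nm z <= 1 -> sigma i z = sigma j z -> i = j].
Proof.
(* A constant phi has no branches, and the continuation requires positive degree. *)
have [d0|d0] := posnP d.
  have no (j : 'I_d) : False by move: (ltn_ord j); rewrite {2}d0.
  by exists (fun j => False_rect _ (no j)); split=> j; case: (no j).
exact: (pencil_branches d0 (size_crev _ _) (size_crev _ _) lead_gap
  (@lead_pencil_lb _ p q) (pencil_roots pq q_neq0 disc reg) (@root_pencil_disc _ p q disc)).
Qed.

Variable sigma : 'I_d -> C -> C.
Hypothesis sC11 : forall j, C11 (sigma j) (deriv_branch (sigma j)).
Hypothesis sroot : forall j z, nm z <= 1 -> root (Q z) (sigma j z).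
Hypothesis sinj : forall i j z, nm z <= 1 -> sigma i z = sigma j z -> i = j.

Lemma branch_disc j z : nm z < 1 -> nm (sigma j z) < 1.
Proof. by move=> hz; apply: (root_pencil_open_disc pq disc hz); apply: sroot; exact: ltW. Qed.

Lemma branch_closed_disc j z : nm z <= 1 -> nm (sigma j z) <= 1.
Proof. by move=> hz; apply: (root_pencil_disc disc hz); exact: sroot. Qed.

Lemma lead_pencil_neq0 z : nm z <= 1 -> (Q z)`_d != 0.
Proof.
by move=> hz; rewrite -nm_gt0; apply: lt_le_trans lead_gap (lead_pencil_lb p q hz).
Qed.

Lemma pencil_prod w : nm w <= 1 -> Q w = (Q w)`_d *: \prod_j ('X - (sigma j w)%:P).
Proof.
move=> hw; have sQ : size (Q w) = d.+1.
  exact: (size_pencil (size_crev _ _) (size_crev _ _) lead_gap (@lead_pencil_lb _ p q)).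
rewrite [LHS](@all_roots_prod_XsubC _ _ [seq sigma j w | j <- enum 'I_d]).
- by rewrite lead_coefE sQ big_map big_enum.
- by rewrite size_map size_enum_ord.
- by apply/allP => _ /mapP [j _ ->]; exact: sroot.
- by rewrite uniq_rootsE map_inj_uniq ?enum_uniq // => i j; exact: sinj.
Qed.

Lemma branch_eq j z : nm z <= 1 -> A.[sigma j z] = z * B.[sigma j z].
Proof.
by move=> hz; have := rootP (sroot j hz); rewrite horner_pencil => /eqP; rewrite subr_eq0 => /eqP.
Qed.

(** The residue at a branch value s is A(s) / Q_w'(s), and A(s) = w B(s) there, so it is w times the
    derivative of the branch. *)
Lemma pencil_fractions w x : nm w <= 1 -> (forall j, x != sigma j w) ->
  A.[x] / (Q w).[x] = (q.[0])^* / (Q w)`_d + \sum_j w * deriv_branch (sigma j) w / (x - sigma j w).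
Proof.
move=> hw hx.
rewrite (partial_fractions _ (lead_pencil_neq0 hw) (pencil_prod hw) (size_crev _ _) hx).
  rewrite coef_crev_lead; congr (_ + _); apply: eq_bigr => j _.
  by rewrite branch_eq // /deriv_branch mulrA.
by move=> i j; exact: sinj.
Qed.

Lemma kernel_fractions w z : nm w < 1 -> nm z < 1 ->
  (1 - w * (p.[z] / q.[z])^*)^-1 = (q.[0])^* / (Q w)`_d +
    \sum_j w * deriv_branch (sigma j) w * (z^* / (1 - sigma j w * z^*)).
Proof.
move=> hw hz; have qz : (q.[z])^* != 0 by rewrite conjC_eq0 (denominator_neq0 pq disc) // ltW.
have eK : (1 - w * (p.[z] / q.[z])^*)^-1 = (q.[z])^* / ((q.[z])^* - w * (p.[z])^*).
  by rewrite rmorphM fmorphV /= -[RHS]invf_div; congr (_^-1); field.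
(* z = 0 corresponds to x at infinity, where only the constant term is left. *)
have [z0|z0] := eqVneq z 0.
  rewrite eK z0 rmorph0 big1 ?addr0 => [|j _]; last by rewrite mul0r mulr0.
  by rewrite (lead_pencil p q w).
have x0 : (z^*)^-1 != 0 by rewrite invr_eq0 conjC_eq0.
have x1 : 1 < nm (z^*)^-1 by rewrite nmV nm_conj invf_gt1 // nm_gt0.
have hx j : (z^*)^-1 != sigma j w.
  apply: contraTneq x1 => ->; rewrite -leNgt; apply: branch_closed_disc; exact: ltW.
have := pencil_fractions (ltW hw) hx.
rewrite horner_pencil /A /B !horner_crev ?(size_le_rat_degl p q) ?(size_le_rat_degr p q) //.
rewrite fmorphV /= conjCK invrK.
set X := (z^*)^-1 ^+ d; have X0 : X != 0 by rewrite expf_neq0.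
have -> : X * (q.[z])^* - w * (X * (p.[z])^*) = X * ((q.[z])^* - w * (p.[z])^*) by ring.
rewrite -mulf_div divff // mul1r eK => ->; congr (_ + _); apply: eq_bigr => j _.
congr (_ * _); have zc : z^* != 0 by rewrite conjC_eq0.
by rewrite -[RHS]invf_div; congr (_^-1); rewrite mulrBl mul1r mulfK.
Qed.

Lemma phi_fun0 : phi_fun p q 0 = p.[0] / q.[0].
Proof. by rewrite (phi_funE pq disc) // nm0. Qed.

Lemma Lambda0_coef w : nm w < 1 -> (q.[0])^* / (Q w)`_d = (1 - (phi_fun p q 0)^* * w)^-1.
Proof.
move=> hw; have n0 : nm (0 : C) < 1 by rewrite nm0.
have := kernel_fractions hw n0; rewrite -phi_fun0 [w * _]mulrC => ->.
by rewrite rmorph0 big1 ?addr0 // => j _; rewrite mul0r mulr0.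
Qed.

(** [kernel_fractions] describes the conjugate of k_w(phi(z)). After conjugation the constant term
    pairs with g to give the term with g(0), and the shifted kernels give the values of the backward
    shift at the branches. *)
Lemma kernel_pairing g b w c : H2coef_of g b -> nm w < 1 ->
  H2coef_of (compo (phi_fun p q) (fun z => (1 - w^* * z)^-1)) c ->
  l2pair c (fun n => (b n)^*) =
  (Lambda (phi_fun p q 0) g w + \sum_j w * deriv_branch (sigma j) w * bshift g (sigma j w))^*.
Proof.
move=> hg hw hc; have [lb _] := (H2coefP _ _).1 hg; have lcb := l2_conj lb.
pose a j := (w * deriv_branch (sigma j) w)^*.
pose k j := shifted_kernel_coef (sigma j w).
have hk j := H2coef_of_shifted_kernel (branch_disc j hw).
have lk j : l2 (k j) by have [] := (H2coefP _ _).1 (hk j).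
pose e0 := ((q.[0])^* / (Q w)`_d)^*.
have -> : c = (fun n => e0 * (n == 0%N)%:R + \sum_j a j * k j n).
  apply: H2coef_of_unique hc _.
  apply: H2coef_of_ext (H2coef_ofD (H2coef_ofZ e0 (@H2coef_of_one R))
    (H2coef_of_sum (index_enum 'I_d) (fun j => H2coef_ofZ (a j) (hk j)))) => z hz.
  rewrite /compo (phi_funE pq disc (ltW hz)).
  have := congr1 Num.conj (kernel_fractions hw hz).
  rewrite fmorphV rmorphB rmorph1 rmorphM /= conjCK => ->.
  rewrite rmorphD mulr1 (rmorph_sum Num.conj); congr (_ + _); apply: eq_bigr => j _.
  rewrite rmorphM; congr (_ * _).
  by rewrite rmorphM fmorphV rmorphB rmorph1 rmorphM /= !conjCK.
have l1 : l2 (fun n => (n == 0%N)%:R : C) by have [] := (H2coefP _ _).1 (@H2coef_of_one R).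
have lak : l2 (fun n => \sum_j a j * k j n) by apply: l2_sum => j; exact: l2Z.
rewrite (l2pairDl (l2Z e0 l1) lak lcb) (l2pairZl e0 l1 lcb) (l2pair_suml _ _ lk lcb) l2pair_one.
rewrite rmorphD (rmorph_sum Num.conj); congr (_ + _).
  by rewrite -rmorphM (Lambda0_coef hw) /Lambda (H2coef0 hg) mulrC.
by apply: eq_bigr => j _; rewrite (l2pair_shifted_kernel (branch_disc j hw) hg) rmorphM.
Qed.

Lemma pencil_deriv_lb_rat : exists2 c : R, 0 < c &
  forall z s, nm z <= 1 -> root (Q z) s -> c <= nm (deriv (Q z)).[s].
Proof.
have [d0|d0] := posnP d.
  exists 1 => // z s hz; have := size_pencil (size_crev d q) (size_crev d p) lead_gap (@lead_pencil_lb _ p q) hz.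
  rewrite d0 => /eqP /size_poly1P [x x0 e] hs; move: hs; rewrite /Q /A /B d0 e.
  by rewrite rootC (negbTE x0).
exact: (pencil_deriv_lb d0 (size_crev _ _) (size_crev _ _) lead_gap
  (@lead_pencil_lb _ p q) (pencil_roots pq q_neq0 disc reg) (@root_pencil_disc _ p q disc)).
Qed.

Lemma horner_pencil0_lb z : nm z <= 1 -> nm q`_d - nm p`_d <= nm (Q z).[0].
Proof.
move=> hz; rewrite horner_pencil !horner_crev0.
have := nmD ((q`_d)^* - z * (p`_d)^*) (z * (p`_d)^*); rewrite subrK !nm_conj nmM nm_conj.
have : 0 <= (1 - nm z) * nm p`_d by rewrite mulr_ge0 ?nm_ge0 // subr_ge0.
by lra.
Qed.

(* As [Q z] vanishes at [sigma j z], the value [(Q z).[0]] is at most a multiple of [|sigma j z|]. *)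
Lemma branch_lb : nm p`_d < nm q`_d -> exists2 c : R, 0 < c &
  forall j z, nm z <= 1 -> c <= nm (sigma j z).
Proof.
move=> pd; have [K K0 hK] := poly_bounds A; have [L L0 hL] := poly_bounds B.
have KL : 0 < K + L + 1 by lra.
exists ((nm q`_d - nm p`_d) / (K + L + 1)); first by rewrite divr_gt0 // subr_gt0.
move=> j z hz; rewrite ler_pdivrMr //; apply: (le_trans (horner_pencil0_lb hz)).
have n0 : nm (0 : C) <= 1 by rewrite nm0.
have s1 := branch_closed_disc j hz.
have [_ _ hA _] := hK 0 _ n0 s1; have [_ _ hB _] := hL 0 _ n0 s1.
rewrite sub0r nmN in hA hB.
have -> : (Q z).[0] = (A.[0] - A.[sigma j z]) - z * (B.[0] - B.[sigma j z]).
  by rewrite horner_pencil (branch_eq j hz); ring.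
apply: (le_trans (nmB_le hA (nmM_le hz hB))); have := nm_ge0 (sigma j z); lra.
Qed.

Lemma derive_branch j z : nm z < 1 -> 'D_1 (sigma j) z = deriv_branch (sigma j) z.
Proof. by move=> hz; have [] := C11_is_derive (sC11 j) (fun x _ => erefl) hz. Qed.

Lemma deriv_branch_C11 j : exists f', C11 (deriv_branch (sigma j)) f'.
Proof.
have [c c0 hc] := pencil_deriv_lb_rat.
have hd := C11D (C11_poly A^`() (sC11 j)) (C11M (C11_cst (-1)) (C11M (@C11_id R) (C11_poly B^`() (sC11 j)))).
have [f' hd2] : exists f', C11 (fun z => (deriv (Q z)).[sigma j z]) f'.
  eexists; apply: C11_ext hd => z _; split; last reflexivity.
  by rewrite horner_pencil_deriv; ring.
have lb z : nm z <= 1 -> c <= nm (deriv (Q z)).[sigma j z].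
  by move=> hz; apply: hc => //; exact: sroot.
eexists; exact: C11M (C11_poly B (sC11 j)) (C11V c0 lb hd2).
Qed.

Lemma hfun_C11 j : exists f', C11 (fun z => z * deriv_branch (sigma j) z) f'.
Proof. by have [f' h] := deriv_branch_C11 j; eexists; exact: C11M (@C11_id R) h. Qed.

Lemma gfun_C11 j : nm p`_d < nm q`_d ->
  exists f', C11 (fun z => z * deriv_branch (sigma j) z / sigma j z) f'.
Proof.
move=> pd; have [f' h] := hfun_C11 j; have [c c0 hc] := branch_lb pd.
by eexists; exact: C11M h (C11V c0 (hc j) (sC11 j)).
Qed.

(** The point x = 0 corresponds to z at infinity, where the left side of the fractions is the kernel
    at phi(oo); it is not a pole because the branches stay away from 0. *)
Lemma Lambda_infinity v w : rat_eval p q None = Some v -> `|v| < 1 -> nm w < 1 ->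
  (1 - v^* * w)^-1 = (q.[0])^* / (Q w)`_d - \sum_j w * deriv_branch (sigma j) w / sigma j w.
Proof.
move=> /(rat_eval_infinity q_neq0) [qd ->] hv hw; rewrite nm_lt1 nm_div ltr_pdivrMr ?nm_gt0 // mul1r in hv.
have pd := hv; have hx j : 0 != sigma j w.
  have [c c0 hc] := branch_lb pd.
  by rewrite eq_sym -nm_gt0 (lt_le_trans c0) // hc // ltW.
have := pencil_fractions (ltW hw) hx; rewrite horner_pencil !horner_crev0 => e.
have qc : (q`_d)^* != 0 by rewrite conjC_eq0.
have -> : (1 - (p`_d / q`_d)^* * w)^-1 = (q`_d)^* / ((q`_d)^* - w * (p`_d)^*).
  by rewrite rmorphM fmorphV /= -[RHS]invf_div; congr (_^-1); field.
rewrite e -sumrN; congr (_ + _); apply: eq_bigr => j _.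
by rewrite sub0r invrN mulrN.
Qed.

End AdjointFormula.

Theorem theorem4p5 (R : realType) (p q : {poly CC R}) :
  coprimep p q -> q != 0 -> maps_disc_into_disc p q ->
  outer_regular p q ->
  exists sigma : 'I_(rat_deg p q) -> CC R -> CC R,
    (* part (a) *)
    [/\ forall j, branch_e_on_disc p q (sigma j) /\
                  (forall z, `|z| < 1 -> `|sigma j z| < 1),
        forall i j, i != j -> exists2 z : CC R, `|z| < 1 & sigma i z != sigma j z,
        forall j, holo_on_disc (hfun (sigma j)) /\ bounded_on_disc (hfun (sigma j)),
        [/\ bounded_op (compo (phi_fun p q)), bounded_op (Lambda (phi_fun p q 0)),
            bounded_op (@bshift R),
            forall j, bounded_op (mulop (hfun (sigma j))) &
            forall j, bounded_op (compo (sigma j))] &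
        forall f g, inH2 f -> inH2 g ->
          H2inner (compo (phi_fun p q) f) g =
          H2inner f (fun z => Lambda (phi_fun p q 0) g z +
             \sum_(j < rat_deg p q) mulop (hfun (sigma j)) (compo (sigma j) (bshift g)) z)]
    /\
    (* part (b) *)
    (strongly_outer_regular p q ->
      [/\ bounded_op (Lambda (odflt 0 (rat_eval p q None))),
          forall j, holo_on_disc (gfun (sigma j)) /\ bounded_on_disc (gfun (sigma j)),
          forall j, bounded_op (mulop (gfun (sigma j))) &
          forall f g, inH2 f -> inH2 g ->
            H2inner (compo (phi_fun p q) f) g =
            H2inner f (fun z => Lambda (odflt 0 (rat_eval p q None)) g z +
               \sum_(j < rat_deg p q) mulop (gfun (sigma j)) (compo (sigma j) g) z)]).
Proof.
move=> pq q0 disc reg.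
have [sigma [sC11 sroot sinj]] := selfmap_branches pq q0 disc reg.
have sdisc j z : nm z < 1 -> nm (sigma j z) < 1 := branch_disc pq disc sroot j (z := z).
have scdisc j z : nm z <= 1 -> nm (sigma j z) <= 1 := branch_closed_disc disc sroot j (z := z).
have hE j z : nm z < 1 -> hfun (sigma j) z = z * _ :=
  fun hz => congr1 (fun y => z * y) (derive_branch sC11 j hz).
have hop j := let: ex_intro f' h := hfun_C11 pq q0 disc reg sC11 sroot j in C11_disc_op h (hE j).
have [phi' phiC11] := phi_C11 pq disc.
have phiE z : nm z < 1 -> phi_fun p q z = p.[z] / q.[z] by move=> hz; rewrite (phi_funE pq disc (ltW hz)).
have phi1 := nm_phi_le1 pq disc; have phi2 := nm_phi_lt1 pq disc.
have n0 : nm (0 : CC R) < 1 by rewrite nm0.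
have phi00 : nm (phi_fun p q 0) < 1 by rewrite phiE // phi2.
have compo_s j : bounded_op (compo (sigma j)).
  by have [] := compo_op (sC11 j) (scdisc j) (sdisc j) (fun z _ => erefl).
have bH2 (T : (CC R -> CC R) -> CC R -> CC R) f : bounded_op T -> inH2 f -> inH2 (T f).
  by move=> [M [_ h]] /h [].
pose Ga g z := Lambda (phi_fun p q 0) g z +
   \sum_(j < rat_deg p q) mulop (hfun (sigma j)) (compo (sigma j) (bshift g)) z.
have GaH2 g : inH2 g -> inH2 (Ga g).
  move=> ig; apply: inH2D; first exact: (bH2 _ _ (Lambda_bounded phi00) ig).
  apply: inH2_sum => j; have [_ _ mb] := hop j.
  exact: (bH2 _ _ mb (bH2 _ _ (compo_s j) (bH2 _ _ (@bshift_bounded R) ig))).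
have adj f g : inH2 f -> inH2 g -> H2inner (compo (phi_fun p q) f) g = H2inner f (Ga g).
  move=> hf hg.
  apply: (adjoint_of_kernels phiC11 phi1 phi2 phiE hg (GaH2 g hg) _ hf) => w c hw hc.
  rewrite (kernel_pairing pq disc sroot sinj (H2coef_ofE hg) hw hc).
  congr (_^*); congr (_ + _); apply: eq_bigr => j _.
  by rewrite /mulop /compo (hE j w hw).
exists sigma; split.
  split; last exact: adj.
  - move=> j; split; last by move=> z; rewrite !nm_lt1; exact: sdisc.
    split=> z; rewrite nm_lt1 => hz.
      by have [] := C11_is_derive (sC11 j) (fun x _ => erefl) hz.
    by apply/(rat_eval_e_root pq q0); exact: sroot (ltW hz).
  - move=> i j ij; exists 0; first by rewrite nm_lt1.
    by apply: contra ij => /eqP /(sinj i j _ (ltW n0)) ->.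
  - by move=> j; have [h1 h2 _] := hop j; split; [exact: h1|exact: h2].
  - split; last exact: compo_s.
    + by have [h _] := compo_op phiC11 phi1 phi2 phiE; exact: h.
    + exact: Lambda_bounded.
    + exact: bshift_bounded.
    + by move=> j; have [_ _ h] := hop j; exact: h.
move=> [_ [v hv v1]]; rewrite hv /=.
have [qd ev] := rat_eval_infinity q0 hv.
have pd : nm p`_(rat_deg p q) < nm q`_(rat_deg p q).
  by move: v1; rewrite ev nm_lt1 nm_div ltr_pdivrMr ?mul1r // nm_gt0.
have gE j z : nm z < 1 -> gfun (sigma j) z = _ :=
  fun hz => congr1 (fun y => y / sigma j z) (hE j z hz).
have gop j := let: ex_intro f' h := gfun_C11 pq q0 disc reg sC11 sroot j pd in C11_disc_op h (gE j).
split.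
- by apply: Lambda_bounded; rewrite -nm_lt1.
- by move=> j; have [h1 h2 _] := gop j; split; [exact: h1|exact: h2].
- by move=> j; have [_ _ h] := gop j; exact: h.
(* The two right sides agree on the disc, hence have the same coefficients, so that (b) follows from
   (a). *)
move=> f g hf hg; rewrite (adj f g hf hg) /H2inner.
suff -> : H2coef (Ga g) = H2coef (fun z => Lambda v g z +
   \sum_(j < rat_deg p q) mulop (gfun (sigma j)) (compo (sigma j) g) z) by [].
have hG := H2coef_ofE (GaH2 g hg); apply/esym/H2coefE.
apply: H2coef_of_ext hG => z hz.
have [c c0 hc] := branch_lb disc sroot pd.
(* Replacing phi(oo) by phi(0) produces the terms -g(0) h_j / sigma_j, which match h_j (B
   g)(sigma_j) = (h_j / sigma_j) (g(sigma_j) - g(0)). *)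
rewrite /Ga /Lambda (Lambda_infinity q0 disc sroot sinj hv v1 hz).
rewrite -(Lambda0_coef pq disc sroot sinj hz).
rewrite mulrBr -addrA; congr (_ + _); rewrite mulr_sumr -sumrN -big_split /=.
apply: eq_bigr => j _; rewrite /mulop /compo (hE j z hz) (gE j z hz).
have s0 : sigma j z != 0 by rewrite -nm_gt0 (lt_le_trans c0) // hc // ltW.
by rewrite /bshift (negbTE s0); move: (_.[_] / _) => D; field.
Qed.
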